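(* Let $k\ge 1$ and $q\ge 1$ be fixed natural numbers and let $f:\{0,1\}^{k+1}\to\{0,1\}$ be a non-degenerate boolean function, and suppose $n\le c\, d^k/\log_{(q)} d$ (where $d=d(n)$) for a constant $c>0$ depending only on $k,q$. Then there exists a constant $\gamma=\gamma(k,q)>0$ such that any (randomized) mechanism which, for every database $D\in\{0,1\}^{n\times(d+1)}$, outputs $\mathbf y\in\mathbb R^{d^k}$ such that for at least a $1-\gamma$ fraction of the indices $J$ one has $|y_J-\Sigma_f(D)_J|=o(\sqrt n)$ (the remaining entries may carry arbitrary noise), or equivalently the same for $\Sigma_f(D)/n$ with $o(1/\sqrt n)$ in place of $o(\sqrt n)$, is attribute non-private. The attack achieving this violation runs in time $O(d^{2k}n^3+d^{2.5k}n^2)$.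
   Context: Every function $\{0,1\}^{m}\to\mathbb R$ has a unique representation as a multilinear polynomial over the reals. A function $f:\{0,1\}^{k+1}\to\{0,1\}$ is non-degenerate if its multilinear polynomial representation has degree exactly $k+1$. A database is $D=(U\,|\,\mathbf s)$ where $U=(\delta_{i,j})\in\{0,1\}^{n\times d}$ is public and $\mathbf s=(s_1,\dots,s_n)\in\{0,1\}^n$ is the sensitive column. For $J=(j_1,\dots,j_k)\in\{1,\dots,d\}^k$ (repeated entries allowed) let $F(D|_J)=\sum_{i=1}^n f(\delta_{i,j_1},\dots,\delta_{i,j_k},s_i)$, and $\Sigma_f(D)=(F(D|_J))_{J\in\{1,\dots,d\}^k}\in\mathbb R^{d^k}$. Iterated logarithm: $\log_{(1)}t=\max(\log t,1)$, $\log_{(q+1)}t=\log_{(1)}(\log_{(q)}t)$. A randomized mechanism $\mathcal M$ allows $(\alpha,\beta)$ attribute reconstruction if there exist a setting $U$ of the public attributes and an algorithm $\mathcal A$ such that for every $\mathbf s\in\{0,1\}^n$, $\Pr_{\mathbf y\leftarrow\mathcal M((U|\mathbf s))}[d_H(\mathbf s,\mathcal A(U,\mathbf y))\le\alpha]\ge1-\beta$ ($d_H$ = Hamming distance). A family of mechanisms (indexed by $n$, $d=d(n)$) is attribute non-private if for an infinite sequence of $n$ it allows $(\alpha,\beta)$ reconstruction with $\alpha=o(n)$, $\beta=o(1)$. *)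

(* Defs.v *)
From HB Require Import structures.
From mathcomp Require Import all_boot all_order all_algebra.
From mathcomp Require Import all_classical all_reals all_analysis.
From mathcomp Require Import -(notations) mpoly.

Set Implicit Arguments.
Unset Strict Implicit.
Unset Printing Implicit Defensive.
Import Order.TTheory GRing.Theory Num.Theory.
Import numFieldNormedType.Exports.

Local Open Scope classical_set_scope.
Local Open Scope ring_scope.

(* [mpoly.msize p] is 1 + the total degree of p (and 0 for p = 0). *)
Definition multilinear (R : realType) (m : nat) (p : mpoly.mpoly m R) : Prop :=
  forall u, u \in mpoly.msupp p -> forall i : 'I_m, (u i <= 1)%N.

Definition represents (R : realType) (m : nat) (p : mpoly.mpoly m R)
    (f : m.-tuple bool -> bool) : Prop :=
  forall x : m.-tuple bool,
    mpoly.meval (fun i : 'I_m => (tnth x i)%:R) p = (f x)%:R.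

Definition non_degenerate (R : realType) (m : nat)
    (f : m.-tuple bool -> bool) : Prop :=
  exists p : mpoly.mpoly m R,
    [/\ multilinear p, represents p f & mpoly.msize p = m.+1].

(* [iterlog q.+1 t] is log_(q+1) t; the base case [iterlog 0 t = t] makes
   [iterlog 1 t = max (log t) 1]. *)
Fixpoint iterlog (R : realType) (q : nat) (t : R) : R :=
  if q is q'.+1 then Num.max (ln (iterlog q' t)) 1 else t.

Definition admissible (R : realType) (k q : nat) (c : R) (n d : nat) : Prop :=
  n%:R <= c * d%:R ^+ k / iterlog q d%:R.

(* A database (U | s) is the matrix [row_mx U s]. *)
Definition database (n d : nat) := 'M[bool]_(n, d + 1).

Definition answers (R : realType) (d k : nat) := k.-tuple 'I_d -> R.

Definition Sigma (R : realType) (k n d : nat) (f : k.+1.-tuple bool -> bool)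
    (D : database n d) : answers R d k := fun J =>
  \sum_(i < n)
    (f [tuple of rcons [tuple of [seq lsubmx D i j | j <- J]]
                       (rsubmx D i ord0)])%:R.

Definition target (R : realType) (k n d : nat) (averaged : bool)
    (f : k.+1.-tuple bool -> bool) (D : database n d) : answers R d k := fun J =>
  if averaged then Sigma R f D J / n%:R else Sigma R f D J.

Definition noise_rate (R : realType) (averaged : bool) (n : nat) : R :=
  if averaged then (Num.sqrt n%:R)^-1 else Num.sqrt n%:R.

(* A randomized mechanism, with internal coins w drawn from [coins_law]. *)
Record mechanism (R : realType) (n d k : nat) := Mechanism {
  coins_display : measure_display ;
  coins : measurableType coins_display ;
  coins_law : probability coins R ;
  release :> database n d -> coins -> answers R d k ;
  release_measurable : forall D J,
    measurable_fun setT (fun w => release D w J) }.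

(* All but a gamma fraction of the entries carry noise o(noise_rate),
   uniformly over the databases and almost surely over the coins. *)
Definition accurate (R : realType) (k : nat) (d : nat -> nat)
    (averaged : bool) (f : k.+1.-tuple bool -> bool) (gamma : R)
    (M : forall n, mechanism R n (d n) k) : Prop :=
  exists2 err : nat -> R, err =o_\oo (noise_rate R averaged) &
  forall n, (0 < n)%N -> forall D : database n (d n),
  {ae coins_law (M n), forall w,
    (1 - gamma) * (d n ^ k)%:R <=
      #|[pred J | `|M n D w J - target R averaged f D J| <= err n]|%:R}.

Definition hamming (n : nat) (s t : 'cV[bool]_n) : nat :=
  #|[pred i | s i ord0 != t i ord0]|.

Definition attack (R : realType) (k : nat) :=
  forall n d : nat, 'M[bool]_(n, d) -> answers R d k -> 'cV[bool]_n.

Definition reconstructs (R : realType) (k n d : nat) (A : attack R k)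
    (M : mechanism R n d k) (alpha beta : R) : Prop :=
  exists U : 'M[bool]_(n, d), forall s : 'cV[bool]_n,
    let success :=
      [set w | (hamming s (A n d U (M (row_mx U s) w)))%:R <= alpha] in
    measurable success /\ ((1 - beta)%:E <= coins_law M success)%E.

(* M is attribute non-private, the violation being achieved by A. *)
Definition attribute_nonprivate_by (R : realType) (k : nat) (d : nat -> nat)
    (A : attack R k) (M : forall n, mechanism R n (d n) k) : Prop :=
  exists (nu : nat -> nat) (alpha beta : nat -> R),
  [/\ {homo nu : i j / (i < j)%N},
      alpha =o_\oo (fun i => (nu i)%:R : R),
      beta =o_\oo (fun=> 1 : R) &
      forall i, reconstructs A (M (nu i)) (alpha i) (beta i)].

(* Running time is measured on a unit-cost real RAM, presented as a structured
   language: natural-number index registers with + and truncated -, arrays of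
   reals with exact field operations and comparisons, and no rounding from
   reals to naturals. Programs contain no real constants. Every node of an
   evaluated expression and every executed command costs one step. *)
Inductive nexp : Type :=
  | NReg of nat
  | NConst of nat
  | NAdd of nexp & nexp
  | NSub of nexp & nexp.

Inductive rexp : Type :=
  | RNat of nexp
  | RCell of nat & nexp
  | RAdd of rexp & rexp
  | RSub of rexp & rexp
  | RMul of rexp & rexp
  | RDiv of rexp & rexp.

Inductive bexp : Type :=
  | BNle of nexp & nexp
  | BRle of rexp & rexp
  | BNot of bexp
  | BAnd of bexp & bexp.

Inductive cmd : Type :=
  | Skip
  | SetReg of nat & nexp
  | SetCell of nat & nexp & rexp
  | Seq of cmd & cmd
  | If of bexp & cmd & cmd
  | While of bexp & cmd.

Record state (R : realType) := State {
  reg : nat -> nat ;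
  cell : nat -> nat -> R }.

Fixpoint neval (r : nat -> nat) (e : nexp) : nat :=
  match e with
  | NReg x => r x
  | NConst m => m
  | NAdd a b => (neval r a + neval r b)%N
  | NSub a b => (neval r a - neval r b)%N
  end.

Fixpoint reval (R : realType) (st : state R) (e : rexp) : R :=
  match e with
  | RNat a => (neval (reg st) a)%:R
  | RCell t a => cell st t (neval (reg st) a)
  | RAdd a b => reval st a + reval st b
  | RSub a b => reval st a - reval st b
  | RMul a b => reval st a * reval st b
  | RDiv a b => reval st a / reval st b
  end.

Fixpoint beval (R : realType) (st : state R) (e : bexp) : bool :=
  match e with
  | BNle a b => (neval (reg st) a <= neval (reg st) b)%N
  | BRle a b => reval st a <= reval st b
  | BNot a => ~~ beval st a
  | BAnd a b => beval st a && beval st b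
  end.

Fixpoint ncost (e : nexp) : nat :=
  match e with
  | NReg _ | NConst _ => 1
  | NAdd a b | NSub a b => (ncost a + ncost b).+1
  end.

Fixpoint rcost (e : rexp) : nat :=
  match e with
  | RNat a | RCell _ a => (ncost a).+1
  | RAdd a b | RSub a b | RMul a b | RDiv a b => (rcost a + rcost b).+1
  end.

Fixpoint bcost (e : bexp) : nat :=
  match e with
  | BNle a b => (ncost a + ncost b).+1
  | BRle a b => (rcost a + rcost b).+1
  | BNot a => (bcost a).+1
  | BAnd a b => (bcost a + bcost b).+1
  end.

Definition set_reg (R : realType) (st : state R) (x v : nat) : state R :=
  State (fun y => if y == x then v else reg st y) (cell st).

Definition set_cell (R : realType) (st : state R) (t i : nat) (v : R) : state R :=
  State (reg st)
    (fun u j => if (u == t) && (j == i) then v else cell st u j).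

(* [exec P st st' T]: from st, P halts in st' after exactly T steps. *)
Inductive exec (R : realType) : cmd -> state R -> state R -> nat -> Prop :=
  | ExecSkip st : exec Skip st st 1
  | ExecSetReg st x e :
      exec (SetReg x e) st (set_reg st x (neval (reg st) e)) (ncost e).+1
  | ExecSetCell st t i e :
      exec (SetCell t i e) st
        (set_cell st t (neval (reg st) i) (reval st e)) (ncost i + rcost e).+1
  | ExecSeq st1 st2 st3 p1 p2 T1 T2 :
      exec p1 st1 st2 T1 -> exec p2 st2 st3 T2 ->
      exec (Seq p1 p2) st1 st3 (T1 + T2).+1
  | ExecIf st st' b p1 p2 T :
      exec (if beval st b then p1 else p2) st st' T ->
      exec (If b p1 p2) st st' (bcost b + T).+1
  | ExecWhileStop st b p :
      beval st b = false -> exec (While b p) st st (bcost b).+1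
  | ExecWhileLoop st1 st2 st3 b p T1 T2 :
      beval st1 b -> exec p st1 st2 T1 -> exec (While b p) st2 st3 T2 ->
      exec (While b p) st1 st3 (bcost b + T1 + T2).+1.

Definition tuple_code (d k : nat) (J : k.-tuple 'I_d) : nat :=
  foldl (fun a (j : 'I_d) => (a * d + j)%N) 0%N J.

(* Input: n and d in registers 0 and 1, U row by row in array 0, y in array 1
   in lexicographic order of J; everything else is 0. *)
Definition input_state (R : realType) (k n d : nat) (U : 'M[bool]_(n, d))
    (y : answers R d k) : state R :=
  State
    (fun x => if x == 0%N then n else if x == 1%N then d else 0%N)
    (fun t a =>
      if t == 0%N then
        if [pick ij : 'I_n * 'I_d | (ij.1 * d + ij.2)%N == a] is Some ij
        then (U ij.1 ij.2)%:R else 0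
      else if t == 1%N then
        if [pick J : k.-tuple 'I_d | tuple_code J == a] is Some J
        then y J else 0
      else 0).

(* Output: the bits of s in array 2, a nonzero cell standing for 1. *)
Definition output_secret (R : realType) (n : nat) (st : state R) :
    'cV[bool]_n :=
  \col_(i < n) (cell st 2%N i != 0).

Definition computes_within (R : realType) (k : nat) (P : cmd) (A : attack R k)
    (n d : nat) (B : R) : Prop :=
  forall (U : 'M[bool]_(n, d)) (y : answers R d k),
  exists (st : state R) (T : nat),
    [/\ exec P (input_state U y) st T,
        output_secret n st = A n d U y & T%:R <= B].

(* Main.v *)
(* The analyst is free to choose U.  Reserve g ~ d/(2k) pairs of columns for each
   of the k positions of a query.  Taking the alternating sum of the answers over
   the 2^k ways of picking one column from each of k pairs kills all but the
   leading term of f: what is left is (W v)_p, where W_{p,i} is the product of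
   the k pair differences in row i and v_i takes one of two values, according
   to s_i, whose difference is the top coefficient of f, a nonzero integer.

   For n = m^k, U can be chosen so that W is the k-th Kronecker power of a g x m
   sign matrix E.  By Kashin's theorem (a union bound over integer points) there
   is such an E, with g a constant times m, satisfying |Ex|_1 >= lam g |x|_2 and
   |Ex|_2 <= kap sqrt(g) |x|_2; Minkowski's inequality passes both bounds on to
   the Kronecker power.  They make l1 regression immune to arbitrary noise on a
   small constant fraction of the N = g^k equations.  Subgradient descent with n
   steps of length 1/N is within O(N) of the optimum, which is negligible against
   N sqrt(n), so its mean is within O(1) + o(sqrt n) of v in l2 norm, and rounding
   it errs in o(n) places. *)
Require Import Defs.
From mathcomp Require Import all_boot all_order all_algebra.
From mathcomp Require Import all_classical all_reals all_analysis.
From mathcomp Require Import measurable_realfun.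
From mathcomp Require Import -(notations) mpoly.
From mathcomp Require Import ring lra zify.
Import Order.TTheory GRing.Theory Num.Theory.
Import numFieldNormedType.Exports.

Local Open Scope classical_set_scope.
Local Open Scope ring_scope.

Set Implicit Arguments.
Unset Strict Implicit.
Unset Printing Implicit Defensive.

(** * Sign matrices with a Euclidean section property *)

Section RandomSigns.
Context {R : realType}.

Definition bsign (b : bool) : R := if b then 1 else -1.

Lemma bsignN b : bsign (~~ b) = - bsign b.
Proof. by case: b; rewrite /bsign ?opprK. Qed.

Lemma bsign_sqr b : bsign b ^+ 2 = 1.
Proof. by case: b; rewrite /bsign ?sqrrN expr1n. Qed.

Section OneRow.
Variable m : nat.
Implicit Types (x : 'I_m -> R) (e : {ffun 'I_m -> bool}).

Definition flip (i : 'I_m) e : {ffun 'I_m -> bool} :=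
  [ffun j => if j == i then ~~ e j else e j].

Lemma flipK i : involutive (flip i).
Proof.
by move=> e; apply/ffunP => j; rewrite !ffunE; case: eqP => // _; rewrite negbK.
Qed.

Definition rademacher x e : R := \sum_i bsign (e i) * x i.

Lemma rademacher_moments x (r : seq 'I_m) : uniq r ->
  \sum_(e : {ffun 'I_m -> bool}) (\sum_(i <- r) bsign (e i) * x i) ^+ 2
    = #|{ffun 'I_m -> bool}|%:R * \sum_(i <- r) x i ^+ 2 /\
  \sum_(e : {ffun 'I_m -> bool}) (\sum_(i <- r) bsign (e i) * x i) ^+ 4
    <= #|{ffun 'I_m -> bool}|%:R * (3 * (\sum_(i <- r) x i ^+ 2) ^+ 2).
Proof.
elim: r => [_|i r IH /= /andP[ir ur]].
  under eq_bigr do rewrite big_nil expr0n.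
  under [X in _ /\ X <= _]eq_bigr do rewrite big_nil expr0n.
  by rewrite !big_nil !big1 //= expr0n /= !mulr0 lexx.
have {IH ur} [IH2 IH4] := IH ur.
set K : R := #|_|%:R in IH2 IH4 *.
pose S e := \sum_(j <- r) bsign (e j) * x j.
have SF e : S (flip i e) = S e.
  apply: eq_big_seq => j jr; rewrite ffunE ifN //.
  by apply: contraNneq ir => <-.
have symm (F : R -> R -> R) :
    \sum_(e : {ffun 'I_m -> bool}) F (S e) (bsign (e i)) = \sum_(e : {ffun 'I_m -> bool}) F (S e) (- bsign (e i)).
  rewrite (reindex_inj (inv_inj (flipK i))) /=; apply: eq_bigr => e _.
  by rewrite SF ffunE eqxx bsignN.
have avg (F : R -> R -> R) : \sum_(e : {ffun 'I_m -> bool}) F (S e) (bsign (e i)) =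
    \sum_(e : {ffun 'I_m -> bool}) (F (S e) (bsign (e i)) + F (S e) (- bsign (e i))) / 2.
  rewrite -mulr_suml big_split /= -symm; by field.
have E2 : \sum_(e : {ffun 'I_m -> bool}) (\sum_(j <- i :: r) bsign (e j) * x j) ^+ 2
    = \sum_(e : {ffun 'I_m -> bool}) (S e ^+ 2) + K * x i ^+ 2.
  under eq_bigr do rewrite big_cons addrC.
  rewrite (avg (fun s b => (s + b * x i) ^+ 2)) /K -sum1_card natr_sum mulr_suml.
  rewrite -big_split /=; apply: eq_bigr => e _.
  by rewrite /bsign; case: (e i); field.
have E4 : \sum_(e : {ffun 'I_m -> bool}) (\sum_(j <- i :: r) bsign (e j) * x j) ^+ 4
    = \sum_(e : {ffun 'I_m -> bool}) (S e ^+ 4) + 6 * x i ^+ 2 * (\sum_(e : {ffun 'I_m -> bool}) S e ^+ 2) + K * x i ^+ 4.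
  under eq_bigr do rewrite big_cons addrC.
  rewrite (avg (fun s b => (s + b * x i) ^+ 4)) /K -sum1_card natr_sum mulr_suml.
  rewrite mulr_sumr -!big_split /=; apply: eq_bigr => e _.
  by rewrite /bsign; case: (e i); field.
rewrite E2 E4 !big_cons -/S; split; first by rewrite IH2; ring.
rewrite IH2; apply: (@le_trans _ _ (K * (3 * (\sum_(j <- r) x j ^+ 2) ^+ 2)
   + 6 * x i ^+ 2 * (K * (\sum_(j <- r) x j ^+ 2)) + K * x i ^+ 4)).
  by rewrite !lerD2r.
have K0 : 0 <= K by rewrite ler0n.
rewrite -subr_ge0; set s := \sum_(j <- r) _.
suff -> : K * (3 * (x i ^+ 2 + s) ^+ 2) - (K * (3 * s ^+ 2) +
  6 * x i ^+ 2 * (K * s) + K * x i ^+ 4) = 2 * K * (x i ^+ 2) ^+ 2.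
  by rewrite mulr_ge0 ?sqr_ge0 // mulr_ge0.
by ring.
Qed.

Definition sqnorm x : R := \sum_i x i ^+ 2.

Lemma sqnorm_ge0 x : 0 <= sqnorm x.
Proof. by apply: sumr_ge0 => i _; rewrite sqr_ge0. Qed.

(* Paley-Zygmund: on t = S^2/|x|^2 the quadratic (t - 1/4)(6 - t) is negative
   below 1/4 and has mean at least 7/4, as E t = 1 and E t^2 <= 3. *)
Lemma rademacher_small_ball x :
  \sum_(e : {ffun 'I_m -> bool}) (if sqnorm x / 4 <= rademacher x e ^+ 2 then 1 / 2 else 1 : R)
    <= 9 / 10 * #|{ffun 'I_m -> bool}|%:R.
Proof.
set K : R := #|_|%:R.
have K0 : 0 <= K by rewrite ler0n.
have [M2 M4] := rademacher_moments x (index_enum_uniq 'I_m).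
rewrite -/(sqnorm x) -/K in M2 M4.
have [X0|Xn0] := eqVneq (sqnorm x) 0.
  under eq_bigr do rewrite X0 mul0r sqr_ge0.
  rewrite sumr_const -[X in X <= _]mulr_natl -/K; lra.
have X0 : 0 < sqnorm x by rewrite lt_def Xn0 sqnorm_ge0.
set X := sqnorm x in X0 Xn0 M2 M4 *.
pose q e : R := 1 - 6 / 100 * ((rademacher x e ^+ 2 / X - 1 / 4)
                                * (6 - rademacher x e ^+ 2 / X)).
apply: (@le_trans _ _ (\sum_(e : {ffun 'I_m -> bool}) q e)).
  apply: ler_sum => e _; rewrite /q.
  set t := rademacher x e ^+ 2 / X.
  have -> : (X / 4 <= rademacher x e ^+ 2) = (1 / 4 <= t).
    by rewrite /t ler_pdivlMr // mul1r mulrC.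
  case: (lerP (1/4) t) => ht; first by have := sqr_ge0 (t - 25 / 8); nra.
  have : 0 <= (1 / 4 - t) * (6 - t) by rewrite mulr_ge0 //; lra.
  nra.
have -> : \sum_(e : {ffun 'I_m -> bool}) q e = K * (1 + 9 / 100) - 6 / 100 * (25 / 4) / X * (\sum_(e : {ffun 'I_m -> bool}) rademacher x e ^+ 2)
    + 6 / 100 / X ^+ 2 * \sum_(e : {ffun 'I_m -> bool}) rademacher x e ^+ 4.
  rewrite /K -sum1_card natr_sum mulr_suml !mulr_sumr -sumrN -!big_split /=.
  by apply: eq_bigr => e _; rewrite /q; field.
rewrite M2.
have -> : 6 / 100 * (25 / 4) / X * (K * X) = 6 / 100 * (25 / 4) * K by field.
have : 6 / 100 / X ^+ 2 * (\sum_(e : {ffun 'I_m -> bool}) rademacher x e ^+ 4) <= 18 / 100 * K.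
  rewrite (_ : 18 / 100 * K = 6 / 100 / X ^+ 2 * (K * (3 * X ^+ 2))); last by field.
  by rewrite ler_wpM2l // divr_ge0 ?sqr_ge0 //; lra.
lra.
Qed.

End OneRow.

Lemma cosh_le (t : R) : (expR t + expR (- t)) / 2 <= expR (2 * t ^+ 2).
Proof.
have t2 := expR_ge1Dx (2 * t ^+ 2).
have [ht|ht] := lerP (t ^+ 2) (1 / 4).
  apply: le_trans t2.
  have l1 : 0 < 1 - t by nra.
  have l2 : 0 < 1 + t by nra.
  have h1 : expR t <= (1 - t)^-1.
    rewrite -[t in expR t]opprK expRN lef_pV2 ?posrE ?expR_gt0 //.
    exact: expR_ge1Dx.
  have h2 : expR (- t) <= (1 + t)^-1.
    rewrite expRN lef_pV2 ?posrE ?expR_gt0 //.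
    exact: expR_ge1Dx.
  apply: (@le_trans _ _ (((1 - t)^-1 + (1 + t)^-1) / 2)); first lra.
  have -> : ((1 - t)^-1 + (1 + t)^-1) / 2 = (1 - t ^+ 2)^-1.
    by field; rewrite ?gt_eqF //; nra.
  rewrite -(mul1r (_^-1)) ler_pdivrMr; nra.
have e1 : expR t <= expR (2 * t ^+ 2) by rewrite ler_expR; nra.
have e2 : expR (- t) <= expR (2 * t ^+ 2) by rewrite ler_expR; nra.
lra.
Qed.

End RandomSigns.

Lemma cauchy_schwarz_sum {R : realType} (I : finType) (a b : I -> R) :
  (\sum_i a i * b i) ^+ 2 <= (\sum_i a i ^+ 2) * (\sum_i b i ^+ 2).
Proof.
rewrite -subr_ge0.
suff -> : (\sum_i a i ^+ 2) * (\sum_i b i ^+ 2) - (\sum_i a i * b i) ^+ 2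
    = (\sum_i \sum_j (a i * b j - a j * b i) ^+ 2) / 2.
  by rewrite divr_ge0 // sumr_ge0 // => i _; rewrite sumr_ge0 // => j _; rewrite sqr_ge0.
have E1 : (\sum_i a i ^+ 2) * (\sum_i b i ^+ 2)
    = \sum_i \sum_j a i ^+ 2 * b j ^+ 2.
  by rewrite mulr_suml; apply: eq_bigr => i _; rewrite mulr_sumr.
have E2 : (\sum_i a i ^+ 2) * (\sum_i b i ^+ 2)
    = \sum_i \sum_j a j ^+ 2 * b i ^+ 2.
  rewrite mulrC mulr_suml; apply: eq_bigr => i _; rewrite mulr_sumr.
  by apply: eq_bigr => j _; rewrite mulrC.
have E3 : (\sum_i a i * b i) ^+ 2 = \sum_i \sum_j (a i * b i) * (a j * b j).
  by rewrite expr2 mulr_suml; apply: eq_bigr => i _; rewrite mulr_sumr.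
have -> : \sum_i \sum_j (a i * b j - a j * b i) ^+ 2 =
   \sum_i \sum_j a i ^+ 2 * b j ^+ 2 + \sum_i \sum_j a j ^+ 2 * b i ^+ 2
   - 2 * \sum_i \sum_j (a i * b i) * (a j * b j).
  rewrite mulr_sumr -sumrN -!big_split /=; apply: eq_bigr => i _.
  rewrite mulr_sumr -sumrN -!big_split /=; apply: eq_bigr => j _.
  by ring.
by rewrite -E1 -E2 -E3; field.
Qed.

Lemma card_exists_le {R : realType} (T Z : finType) (N : pred Z) (P : Z -> pred T)
    (B : R) : (forall z, N z -> #|P z|%:R <= B) ->
  #|[pred w | [exists z, N z && P z w]]|%:R <= #|N|%:R * B.
Proof.
move=> PB; apply: (@le_trans _ _ (\sum_(z | N z) #|P z|%:R)); last first.
  by rewrite mulr_natl -sumr_const; apply: ler_sum => z; exact: PB.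
rewrite -natr_sum ler_nat -sum1_card.
under [X in (_ <= X)%N]eq_bigr do rewrite -sum1_card.
rewrite (exchange_big_dep predT) //= big_mkcond /=; apply: leq_sum => w _.
case: ifP => // /existsP[z /andP[Nz Pz]].
by rewrite (bigD1 z) //= Nz.
Qed.

Section SignMatrix.
Context {R : realType}.
Variables g m : nat.
Local Notation row_t := {ffun 'I_m -> bool}.
Local Notation mx_t := {ffun 'I_g -> row_t}.
Implicit Types (x : 'I_m -> R) (w : mx_t).

Definition large_rows x w : nat :=
  #|[pred j | sqnorm x / 4 <= rademacher x (w j) ^+ 2]|.

Lemma few_large_rows x :
  #|[pred w : mx_t | (20 * large_rows x w < g)%N]|%:R
    <= (189 / 200 : R) ^+ g * #|mx_t|%:R.
Proof.
pose phi (e : row_t) : R :=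
  if sqnorm x / 4 <= rademacher x e ^+ 2 then 1 / 2 else 1.
have phi0 e : 0 <= phi e by rewrite /phi; case: ifP => _; lra.
have beta20 : 2 <= (21 / 20 : R) ^+ 20.
  suff h : forall n, 1 + n%:R / 20 <= (21 / 20 : R) ^+ n.
    by apply: le_trans (h 20%N); lra.
  elim=> [|n IH]; first by rewrite expr0 mul0r addr0.
  have n0 : 0 <= n%:R :> R by rewrite ler0n.
  by rewrite exprS -natr1; lra.
apply: (@le_trans _ _ (\sum_(w : mx_t) (21 / 20 : R) ^+ g * \prod_j phi (w j))).
  rewrite -sum1_card natr_sum big_mkcond /=; apply: ler_sum => w _.
  have -> : \prod_j phi (w j) = (1 / 2) ^+ large_rows x w.
    by rewrite -big_mkcond prodr_const.
  case: ifP => [bad|_]; last by rewrite mulr_ge0 // exprn_ge0; lra.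
  set c := large_rows x w in bad *.
  apply: (@le_trans _ _ ((21 / 20) ^+ (20 * c) * (1 / 2) ^+ c)); last first.
    by apply: ler_wpM2r; [rewrite exprn_ge0 //; lra|apply: ler_weXn2l; [lra|exact: ltnW]].
  by rewrite exprM -exprMn exprn_ege1 //; lra.
rewrite -mulr_sumr -(bigA_distr_bigA (fun=> phi)) /= prodr_const card_ord.
rewrite card_ffun card_ord natrX -!exprMn.
rewrite lerXn2r ?nnegrE //.
  by rewrite mulr_ge0 ?sumr_ge0 //; lra.
have -> : 189 / 200 = 21 / 20 * (9 / 10) :> R by field.
rewrite -[X in _ <= X]mulrA; apply: ler_wpM2l; [lra|exact: rademacher_small_ball].
Qed.

Lemma bilinear_mgf (mu : R) x (y : 'I_g -> R) :
  \sum_(w : mx_t) expR (mu * \sum_j y j * rademacher x (w j))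
    <= #|mx_t|%:R * expR (2 * mu ^+ 2 * sqnorm x * sqnorm y).
Proof.
pose G j i (b : bool) := expR (mu * (y j * (bsign b * x i))).
have E w : expR (mu * \sum_j y j * rademacher x (w j)) = \prod_j \prod_i G j i (w j i).
  rewrite mulr_sumr expR_sum; apply: eq_bigr => j _.
  by rewrite mulr_sumr mulr_sumr expR_sum.
under eq_bigr do rewrite E.
rewrite -(bigA_distr_bigA (fun j (e : row_t) => \prod_i G j i (e i))) /=.
under eq_bigr do rewrite -(bigA_distr_bigA (G _)) /=.
have -> : #|mx_t|%:R = \prod_(j < g) \prod_(i < m) (2 : R).
  by rewrite !card_ffun card_bool !card_ord !natrX !prodr_const !card_ord.
have -> : expR (2 * mu ^+ 2 * sqnorm x * sqnorm y)
    = \prod_j \prod_i expR (2 * (mu * (y j * x i)) ^+ 2).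
  rewrite mulr_sumr expR_sum; apply: eq_bigr => j _.
  rewrite -expR_sum /sqnorm; congr expR.
  rewrite [_ * \sum_i x i ^+ 2]mulr_sumr mulr_suml.
  by apply: eq_bigr => i _; ring.
rewrite -big_split /=; apply: ler_prod => j _.
rewrite prodr_ge0 /= => [|i _]; last by rewrite sumr_ge0 // => b _; exact: expR_ge0.
rewrite -big_split /=; apply: ler_prod => i _.
rewrite sumr_ge0 /= => [|b _]; last exact: expR_ge0.
rewrite big_bool /G /bsign /= !mul1r mulN1r !mulrN.
by have := cosh_le (mu * (y j * x i)); lra.
Qed.

End SignMatrix.

Section IntegerPoints.
Context {R : realType}.
Variables B : nat.

Definition ival (p : bool * 'I_B) : R := bsign p.1 * p.2%:R.

Lemma ival_sqr p : ival p ^+ 2 = (p.2 ^ 2)%:R.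
Proof. by rewrite exprMn bsign_sqr mul1r natrX. Qed.

Definition net (m r : nat) : pred {ffun 'I_m -> bool * 'I_B} :=
  [pred z : {ffun 'I_m -> bool * 'I_B} | sqnorm (fun i => ival (z i)) <= (r * m)%:R].

Lemma sum_half_powers (b : nat) : \sum_(j < b) (1 / 2 : R) ^+ j <= 2.
Proof.
have -> : \sum_(j < b) (1 / 2 : R) ^+ j = 2 - 2 * (1 / 2) ^+ b.
  elim: b => [|b IH]; first by rewrite big_ord0 expr0; lra.
  by rewrite big_ord_recr /= IH exprS; field.
have : 0 <= (1 / 2 : R) ^+ b by rewrite exprn_ge0 //; lra.
lra.
Qed.

Lemma card_net m r : #|@net m r|%:R <= (2 : R) ^+ ((r + 2) * m).
Proof.
have -> : (2 : R) ^+ ((r + 2) * m) = 2 ^+ (r * m) * \prod_(i < m) 4.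
  by rewrite mulnDl exprD prodr_const card_ord [2 ^+ (2 * m)]exprM; congr (_ * _ ^+ _); ring.
apply: (@le_trans _ _ (2 ^+ (r * m) * \prod_(i < m) \sum_(p : bool * 'I_B) (1 / 2) ^+ p.2)).
  rewrite (bigA_distr_bigA (fun _ (p : bool * 'I_B) => (1 / 2 : R) ^+ p.2)) mulr_sumr.
  rewrite -sum1_card natr_sum big_mkcond /=; apply: ler_sum => z _.
  rewrite prodrXr.
  case: ifP => [zn|_]; last by rewrite mulr_ge0 // exprn_ge0 //; lra.
  have le : (\sum_(i < m) (z i).2 <= r * m)%N.
    move: zn; rewrite inE /sqnorm; under eq_bigr do rewrite ival_sqr.
    rewrite -natr_sum ler_nat; apply: leq_trans; apply: leq_sum => i _.
    by case: (nat_of_ord _) => // n; rewrite leq_pmulr.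
  apply: (@le_trans _ _ (2 ^+ (\sum_(i < m) (z i).2) * (1 / 2) ^+ (\sum_(i < m) (z i).2))).
    by rewrite -exprMn (_ : 2 * (1 / 2) = 1 :> R) ?expr1n //; field.
  by apply: ler_wpM2r; [rewrite exprn_ge0 //; lra|apply: ler_weXn2l; [lra|]].
rewrite ler_wpM2l ?exprn_ge0 //; apply: ler_prod => i _.
rewrite sumr_ge0 /= => [|p _]; last by rewrite exprn_ge0 //; lra.
rewrite -(pair_bigA _ (fun (_ : bool) (j : 'I_B) => (1 / 2 : R) ^+ j)) /= big_bool /=.
by have := sum_half_powers B; lra.
Qed.

End IntegerPoints.

Section GoodMatrix.
Context {R : realType}.

Lemma ler_expR_natX (x : R) (n : nat) : 0 <= x -> x <= expR 1 -> x ^+ n <= expR n%:R.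
Proof.
by move=> x0 xe; rewrite -[n%:R]mulr1 expRM_natl lerXn2r // nnegrE expR_ge0.
Qed.

Lemma two_le_expR1 : 2 <= expR 1 :> R.
Proof. by have := expR_ge1Dx (1 : R); lra. Qed.

(* 46 beats the cost of the union over pairs of points of [net 4] and of the
   moment generating function. *)
Definition bilinear_bound (g m : nat) : R := 46 * g%:R * Num.sqrt m%:R.

Lemma bilinear_tail (g m : nat) (x : 'I_m -> R) (y : 'I_g -> R) : (0 < m)%N ->
  sqnorm x <= (4 * m)%:R -> sqnorm y <= (4 * g)%:R ->
  #|[pred w : {ffun 'I_g -> {ffun 'I_m -> bool}} |
      bilinear_bound g m < \sum_j y j * rademacher x (w j)]|%:R
    <= expR (- 14 * g%:R) * #|{ffun 'I_g -> {ffun 'I_m -> bool}}|%:R :> R.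
Proof.
move=> m0 hx hy; set K : R := #|{ffun _ -> _}|%:R.
have mR : 0 < m%:R :> R by rewrite ltr0n.
have sm : 0 < Num.sqrt m%:R :> R by rewrite sqrtr_gt0.
pose mu : R := (Num.sqrt m%:R)^-1.
have mu2 : mu ^+ 2 = m%:R^-1 by rewrite exprVn sqr_sqrtr // ltW.
apply: (@le_trans _ _ (expR (- 46 * g%:R) *
    \sum_(w : {ffun 'I_g -> {ffun 'I_m -> bool}})
        expR (mu * \sum_j y j * rademacher x (w j)))).
  rewrite mulr_sumr -sum1_card natr_sum big_mkcond /=; apply: ler_sum => w _.
  case: ifP => [|_]; last by rewrite mulr_ge0 ?expR_ge0.
  rewrite inE => h; rewrite -expRD -[X in X <= _]expR0 ler_expR.
  have : mu * bilinear_bound g m <= mu * \sum_j y j * rademacher x (w j).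
    by rewrite ler_wpM2l ?invr_ge0 ?sqrtr_ge0 // ltW.
  have -> : mu * bilinear_bound g m = 46 * g%:R.
    by rewrite /bilinear_bound /mu; field; rewrite gt_eqF.
  by move=> ?; lra.
apply: (@le_trans _ _ (expR (- 46 * g%:R) * (K * expR (32 * g%:R)))).
  rewrite ler_wpM2l ?expR_ge0 //; apply: le_trans (bilinear_mgf _ _ _) _.
  rewrite ler_wpM2l ?ler0n // ler_expR mu2.
  have -> : 32 * g%:R = 2 * m%:R^-1 * (4 * m)%:R * (4 * g)%:R :> R.
    by rewrite !natrM; field; rewrite gt_eqF.
  apply: ler_pM; rewrite ?sqnorm_ge0 ?mulr_ge0 ?sqnorm_ge0 ?invr_ge0 ?ler0n //.
  by rewrite ler_wpM2l // mulr_ge0 // invr_ge0.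
rewrite mulrCA -expRD mulrC; apply: ler_wpM2r; first by rewrite ler0n.
by rewrite ler_expR; lra.
Qed.

Lemma good_sign_matrix (r : nat) : exists C0 : nat, forall g m B B1 B' : nat,
  (0 < m)%N -> (C0 * m <= g)%N ->
  exists w : {ffun 'I_g -> {ffun 'I_m -> bool}},
   (forall z : {ffun 'I_m -> bool * 'I_B}, @net R _ _ r z ->
      (g <= 20 * large_rows (fun i => ival (z i) : R) w)%N) /\
   (forall (X : {ffun 'I_m -> bool * 'I_B1}) (Y : {ffun 'I_g -> bool * 'I_B'}),
      @net R _ _ 4 X -> @net R _ _ 4 Y ->
      \sum_j ival (Y j) * rademacher (fun i => ival (X i)) (w j)
        <= bilinear_bound g m).
Proof.
have q0 : 0 <= 189 / 200 :> R by lra.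
have q1 : 189 / 200 <= 1 :> R by lra.
have [C hC] : exists C : nat, 2 ^+ (r + 2) * (189 / 200 : R) ^+ C <= 1 / 4.
  have /(_ (1 / 4 / 2 ^+ (r + 2))) : forall e : R, 0 < e ->
      exists C : nat, (189 / 200 : R) ^+ C <= e.
    move=> e e0; have lt1 : `|189 / 200 : R| < 1 by rewrite ger0_norm; lra.
    have /cvgrPdist_le /(_ e e0) := cvg_expr lt1.
    case=> N _ /(_ N (leqnn N)) /=; rewrite sub0r normrN => h.
    by exists N; apply: le_trans h; rewrite ler_norm.
  case=> [|C hC]; first by rewrite divr_gt0 ?exprn_gt0 //; lra.
  by exists C; move: hC; rewrite ler_pdivlMr ?exprn_gt0 // mulrC.
exists C.+1 => g m B B1 B' m0 gm.
have mg : (m <= g)%N by apply: leq_trans gm; rewrite leq_pmull.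
have g0 : (0 < g)%N by apply: leq_trans mg.
have Cmg : (C * m <= g)%N by apply: leq_trans gm; rewrite leq_mul2r leqnSn orbT.
pose W := {ffun 'I_g -> {ffun 'I_m -> bool}}.
pose K : R := #|{: W}|%:R.
have K0 : 0 < K.
  by rewrite ltr0n; apply/card_gt0P; exists [ffun=> [ffun=> true]].
pose bad1 := [pred w : W | [exists z : {ffun 'I_m -> bool * 'I_B}, @net R _ _ r z &&
   (20 * large_rows (fun i => ival (z i) : R) w < g)%N]].
pose bad2 := [pred w : W |
   [exists XY : {ffun 'I_m -> bool * 'I_B1} * {ffun 'I_g -> bool * 'I_B'},
     (@net R _ _ 4 XY.1 && @net R _ _ 4 XY.2) &&
     (bilinear_bound g m < \sum_j ival (XY.2 j) * rademacher (fun i => ival (XY.1 i)) (w j))]].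
have c1 : #|bad1|%:R <= 1 / 4 * K.
  have := @card_exists_le R W _ (@net R B m r)
    (fun z => [pred w : W | (20 * large_rows (fun i => ival (z i) : R) w < g)%N]) _
    (fun z _ => few_large_rows g (fun i => ival (z i) : R)).
  move=> /le_trans -> //; rewrite mulrA ler_wpM2r // ?ler0n //.
  apply: (@le_trans _ _ (2 ^+ ((r + 2) * m) * (189 / 200) ^+ (C * m))).
    apply: ler_pM; rewrite ?ler0n ?card_net ?exprn_ge0 //.
    exact: ler_wiXn2l.
  rewrite !exprM -exprMn; apply: (@le_trans _ _ ((1 / 4) ^+ m)).
    apply: lerXn2r => //; rewrite nnegrE; last lra.
    by rewrite mulr_ge0 // exprn_ge0.
  by case: (m) m0 => // m' _; rewrite exprS ler_piMr ?exprn_ile1 //; lra.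
have c2 : #|bad2|%:R <= 1 / 4 * K.
  have h := @card_exists_le R W _ [pred XY | @net R B1 m 4 XY.1 && @net R B' g 4 XY.2]
    (fun XY => [pred w : W | bilinear_bound g m <
        \sum_j ival (XY.2 j) * rademacher (fun i => ival (XY.1 i)) (w j)])
    (expR (- 14 * g%:R) * K).
  apply: le_trans (h _) _ => [XY /andP[hX hY]|]; first exact: bilinear_tail.
  rewrite mulrA ler_wpM2r ?ler0n //.
  have -> : #|[pred XY | @net R B1 m 4 XY.1 && @net R B' g 4 XY.2]|
      = (#|@net R B1 m 4| * #|@net R B' g 4|)%N by rewrite -cardX.
  rewrite natrM; apply: (@le_trans _ _ (expR (12 * g%:R) * expR (- 14 * g%:R))).
    rewrite ler_wpM2r ?expR_ge0 //.
    apply: (@le_trans _ _ (2 ^+ (6 * m) * 2 ^+ (6 * g))).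
      by apply: ler_pM; rewrite ?ler0n // card_net.
    rewrite -exprD -natrM; apply: (@le_trans _ _ (2 ^+ (12 * g))).
      by apply: ler_weXn2l; [lra|lia].
    by apply: ler_expR_natX; [lra|exact: two_le_expR1].
  rewrite -expRD (_ : _ + _ = - (2 * g)%:R); last by rewrite natrM; ring.
  rewrite expRN -[X in _ <= X]invrK lef_pV2 ?posrE ?expR_gt0 ?invr_gt0 //; try lra.
  apply: le_trans (ler_expR_natX _ _ two_le_expR1); last lra.
  rewrite exprM (_ : (1 / 4)^-1 = 2 ^+ 2 :> R); last by field.
  by rewrite -[X in X <= _]expr1 ler_weXn2l //; lra.
have [w /norP[w1 w2]] : exists w : W, ~~ (bad1 w || bad2 w).
  apply/existsP; apply: contraT; rewrite negb_exists => /forallP all.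
  have : K <= #|bad1|%:R + #|bad2|%:R.
    rewrite -natrD ler_nat -cardUI; apply: leq_trans (leq_addr _ _).
    rewrite (@eq_card W [predU bad1 & bad2] predT) // => w.
    by have := all w; rewrite negbK !inE => ->.
  by move: c1 c2 K0; rewrite -/K; lra.
exists w; split=> [z zn|X Y hX hY].
  by rewrite leqNgt; apply: contra w1 => h; apply/existsP; exists z; rewrite zn.
by rewrite leNgt; apply: contra w2 => h; apply/existsP; exists (X, Y); rewrite /= hX hY.
Qed.

End GoodMatrix.

Section Rounding.
Context {R : realType}.

Lemma bsign_norm (x : R) : x = bsign (0 <= x) * `|x|.
Proof.
rewrite /bsign; case: (boolP (0 <= x)) => [h|]; first by rewrite mul1r ger0_norm.
by rewrite -ltNge => h; rewrite mulN1r ltr0_norm // opprK.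
Qed.

(* Rounding along the sign of [c] bounds a bilinear form on a ball by its values
   at integer points, with no supremum over the sphere. *)
Lemma round_for_linear_form (B : nat) (c x : R) : `|x| + 1 < B%:R ->
  exists p : bool * 'I_B, c * x <= c * ival p /\ ival p ^+ 2 <= 2 * x ^+ 2 + 2.
Proof.
move=> xB; have [t1 t2] := andP (truncn_itv (normr_ge0 x)).
set t := Num.trunc `|x| in t1 t2.
have tB : (t.+1 < B)%N by rewrite -(ltr_nat R) -natr1; lra.
have xE := bsign_norm x.
have t0 : 0 <= t%:R :> R by rewrite ler0n.
have tx : t%:R ^+ 2 <= x ^+ 2.
  by rewrite -[x ^+ 2]real_normK ?num_real // lerXn2r // nnegrE.
rewrite -natr1 in t2.
have [cx|cx] := lerP 0 (c * bsign (0 <= x)).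
  exists (0 <= x, Ordinal tB); rewrite ival_sqr natrX /= -natr1; split.
    by rewrite [X in c * X]xE /ival /= !mulrA ler_wpM2l // -natr1 ltW.
  by have := sqr_ge0 (t%:R - 1 : R); nra.
have tB' : (t < B)%N by apply: ltn_trans tB.
exists (0 <= x, Ordinal tB'); rewrite ival_sqr natrX /=; split.
  by rewrite [X in c * X]xE /ival /= !mulrA ler_wnM2l // ltW.
by have := sqr_ge0 x; lra.
Qed.

Lemma round_towards_zero (B : nat) (x : R) : `|x| < B%:R ->
  exists p : bool * 'I_B, (x - ival p) ^+ 2 <= 1 /\ ival p ^+ 2 <= x ^+ 2.
Proof.
move=> xB; have [t1 t2] := andP (truncn_itv (normr_ge0 x)).
set t := Num.trunc `|x| in t1 t2.
have tB : (t < B)%N by rewrite -(ltr_nat R); lra.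
have xE := bsign_norm x.
have t0 : 0 <= t%:R :> R by rewrite ler0n.
have tx : t%:R ^+ 2 <= x ^+ 2.
  by rewrite -[x ^+ 2]real_normK ?num_real // lerXn2r // nnegrE.
rewrite -natr1 in t2.
exists (0 <= x, Ordinal tB); rewrite ival_sqr natrX /=; split.
  by rewrite [X in X - _]xE /ival /= -mulrBr exprMn bsign_sqr mul1r; nra.
exact: tx.
Qed.

Lemma coord_le_sqnorm (m : nat) (x : 'I_m -> R) (b : nat) (i : 'I_m) :
  sqnorm x <= b%:R -> `|x i| < b.+1%:R.
Proof.
move=> xb; have : x i ^+ 2 <= b%:R.
  apply: le_trans xb; rewrite /sqnorm (bigD1 i) //= lerDl sumr_ge0 // => j _.
  exact: sqr_ge0.
have : 0 <= b%:R :> R by rewrite ler0n.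
by rewrite -[x i ^+ 2]real_normK ?num_real // -natr1; have := normr_ge0 (x i); nra.
Qed.

Lemma round_vector_for_linear_form (m : nat) (c x : 'I_m -> R) :
  sqnorm x <= m%:R -> exists Z : {ffun 'I_m -> bool * 'I_m.+2},
  @net R _ _ 4 Z /\ \sum_i c i * x i <= \sum_i c i * ival (Z i).
Proof.
move=> xm; have xB i : `|x i| + 1 < m.+2%:R.
  by have := coord_le_sqnorm i xm; rewrite -[m.+2%:R]natr1; lra.
have [Z hZ] := choice (fun i => round_for_linear_form (c i) (xB i)).
exists [ffun i => Z i]; split; last first.
  by apply: ler_sum => i _; rewrite ffunE; have [] := hZ i.
rewrite /net /= /sqnorm; apply: (@le_trans _ _ (\sum_i (2 * x i ^+ 2 + 2))).
  by apply: ler_sum => i _; rewrite ffunE; have [] := hZ i.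
rewrite big_split /= -mulr_sumr sumr_const card_ord -mulr_natl natrM.
by move: xm; rewrite /sqnorm; lra.
Qed.

Lemma round_vector (m r : nat) (x : 'I_m -> R) :
  sqnorm x <= (r * m)%:R -> exists Z : {ffun 'I_m -> bool * 'I_(r * m).+1},
  @net R _ _ r Z /\ sqnorm (fun i => x i - ival (Z i)) <= m%:R.
Proof.
move=> xm; have [Z hZ] := choice (fun i => round_towards_zero (coord_le_sqnorm i xm)).
exists [ffun i => Z i]; split.
  rewrite /net /=; apply: le_trans xm.
  by apply: ler_sum => i _; rewrite ffunE; have [] := hZ i.
apply: (@le_trans _ _ (\sum_(i < m) 1)).
  by apply: ler_sum => i _; rewrite ffunE; have [] := hZ i.
by rewrite sumr_const card_ord.
Qed.

End Rounding.

Section EuclideanSection.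
Context {R : realType}.

Lemma rademacherB (m : nat) (x y : 'I_m -> R) e :
  rademacher (fun i => x i - y i) e = rademacher x e - rademacher y e.
Proof. by rewrite -sumrB; apply: eq_bigr => i _; rewrite mulrBr. Qed.

Lemma rademacherZ (m : nat) (a : R) (x : 'I_m -> R) e :
  rademacher (fun i => a * x i) e = a * rademacher x e.
Proof. by rewrite mulr_sumr; apply: eq_bigr => i _; rewrite mulrCA. Qed.

Lemma sqnormZ (m : nat) (a : R) (x : 'I_m -> R) :
  sqnorm (fun i => a * x i) = a ^+ 2 * sqnorm x.
Proof. by rewrite mulr_sumr; apply: eq_bigr => i _; rewrite exprMn. Qed.

Lemma sqnorm_eq0 (m : nat) (x : 'I_m -> R) : sqnorm x = 0 -> forall i, x i = 0.
Proof.
move=> /eqP; rewrite psumr_eq0 => [/allP h i|i _]; last exact: sqr_ge0.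
by have := h i (mem_index_enum _); rewrite /= sqrf_eq0 => /eqP.
Qed.

Lemma rademacher_sqnorm0 (m : nat) (x : 'I_m -> R) e :
  sqnorm x = 0 -> rademacher x e = 0.
Proof. by move=> /sqnorm_eq0 x0; rewrite /rademacher big1 // => i _; rewrite x0 mulr0. Qed.

Lemma norm1_le_norm2 (I : finType) (a : I -> R) :
  \sum_i `|a i| <= Num.sqrt #|I|%:R * Num.sqrt (\sum_i a i ^+ 2).
Proof.
rewrite -sqrtrM ?ler0n // -[X in X <= _]ger0_norm ?sumr_ge0 // -sqrtr_sqr ler_sqrt.
  have := cauchy_schwarz_sum (fun=> 1 : R) (fun i => `|a i|).
  under eq_bigr do rewrite mul1r.
  under [X in _ <= X * _ -> _]eq_bigr do rewrite expr1n.
  under [X in _ <= _ * X -> _]eq_bigr do rewrite real_normK ?num_real //.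
  by rewrite sumr_const.
by rewrite mulr_ge0 // sumr_ge0 // => i _; exact: sqr_ge0.
Qed.

Lemma operator_norm_of_bilinear (g m : nat) (w : {ffun 'I_g -> {ffun 'I_m -> bool}}) :
  (0 < m)%N -> (0 < g)%N ->
  (forall (X : {ffun 'I_m -> bool * 'I_m.+2}) (Y : {ffun 'I_g -> bool * 'I_g.+2}),
      @net R _ _ 4 X -> @net R _ _ 4 Y ->
      \sum_j ival (Y j) * rademacher (fun i => ival (X i)) (w j) <= bilinear_bound g m :> R) ->
  forall x : 'I_m -> R,
  sqnorm (fun j => rademacher x (w j)) <= 46 ^+ 2 * g%:R * sqnorm x.
Proof.
move=> m0 g0 hw.
have mR : 0 < m%:R :> R by rewrite ltr0n.
have gR : 0 < g%:R :> R by rewrite ltr0n.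
have bil (x : 'I_m -> R) (y : 'I_g -> R) : sqnorm x <= m%:R -> sqnorm y <= g%:R ->
    \sum_j y j * rademacher x (w j) <= bilinear_bound g m.
  move=> xm yg.
  have swap (v : 'I_m -> R) (u : 'I_g -> R) : \sum_j u j * rademacher v (w j)
      = \sum_i (\sum_j u j * bsign (w j i)) * v i.
    under [RHS]eq_bigr do rewrite mulr_suml.
    rewrite exchange_big /=; apply: eq_bigr => j _; rewrite mulr_sumr.
    by apply: eq_bigr => i _; rewrite mulrA.
  have [X [hX lX]] := round_vector_for_linear_form (fun i => \sum_j y j * bsign (w j i)) xm.
  rewrite swap; apply: le_trans lX _; rewrite -swap.
  have [Y [hY lY]] := round_vector_for_linear_form
     (fun j => rademacher (fun i => ival (X i)) (w j)) yg.
  apply: le_trans (hw X Y hX hY).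
  under eq_bigr do rewrite mulrC.
  by under [X in _ <= X]eq_bigr do rewrite mulrC.
move=> x; set s := sqnorm (fun j => _); set X := sqnorm x.
have X0 : 0 <= X by exact: sqnorm_ge0.
have s0 : 0 <= s by exact: sqnorm_ge0.
have [Xz|Xn] := eqVneq X 0.
  rewrite Xz mulr0 /s /sqnorm big1 // => j _.
  by rewrite rademacher_sqnorm0 // expr0n.
have [sz|sn] := eqVneq s 0; first by rewrite sz !mulr_ge0.
have {}X0 : 0 < X by rewrite lt_def Xn.
have {}s0 : 0 < s by rewrite lt_def sn.
pose a := Num.sqrt (m%:R / X); pose b := Num.sqrt (g%:R / s).
have a2 : a ^+ 2 = m%:R / X by rewrite sqr_sqrtr // divr_ge0 // ltW.
have b2 : b ^+ 2 = g%:R / s by rewrite sqr_sqrtr // divr_ge0 // ltW.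
have := bil (fun i => a * x i) (fun j => b * rademacher x (w j)).
rewrite !sqnormZ a2 b2 !divfK // !lexx => /(_ isT isT).
under eq_bigr do rewrite rademacherZ.
have -> : \sum_j b * rademacher x (w j) * (a * rademacher x (w j)) = a * b * s.
  by rewrite mulr_sumr; apply: eq_bigr => j _; ring.
move=> h; have {}h : (a * b * s) ^+ 2 <= bilinear_bound g m ^+ 2.
  by rewrite lerXn2r // nnegrE ?mulr_ge0 ?sqrtr_ge0 // ltW.
move: h; rewrite !exprMn a2 b2 sqr_sqrtr ?ler0n //.
rewrite (_ : m%:R / X * (g%:R / s) * s ^+ 2 = (m%:R * g%:R / X) * s); last by field; rewrite Xn.
rewrite (_ : 46 ^+ 2 * g%:R ^+ 2 * m%:R = (m%:R * g%:R / X) * (46 ^+ 2 * g%:R * X)); last by field.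
by rewrite ler_pM2l // !mulr_gt0 // invr_gt0.
Qed.

(* Kashin's theorem for sign matrices. *)
Theorem sign_euclidean_section : exists (C0 : nat) (lam kap : R),
  [/\ 0 < lam, 0 < kap & forall g m : nat, (0 < m)%N -> (C0 * m <= g)%N ->
  exists w : {ffun 'I_g -> {ffun 'I_m -> bool}}, forall x : 'I_m -> R,
    lam * g%:R * Num.sqrt (sqnorm x) <= \sum_j `|rademacher x (w j)| /\
    sqnorm (fun j => rademacher x (w j)) <= kap ^+ 2 * g%:R * sqnorm x].
Proof.
pose rho : nat := (80 * 46)%N.
pose r : nat := (2 * rho ^ 2 + 2)%N.
have rR : r%:R = 2 * rho%:R ^+ 2 + 2 :> R by rewrite natrD natrM natrX.
have rho0 : 0 <= rho%:R :> R by rewrite ler0n.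
have r0 : 0 < r%:R :> R by rewrite rR; nra.
have rhoE : rho%:R = 80 * 46 :> R by rewrite natrM.
move: rho rhoE r rR rho0 r0 => rho rhoE r rR rho0 r0.
have [C0 hC] := @good_sign_matrix R r.
exists C0.+1, (46 / Num.sqrt r%:R), 46; split=> [||g m m0 Cg].
- by rewrite divr_gt0 ?sqrtr_gt0 //; lra.
- lra.
have g0 : (0 < g)%N by apply: leq_trans Cg; rewrite muln_gt0.
have [|w [hw1 hw2]] := hC g m (r * m).+1 m.+2 g.+2 m0.
  by apply: leq_trans Cg; rewrite leq_mul2r leqnSn orbT.
have upper := operator_norm_of_bilinear m0 g0 hw2.
exists w => x; split=> //.
have mR : 0 < m%:R :> R by rewrite ltr0n.
have gR : 0 < g%:R :> R by rewrite ltr0n.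
have [Xz|Xn] := eqVneq (sqnorm x) 0.
  by rewrite Xz sqrtr0 mulr0 sumr_ge0.
have X0 : 0 < sqnorm x by rewrite lt_def Xn sqnorm_ge0.
pose a := Num.sqrt ((r * m)%:R / sqnorm x).
have rm0 : 0 < (r * m)%:R :> R by rewrite natrM mulr_gt0.
have a0 : 0 < a by rewrite sqrtr_gt0 divr_gt0.
have a2 : a ^+ 2 * sqnorm x = (r * m)%:R.
  by rewrite sqr_sqrtr ?divfK // divr_ge0 // ltW.
pose y i := a * x i.
have y2 : sqnorm y = (r * m)%:R by rewrite sqnormZ.
have [|Z [Zn Zy]] := @round_vector R m r y; first by rewrite y2.
pose z i : R := ival (Z i).
have z2 : rho%:R ^+ 2 * m%:R <= sqnorm z.
  have : sqnorm y <= 2 * sqnorm (fun i => y i - z i) + 2 * sqnorm z.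
    rewrite !mulr_sumr -big_split /=; apply: ler_sum => i _.
    by have := sqr_ge0 (y i - 2 * z i); nra.
  by move: Zy; rewrite y2 natrM rR; nra.
have z1 : g%:R * rho%:R * Num.sqrt m%:R / 40 <= \sum_j `|rademacher z (w j)|.
  have sz : rho%:R * Num.sqrt m%:R <= Num.sqrt (sqnorm z).
    have -> : rho%:R * Num.sqrt m%:R = Num.sqrt (rho%:R ^+ 2 * m%:R) :> R.
      by rewrite sqrtrM ?sqr_ge0 // sqrtr_sqr ger0_norm.
    by rewrite ler_sqrt // sqnorm_ge0.
  apply: (@le_trans _ _ (\sum_(j < g | sqnorm z / 4 <= rademacher z (w j) ^+ 2)
      Num.sqrt (sqnorm z) / 2)); last first.
    rewrite [X in _ <= X](bigID (fun j => sqnorm z / 4 <= rademacher z (w j) ^+ 2)) /=.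
    rewrite ler_wpDr ?sumr_ge0 //; apply: ler_sum => j hj.
    have -> : Num.sqrt (sqnorm z) / 2 = Num.sqrt (sqnorm z / 4).
      rewrite sqrtrM ?sqnorm_ge0 // (_ : 4^-1 = (2^-1) ^+ 2 :> R); last by field.
      by rewrite sqrtr_sqr ger0_norm // invr_ge0.
    by rewrite -sqrtr_sqr ler_sqrt // sqr_ge0.
  rewrite sumr_const -mulr_natl.
  have cnt : g%:R <= 20 * (large_rows z w)%:R :> R by rewrite -natrM ler_nat hw1.
  have s0 : 0 <= Num.sqrt (sqnorm z) by exact: sqrtr_ge0.
  rewrite -/(large_rows z w).
  have c0 : 0 <= rho%:R * Num.sqrt m%:R :> R by rewrite mulr_ge0 ?sqrtr_ge0.
  have : g%:R * (rho%:R * Num.sqrt m%:R) <= 20 * (large_rows z w)%:R * Num.sqrt (sqnorm z).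
    by apply: ler_pM => //; rewrite ltW.
  by rewrite -mulrA; lra.
have d1 : \sum_j `|rademacher (fun i => y i - z i) (w j)| <= 46 * g%:R * Num.sqrt m%:R.
  apply: le_trans (norm1_le_norm2 _) _; rewrite card_ord.
  have -> : 46 * g%:R * Num.sqrt m%:R
      = Num.sqrt g%:R * Num.sqrt (46 ^+ 2 * g%:R * m%:R) :> R.
    rewrite [Num.sqrt (_ * m%:R)]sqrtrM ?mulr_ge0 ?sqr_ge0 // 1?ltW //.
    rewrite sqrtrM ?sqr_ge0 // sqrtr_sqr ger0_norm //.
    by rewrite -{1}[g%:R]sqr_sqrtr ?ltW //; ring.
  rewrite ler_wpM2l ?sqrtr_ge0 // ler_sqrt; last by rewrite mulr_ge0 ?mulr_ge0 ?sqr_ge0 // ltW.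
  apply: le_trans (upper (fun i => y i - z i)) _; rewrite ler_wpM2l // mulr_ge0 ?sqr_ge0 // ltW.
have : \sum_j `|rademacher z (w j)| <= \sum_j `|rademacher y (w j)|
    + \sum_j `|rademacher (fun i => y i - z i) (w j)|.
  rewrite -big_split /=; apply: ler_sum => j _; rewrite rademacherB addrC.
  by rewrite -[X in `|X|](subKr (rademacher y (w j))); apply: le_trans (ler_normB _ _) _; rewrite addrC.
have -> : \sum_j `|rademacher y (w j)| = a * \sum_j `|rademacher x (w j)|.
  rewrite mulr_sumr; apply: eq_bigr => j _.
  by rewrite rademacherZ normrM gtr0_norm.
move=> key; rewrite -(ler_pM2l a0).
have -> : a * (46 / Num.sqrt r%:R * g%:R * Num.sqrt (sqnorm x)) = 46 * g%:R * Num.sqrt m%:R.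
  rewrite /a sqrtrM ?ltW // natrM sqrtrM ?ltW // sqrtrV ?ltW //.
  by field; rewrite !gt_eqF ?sqrtr_gt0.
by move: z1 d1 key; rewrite rhoE; lra.
Qed.

End EuclideanSection.

(** * Kronecker powers *)

Section Tensor.
Context {R : realType}.

Lemma big_ord_mulM (a b : nat) (F : nat -> R) :
  \sum_(p < a * b) F p = \sum_(t < a) \sum_(h < b) F (t * b + h)%N.
Proof.
rewrite -(big_mkord xpredT F).
elim: a => [|a IH]; first by rewrite mul0n big_ord0 big_geq.
rewrite big_ord_recr /= -IH mulSn addnC (@big_cat_nat _ _ _ (a * b)) ?leq_addr //=.
by congr (_ + _); rewrite -{1}[(a * b)%N]add0n big_addn addKn big_mkord;
  apply: eq_bigr => h _; rewrite addnC.
Qed.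

Lemma big_ord_expS (a l : nat) (F : nat -> R) :
  \sum_(p < a ^ l.+1) F p = \sum_(t < a) \sum_(h < a ^ l) F (t * a ^ l + h)%N.
Proof. by rewrite expnS big_ord_mulM. Qed.

Lemma norm2_triangle (I : finType) (a b : I -> R) :
  Num.sqrt (\sum_i (a i + b i) ^+ 2)
    <= Num.sqrt (\sum_i a i ^+ 2) + Num.sqrt (\sum_i b i ^+ 2).
Proof.
have s0 (c : I -> R) : 0 <= \sum_i c i ^+ 2.
  by apply: sumr_ge0 => i _; exact: sqr_ge0.
rewrite -[X in _ <= X]ger0_norm ?addr_ge0 ?sqrtr_ge0 // -sqrtr_sqr ler_sqrt ?sqr_ge0 //.
rewrite sqrrD !sqr_sqrtr // -sqrtrM //.
have -> : \sum_i (a i + b i) ^+ 2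
    = \sum_i a i ^+ 2 + (\sum_i a i * b i) *+ 2 + \sum_i b i ^+ 2.
  by rewrite -sumrMnl -!big_split /=; apply: eq_bigr => i _; rewrite sqrrD.
rewrite lerD2r lerD2l lerMn2r /=; apply: le_trans (ler_norm _) _.
by rewrite -sqrtr_sqr ler_sqrt ?mulr_ge0 // cauchy_schwarz_sum.
Qed.

Lemma minkowski_sum (I H : finType) (Y : H -> I -> R) :
  Num.sqrt (\sum_i (\sum_h `|Y h i|) ^+ 2) <= \sum_h Num.sqrt (\sum_i Y h i ^+ 2).
Proof.
elim: (index_enum H) => [|h r IH].
  by rewrite big_nil big1 ?sqrtr0 // => i _; rewrite big_nil expr0n.
under eq_bigr do rewrite big_cons.
rewrite big_cons; apply: le_trans (norm2_triangle _ _) _.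
apply: lerD => //; rewrite le_eqVlt; apply/orP; left; apply/eqP; congr Num.sqrt.
by apply: eq_bigr => i _; rewrite real_normK ?num_real.
Qed.

Variables (g m : nat) (E : nat -> nat -> R).

(* The l-th Kronecker power of E, rows being indexed in base g and columns in
   base m. *)
Fixpoint kron (l : nat) : nat -> nat -> R :=
  if l is l'.+1 then fun p c =>
    kron l' (p %% g ^ l')%N (c %% m ^ l')%N * E (p %/ g ^ l')%N (c %/ m ^ l')%N
  else fun _ _ => 1.

Lemma kron_apply (l : nat) (x : nat -> R) (t h : nat) : (h < g ^ l)%N ->
  \sum_(c < m ^ l.+1) kron l.+1 (t * g ^ l + h)%N c * x c =
  \sum_(u < m) E t u * \sum_(c < m ^ l) kron l h c * x (u * m ^ l + c)%N.
Proof.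
move=> hl; rewrite (big_ord_expS m l (fun c => kron l.+1 (t * g ^ l + h)%N c * x c)).
apply: eq_bigr => u _; rewrite mulr_sumr; apply: eq_bigr => c _ /=.
have gl : (0 < g ^ l)%N by apply: leq_ltn_trans hl.
have ml : (0 < m ^ l)%N by apply: leq_ltn_trans (ltn_ord c).
rewrite !modnMDl !divnMDl // !modn_small // !divn_small // !addn0.
by rewrite mulrAC mulrC.
Qed.

Lemma kron_lower (lam : R) (l : nat) (x : nat -> R) : 0 <= lam ->
  (forall y : nat -> R, lam * g%:R * Num.sqrt (\sum_(u < m) y u ^+ 2)
     <= \sum_(t < g) `|\sum_(u < m) E t u * y u|) ->
  (lam * g%:R) ^+ l * Num.sqrt (\sum_(c < m ^ l) x c ^+ 2)
    <= \sum_(p < g ^ l) `|\sum_(c < m ^ l) kron l p c * x c|.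
Proof.
move=> lam0 hE; elim: l x => [|l IH] x.
  by rewrite !big_ord_recl !big_ord0 /= !addr0 expr0 !mul1r sqrtr_sqr.
have lg0 : 0 <= lam * g%:R by rewrite mulr_ge0.
rewrite (big_ord_expS g l
  (fun p => `|\sum_(c < m ^ l.+1) kron l.+1 p c * x c|)).
pose Y h u := \sum_(c < m ^ l) kron l h c * x (u * m ^ l + c)%N.
rewrite exchange_big /=.
apply: (@le_trans _ _ (\sum_(h < g ^ l) lam * g%:R * Num.sqrt (\sum_(u < m) Y h u ^+ 2))).
  rewrite -mulr_sumr exprS -mulrA ler_wpM2l //.
  apply: le_trans (minkowski_sum _).
  have -> : (lam * g%:R) ^+ l * Num.sqrt (\sum_(c < m ^ l.+1) x c ^+ 2) =
     Num.sqrt (\sum_(u < m)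
       ((lam * g%:R) ^+ l * Num.sqrt (\sum_(c < m ^ l) x (u * m ^ l + c)%N ^+ 2)) ^+ 2).
    rewrite (big_ord_expS m l (fun c => x c ^+ 2)).
    rewrite -[X in X * _]ger0_norm ?exprn_ge0 // -sqrtr_sqr -sqrtrM ?sqr_ge0 //.
    congr Num.sqrt; rewrite mulr_sumr; apply: eq_bigr => u _.
    by rewrite [RHS]exprMn sqr_sqrtr // sumr_ge0 // => c _; exact: sqr_ge0.
  apply: ler_wsqrtr; apply: ler_sum => u _; apply: lerXn2r; last exact: (IH (fun c => x (u * m ^ l + c)%N)).
    by rewrite nnegrE mulr_ge0 ?exprn_ge0 ?sqrtr_ge0.
  by rewrite nnegrE sumr_ge0.
apply: ler_sum => h _; apply: le_trans (hE (Y h)) _.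
by apply: ler_sum => t _; rewrite kron_apply.
Qed.

Lemma kron_upper (kap : R) (l : nat) (x : nat -> R) : 0 <= kap ->
  (forall y : nat -> R, \sum_(t < g) (\sum_(u < m) E t u * y u) ^+ 2
     <= kap * g%:R * \sum_(u < m) y u ^+ 2) ->
  \sum_(p < g ^ l) (\sum_(c < m ^ l) kron l p c * x c) ^+ 2
    <= (kap * g%:R) ^+ l * \sum_(c < m ^ l) x c ^+ 2.
Proof.
move=> kap0 hE; elim: l x => [|l IH] x.
  by rewrite !big_ord_recl !big_ord0 /= !addr0 expr0 !mul1r.
have kg0 : 0 <= kap * g%:R by rewrite mulr_ge0.
rewrite (big_ord_expS g l
  (fun p => (\sum_(c < m ^ l.+1) kron l.+1 p c * x c) ^+ 2)).
pose Y h u := \sum_(c < m ^ l) kron l h c * x (u * m ^ l + c)%N.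
rewrite exchange_big /=.
apply: (@le_trans _ _ (\sum_(h < g ^ l) kap * g%:R * (\sum_(u < m) Y h u ^+ 2))).
  apply: ler_sum => h _; apply: le_trans (hE (Y h)).
  by apply: ler_sum => t _; rewrite kron_apply.
rewrite -mulr_sumr exprS -[X in _ <= X]mulrA ler_wpM2l // exchange_big /=.
rewrite (big_ord_expS m l (fun c => x c ^+ 2)) mulr_sumr.
by apply: ler_sum => u _; exact: (IH (fun c => x (u * m ^ l + c)%N)).
Qed.

End Tensor.

(** * Subgradient descent *)

Section Descent.
Context {R : realType}.
Variables (N n : nat) (W : nat -> nat -> R) (z : nat -> R).

Definition apply_mx (v : nat -> R) (p : nat) : R := \sum_(i < n) W p i * v i.

Definition residual_sign (v : nat -> R) (p : nat) : R :=
  if z p <= apply_mx v p then 1 else -1.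

(* Subgradient steps of length 1/N for the l1 residual. *)
Fixpoint descent (t : nat) : nat -> R :=
  if t is t'.+1 then fun i =>
    descent t' i - \sum_(p < N) residual_sign (descent t') p * W p i / N%:R
  else fun=> 0.

Definition descent_sum (T i : nat) : R := \sum_(t < T) descent t i.

Definition l1_residual (v : nat -> R) : R := \sum_(p < N) `|apply_mx v p - z p|.

Definition subgradient (v : nat -> R) (i : nat) : R :=
  \sum_(p < N) residual_sign v p * W p i.

Lemma apply_mxB (u v : nat -> R) p :
  apply_mx (fun i => u i - v i) p = apply_mx u p - apply_mx v p.
Proof. by rewrite -sumrB; apply: eq_bigr => i _; rewrite mulrBr. Qed.

Lemma residual_sign_sqr v p : residual_sign v p ^+ 2 = 1.
Proof. by rewrite /residual_sign; case: ifP => _; rewrite ?sqrrN expr1n. Qed.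

Lemma subgradient_ineq (u v : nat -> R) :
  l1_residual v - l1_residual u <= \sum_(i < n) subgradient v i * (v i - u i).
Proof.
have -> : \sum_(i < n) subgradient v i * (v i - u i)
    = \sum_(p < N) residual_sign v p * (apply_mx v p - apply_mx u p).
  under eq_bigr do rewrite mulr_suml.
  rewrite exchange_big /=; apply: eq_bigr => p _; rewrite -apply_mxB mulr_sumr.
  by apply: eq_bigr => i _; rewrite mulrA.
rewrite -sumrB; apply: ler_sum => p _; rewrite /residual_sign.
case: ifP => h.
  rewrite [`|_ - _|]ger0_norm ?subr_ge0 //.
  by have := ler_norm (apply_mx u p - z p); lra.
move/negbT: h; rewrite -ltNge => h.
rewrite [`|_ - _|]ltr0_norm ?subr_lt0 //.
by have := ler_norm (z p - apply_mx u p); rewrite distrC; lra.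
Qed.

Hypotheses (N0 : (0 < N)%N) (n0 : (0 < n)%N).
Variable K2 : R.
Hypothesis K20 : 0 <= K2.
Hypothesis upper : forall x : nat -> R,
  \sum_(p < N) apply_mx x p ^+ 2 <= K2 * N%:R * \sum_(i < n) x i ^+ 2.

Let NR : 0 < N%:R :> R. Proof. by rewrite ltr0n. Qed.
Let nR : 0 < n%:R :> R. Proof. by rewrite ltr0n. Qed.

Lemma subgradient_bound v : \sum_(i < n) subgradient v i ^+ 2 <= K2 * N%:R ^+ 2.
Proof.
set s := \sum_(i < n) _.
have s0 : 0 <= s by rewrite sumr_ge0 // => i _; exact: sqr_ge0.
have [->|sn] := eqVneq s 0; first by rewrite mulr_ge0 // sqr_ge0.
have {}s0 : 0 < s by rewrite lt_def sn.
have sE : s = \sum_(p < N) residual_sign v p * apply_mx (subgradient v) p.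
  rewrite /s; under eq_bigr do rewrite expr2 {1}/subgradient mulr_suml.
  rewrite exchange_big /=; apply: eq_bigr => p _; rewrite mulr_sumr.
  by apply: eq_bigr => i _; rewrite mulrA.
have : s ^+ 2 <= N%:R * (K2 * N%:R * s).
  rewrite {1}sE; apply: le_trans (cauchy_schwarz_sum _ _) _.
  under eq_bigr do rewrite residual_sign_sqr.
  by rewrite sumr_const card_ord ler_wpM2l.
rewrite expr2 (_ : N%:R * (K2 * N%:R * s) = (K2 * N%:R ^+ 2) * s); last by ring.
by rewrite ler_pM2r.
Qed.

Lemma descent_step (u : nat -> R) t :
  \sum_(i < n) (descent t.+1 i - u i) ^+ 2 <=
  \sum_(i < n) (descent t i - u i) ^+ 2
    - 2 / N%:R * (l1_residual (descent t) - l1_residual u) + K2.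
Proof.
set v := descent t.
have -> : \sum_(i < n) (descent t.+1 i - u i) ^+ 2 = \sum_(i < n) (v i - u i) ^+ 2
    - 2 / N%:R * (\sum_(i < n) subgradient v i * (v i - u i))
    + (N%:R ^+ 2)^-1 * \sum_(i < n) subgradient v i ^+ 2.
  rewrite !mulr_sumr -sumrN -!big_split /=; apply: eq_bigr => i _.
  by rewrite -/v -mulr_suml -/(subgradient v i); field; rewrite gt_eqF.
apply: lerD.
  by rewrite lerD2l lerN2 ler_wpM2l ?subgradient_ineq // divr_ge0 // ltW.
rewrite mulrC ler_pdivrMr ?exprn_gt0 //; exact: subgradient_bound.
Qed.

Definition descent_mean (i : nat) : R := descent_sum n i / n%:R.

Lemma descent_mean_residual (u : nat -> R) :
  l1_residual descent_mean <= l1_residual u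
    + N%:R * ((\sum_(i < n) u i ^+ 2) / n%:R + K2) / 2.
Proof.
have tele T : \sum_(i < n) (descent T i - u i) ^+ 2
    + 2 / N%:R * \sum_(t < T) (l1_residual (descent t) - l1_residual u)
    <= \sum_(i < n) u i ^+ 2 + T%:R * K2.
  elim: T => [|T IH].
    rewrite big_ord0 mulr0 mul0r !addr0; apply: ler_sum => i _.
    by rewrite sub0r sqrrN.
  rewrite big_ord_recr /= -natr1 mulrDr mulrDl mul1r.
  by have := descent_step u T; move: IH; lra.
have cvx : l1_residual descent_mean <= (\sum_(t < n) l1_residual (descent t)) / n%:R.
  rewrite exchange_big mulr_suml /=; apply: ler_sum => p _.
  have -> : apply_mx descent_mean p - z p
      = (\sum_(t < n) (apply_mx (descent t) p - z p)) / n%:R.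
    rewrite sumrB sumr_const card_ord -[z p *+ n]mulr_natr mulrBl mulfK ?gt_eqF //.
    congr (_ - _); rewrite exchange_big mulr_suml /=; apply: eq_bigr => i _.
    by rewrite -mulr_sumr mulrA.
  by rewrite normrM normfV [`|n%:R|]gtr0_norm // ler_wpM2r ?invr_ge0 ?ler0n // ler_norm_sum.
apply: le_trans cvx _; rewrite ler_pdivrMr //.
have := tele n; rewrite sumrB sumr_const card_ord -[l1_residual u *+ n]mulr_natl.
set S := \sum_(t < n) l1_residual _; set F := l1_residual u; set U := \sum_(i < n) u i ^+ 2.
have : 0 <= \sum_(i < n) (descent n i - u i) ^+ 2.
  by apply: sumr_ge0 => i _; exact: sqr_ge0.
move: (\sum_(i < n) (descent n i - u i) ^+ 2) => D D0 h.
have {h} : 2 / N%:R * (S - n%:R * F) <= U + n%:R * K2 by lra.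
rewrite mulrAC ler_pdivrMr // => h.
rewrite (_ : (F + N%:R * (U / n%:R + K2) / 2) * n%:R
   = n%:R * F + (U + n%:R * K2) * N%:R / 2); last by field; rewrite gt_eqF.
by lra.
Qed.

Variables (lam kap eps : R) (u : nat -> R).
Hypotheses (lam0 : 0 < lam) (kap0 : 0 < kap) (eps0 : 0 <= eps) (K2E : K2 = kap ^+ 2).
Hypothesis lower : forall x : nat -> R,
  lam * N%:R * Num.sqrt (\sum_(i < n) x i ^+ 2) <= \sum_(p < N) `|apply_mx x p|.
Hypothesis few_bad :
  #|[pred p : 'I_N | eps < `|apply_mx u p - z p|]|%:R <= (lam / (4 * kap)) ^+ 2 * N%:R.

Lemma descent_mean_close :
  \sum_(i < n) (descent_mean i - u i) ^+ 2
    <= ((4 * eps + (\sum_(i < n) u i ^+ 2) / n%:R + kap ^+ 2) / lam) ^+ 2.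
Proof.
set C3 := (\sum_(i < n) u i ^+ 2) / n%:R.
have C30 : 0 <= C3 by rewrite divr_ge0 // sumr_ge0 // => i _; exact: sqr_ge0.
have k20 : 0 <= kap ^+ 2 by exact: sqr_ge0.
pose x i := descent_mean i - u i.
pose bad (p : 'I_N) := eps < `|apply_mx u p - z p|.
set s := \sum_(i < n) _.
have s0 : 0 <= s by rewrite sumr_ge0 // => i _; exact: sqr_ge0.
suff h : Num.sqrt s <= (4 * eps + C3 + kap ^+ 2) / lam.
  rewrite -[X in X <= _]sqr_sqrtr // lerXn2r // nnegrE ?sqrtr_ge0 //.
  exact: le_trans h; rewrite sqrtr_ge0.
have badx : \sum_(p < N | bad p) `|apply_mx x p| <= lam / 4 * N%:R * Num.sqrt s.
  have -> : \sum_(p < N | bad p) `|apply_mx x p|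
      = \sum_(p < N) (bad p)%:R * `|apply_mx x p|.
    by rewrite big_mkcond /=; apply: eq_bigr => p _; case: (bad p); rewrite ?mul1r ?mul0r.
  have b0 : 0 <= \sum_(p < N) (bad p)%:R * `|apply_mx x p|.
    by apply: sumr_ge0 => p _; rewrite mulr_ge0.
  rewrite -[X in X <= _]ger0_norm // -sqrtr_sqr.
  have -> : lam / 4 * N%:R * Num.sqrt s = Num.sqrt ((lam / 4 * N%:R) ^+ 2 * s).
    by rewrite sqrtrM ?sqr_ge0 // sqrtr_sqr ger0_norm // mulr_ge0 ?divr_ge0 // ltW.
  apply: ler_wsqrtr; apply: le_trans (cauchy_schwarz_sum _ _) _.
  have -> : \sum_(p < N) (bad p)%:R ^+ 2 = #|[pred p | bad p]|%:R :> R.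
    rewrite -sum1_card natr_sum [RHS]big_mkcond /=; apply: eq_bigr => p _.
    by rewrite inE; case: (bad p); rewrite ?expr1n ?expr0n.
  under [X in _ * X <= _]eq_bigr do rewrite real_normK ?num_real //.
  apply: le_trans (ler_pM _ _ few_bad (upper x)) _; rewrite ?ler0n //.
    by apply: sumr_ge0 => p _; exact: sqr_ge0.
  rewrite -/s K2E (_ : (lam / (4 * kap)) ^+ 2 * N%:R * (kap ^+ 2 * N%:R * s)
    = (lam / 4 * N%:R) ^+ 2 * s) //.
  by field; rewrite gt_eqF.
have good1 : \sum_(p < N | ~~ bad p) `|apply_mx u p - z p| <= eps * N%:R.
  apply: (@le_trans _ _ (\sum_(p < N) eps)).
    rewrite big_mkcond /=; apply: ler_sum => p _; case: ifP => // .
    by rewrite /bad -leNgt.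
  by rewrite sumr_const card_ord mulr_natr.
have resid := descent_mean_residual u.
have split_l1 (F : nat -> R) : \sum_(p < N) F p
    = \sum_(p < N | bad p) F p + \sum_(p < N | ~~ bad p) F p.
  exact: bigID.
have goodx : \sum_(p < N | ~~ bad p) `|apply_mx x p|
    - \sum_(p < N | ~~ bad p) `|apply_mx u p - z p|
    <= \sum_(p < N | ~~ bad p) `|apply_mx descent_mean p - z p|.
  rewrite -sumrB; apply: ler_sum => p _; rewrite apply_mxB lerBlDr.
  have -> : apply_mx descent_mean p - apply_mx u p =
    (apply_mx descent_mean p - z p) - (apply_mx u p - z p) by ring.
  exact: ler_normB.
have badr : \sum_(p < N | bad p) `|apply_mx u p - z p| - \sum_(p < N | bad p) `|apply_mx x p|
    <= \sum_(p < N | bad p) `|apply_mx descent_mean p - z p|.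
  rewrite -sumrB; apply: ler_sum => p _; rewrite apply_mxB lerBlDr.
  have -> : apply_mx u p - z p =
    (apply_mx descent_mean p - z p) - (apply_mx descent_mean p - apply_mx u p) by ring.
  exact: ler_normB.
have := lower x; rewrite -/s (split_l1 (fun p => `|apply_mx x p|)).
move: resid; rewrite /l1_residual (split_l1 (fun p => `|apply_mx descent_mean p - z p|)).
rewrite (split_l1 (fun p => `|apply_mx u p - z p|)) -/C3 K2E => resid lo.
rewrite ler_pdivlMr //.
suff : N%:R * (Num.sqrt s * lam) <= N%:R * (4 * eps + C3 + kap ^+ 2) by rewrite ler_pM2l.
lra.
Qed.

End Descent.

Lemma rounding_correct {R : realType} (c0 c1 v : R) (s : bool) : 1 <= `|c1 - c0| ->
  s != (0 <= (2 * v - (c0 + c1)) * (c1 - c0)) ->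
  1 <= 4 * (v - (if s then c1 else c0)) ^+ 2.
Proof.
move=> d1 h; set a := c1 - c0 in d1 h.
have a2 : 1 <= a ^+ 2.
  by rewrite -[a ^+ 2]real_normK ?num_real // exprn_ege1.
case: s h => h.
  have {}h : (2 * v - (c0 + c1)) * a < 0 by rewrite ltNge; case: (_ <= _) h.
  have -> : v - c1 = (2 * v - (c0 + c1) - a) / 2 by rewrite /a; field.
  move: h; set b := 2 * v - _ => h; have := sqr_ge0 b.
  have -> : 4 * ((b - a) / 2) ^+ 2 = b ^+ 2 - 2 * (b * a) + a ^+ 2 by field.
  by lra.
have {}h : 0 <= (2 * v - (c0 + c1)) * a by case: (_ <= _) h.
have -> : v - c0 = (2 * v - (c0 + c1) + a) / 2 by rewrite /a; field.
move: h; set b := 2 * v - _ => h; have := sqr_ge0 b.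
have -> : 4 * ((b + a) / 2) ^+ 2 = b ^+ 2 + 2 * (b * a) + a ^+ 2 by field.
by lra.
Qed.

(** * Program logic for the real RAM *)

Section ProgramLogic.
Context {R : realType}.
Implicit Types (st : state R) (c : cmd) (b : bexp).

Fixpoint written_regs c : seq nat :=
  match c with
  | SetReg x _ => [:: x]
  | Seq c1 c2 | If _ c1 c2 => written_regs c1 ++ written_regs c2
  | While _ c1 => written_regs c1
  | _ => [::]
  end.

Fixpoint written_arrays c : seq nat :=
  match c with
  | SetCell t _ _ => [:: t]
  | Seq c1 c2 | If _ c1 c2 => written_arrays c1 ++ written_arrays c2
  | While _ c1 => written_arrays c1
  | _ => [::]
  end.

Definition framed c st st' : Prop :=
  (forall x, x \notin written_regs c -> reg st' x = reg st x) /\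
  (forall t, t \notin written_arrays c -> forall j, cell st' t j = cell st t j).

Lemma exec_framed c st st' T : exec c st st' T -> framed c st st'.
Proof.
elim=> {c st st' T} //=.
- by move=> st x e; split=> // y; rewrite inE /= => /negbTE ->.
- by move=> st t i e; split=> // u; rewrite inE /= => /negbTE -> j.
- move=> st1 st2 st3 c1 c2 T1 T2 _ [r1 a1] _ [r2 a2]; split=> [x|t].
    by rewrite mem_cat negb_or => /andP[? ?]; rewrite r2 // r1.
  by rewrite mem_cat negb_or => /andP[? ?] j; rewrite a2 // a1.
- move=> st st' b c1 c2 T _; case: (beval st b) => -[r1 a1]; split=> [x|t].
  + by rewrite mem_cat negb_or => /andP[? ?]; rewrite r1.
  + by rewrite mem_cat negb_or => /andP[? ?] j; rewrite a1.
  + by rewrite mem_cat negb_or => /andP[? ?]; rewrite r1.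
  + by rewrite mem_cat negb_or => /andP[? ?] j; rewrite a1.
- move=> st1 st2 st3 b c T1 T2 _ _ [r1 a1] _ [r2 a2]; split=> [x hx|t ht j].
    by rewrite r2 // r1.
  by rewrite a2 // a1.
Qed.

Definition runs c st st' (B : nat) : Prop := exists2 T, exec c st st' T & (T <= B)%N.

Lemma runs_framed c st st' B : runs c st st' B -> framed c st st'.
Proof. by case=> T /exec_framed. Qed.

Lemma runs_weaken c st st' B B' : (B <= B')%N -> runs c st st' B -> runs c st st' B'.
Proof. by move=> BB' [T e TB]; exists T => //; apply: leq_trans BB'. Qed.

Lemma runs_seq c1 c2 st1 st2 st3 B1 B2 :
  runs c1 st1 st2 B1 -> runs c2 st2 st3 B2 -> runs (Seq c1 c2) st1 st3 (B1 + B2).+1.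
Proof.
move=> [T1 e1 l1] [T2 e2 l2]; exists (T1 + T2).+1; first exact: ExecSeq e1 e2.
by rewrite ltnS leq_add.
Qed.

Fixpoint straight c : bool :=
  match c with
  | Seq c1 c2 | If _ c1 c2 => straight c1 && straight c2
  | While _ _ => false
  | _ => true
  end.

Fixpoint straight_run c st : state R :=
  match c with
  | SetReg x e => set_reg st x (neval (reg st) e)
  | SetCell t i e => set_cell st t (neval (reg st) i) (reval st e)
  | Seq c1 c2 => straight_run c2 (straight_run c1 st)
  | If b c1 c2 => if beval st b then straight_run c1 st else straight_run c2 st
  | _ => st
  end.

Fixpoint straight_cost c : nat :=
  match c with
  | SetReg _ e => (ncost e).+1
  | SetCell _ i e => (ncost i + rcost e).+1
  | Seq c1 c2 => (straight_cost c1 + straight_cost c2).+1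
  | If b c1 c2 => (bcost b + (straight_cost c1 + straight_cost c2)).+1
  | _ => 1
  end.

Lemma runs_straight c st : straight c -> runs c st (straight_run c st) (straight_cost c).
Proof.
elim: c st => //= [|x e|t i e|c1 IH1 c2 IH2|b c1 IH1 c2 IH2] st.
- by exists 1%N => //; constructor.
- by exists (ncost e).+1 => //; constructor.
- by exists (ncost i + rcost e).+1 => //; constructor.
- by move=> /andP[s1 s2]; apply: runs_seq (IH1 _ s1) (IH2 _ s2).
- move=> /andP[/(IH1 st)[T1 e1 l1] /(IH2 st)[T2 e2 l2]].
  exists (bcost b + (if beval st b then T1 else T2)).+1.
    by constructor; case: (beval st b).
  by rewrite ltnS leq_add2l; case: (beval st b); lia.
Qed.

Lemma runs_while (b : bexp) c (n B : nat) (Inv : nat -> state R -> Prop) st0 :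
  Inv 0%N st0 ->
  (forall i st, (i <= n)%N -> framed c st0 st -> Inv i st -> beval st b = (i < n)%N) ->
  (forall i st, (i < n)%N -> framed c st0 st -> Inv i st ->
     exists2 st', runs c st st' B & Inv i.+1 st') ->
  exists2 st', runs (While b c) st0 st' (n.+1 * (B + bcost b + 1)) &
    framed c st0 st' /\ Inv n st'.
Proof.
move=> I0 guard step.
suff h : forall j st, (j <= n)%N -> framed c st0 st -> Inv (n - j)%N st ->
    exists2 st', runs (While b c) st st' (j.+1 * (B + bcost b + 1)) &
    framed c st0 st' /\ Inv n st'.
  by apply: h => //; rewrite ?subnn.
elim=> [|j IH] st jn fr I.
  exists st; last by rewrite subn0 in I.
  exists (bcost b).+1; last by lia.
  by constructor; rewrite (guard (n - 0)%N) // ?subn0 ?ltnn.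
have lt : (n - j.+1 < n)%N by lia.
have [st1 [T1 e1 l1] I1] := step _ _ lt fr I.
have [r1 a1] := exec_framed e1.
have fr1 : framed c st0 st1.
  by case: fr => r0 a0; split=> [x hx|t ht i]; [rewrite r1 ?r0|rewrite a1 ?a0].
rewrite -subSn // subSS in I1.
have [st2 [T2 e2 l2] [fr2 I2]] := IH st1 (ltnW jn) fr1 I1.
exists st2 => //; exists (bcost b + T1 + T2).+1; last by lia.
by apply: ExecWhileLoop e1 e2; rewrite (guard (n - j.+1)%N) // ltnW.
Qed.

Lemma runs_while_ex (n : nat) (Inv : nat -> state R -> Prop) b c (B : nat) st0
    (Q : state R -> Prop) :
  Inv 0%N st0 ->
  (forall i st, (i <= n)%N -> framed c st0 st -> Inv i st -> beval st b = (i < n)%N) ->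
  (forall i st, (i < n)%N -> framed c st0 st -> Inv i st ->
     exists2 st', runs c st st' B & Inv i.+1 st') ->
  (forall st, framed c st0 st -> Inv n st -> Q st) ->
  exists2 st', runs (While b c) st0 st' (n.+1 * (B + bcost b + 1)) & Q st'.
Proof.
move=> I0 guard step IQ; have [st' r [fr In]] := runs_while I0 guard step.
by exists st' => //; exact: IQ.
Qed.

Lemma runs_seq_ex c1 c2 st1 B1 B2 (P Q : state R -> Prop) :
  (exists2 st2, runs c1 st1 st2 B1 & P st2) ->
  (forall st2, framed c1 st1 st2 -> P st2 -> exists2 st3, runs c2 st2 st3 B2 & Q st3) ->
  exists2 st3, runs (Seq c1 c2) st1 st3 (B1 + B2).+1 & Q st3.
Proof.
move=> [st2 r1 p2] h; have [st3 r2 q3] := h _ (runs_framed r1) p2.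
by exists st3 => //; apply: runs_seq r1 r2.
Qed.

Lemma runs_weaken_ex c st B B' (Q : state R -> Prop) :
  (exists2 st', runs c st st' B & Q st') -> (B <= B')%N ->
  exists2 st', runs c st st' B' & Q st'.
Proof. by move=> [st' r q] BB'; exists st' => //; apply: runs_weaken r. Qed.

Lemma runs_straight_ex c st (P : state R -> Prop) : straight c ->
  P (straight_run c st) -> exists2 st', runs c st st' (straight_cost c) & P st'.
Proof. by move=> s p; exists (straight_run c st) => //; exact: runs_straight. Qed.

End ProgramLogic.

Fixpoint nmulc (m : nat) (e : nexp) : nexp :=
  if m is m'.+1 then NAdd e (nmulc m' e) else NConst 0.

Lemma nmulcE r m e : neval r (nmulc m e) = (m * neval r e)%N.
Proof. by elim: m => //= m ->; rewrite mulSn. Qed.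

Definition BNlt (a b : nexp) : bexp := BNle (NAdd a (NConst 1)) b.

Lemma BNltE {R : realType} (st : state R) a b :
  beval st (BNlt a b) = (neval (reg st) a < neval (reg st) b)%N.
Proof. by rewrite /= addn1. Qed.

Definition incr (x : nat) : cmd := SetReg x (NAdd (NReg x) (NConst 1)).

(** * The attack program *)

(* Registers: 0 and 1 hold n and d, 2 the number g of column pairs per position,
   3 the current number of alternating answers (finally N), 7 the size of the
   current product array; 4-6 and 8-11 are counters and pointers.
   Arrays: 2 holds the sum of the iterates, 4 the iterate, 6 the residual signs,
   8 a scratch cell; l passes leave the answers in 2l+1, the products in 2l+10. *)
Section Passes.
Context {R : realType}.
Implicit Types (st : state R).

Lemma cost_loop (g X a b c : nat) : (0 < X)%N -> (g <= X)%N ->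
  ((a + g.+1 * (b + c + 1)).+1 <= (a + 2 * (b + c + 1) + 1) * X)%N.
Proof. nia. Qed.

Lemma cost_loop_seq (g X a b c e : nat) : (0 < X)%N -> (g <= X)%N ->
  ((a + (g.+1 * (b + c + 1) + e).+1).+1 <= (a + 2 * (b + c + 1) + e + 2) * X)%N.
Proof. nia. Qed.

Lemma nested_count (g M X : nat) : (0 < X)%N -> (g * M <= X)%N -> (g <= X)%N ->
  (M <= X)%N -> (g.+1 * M.+1 <= 4 * X)%N.
Proof. by rewrite mulSn mulnS; lia. Qed.

Lemma cost_nest (g M X a b c e f h i : nat) :
  (0 < X)%N -> (g * M <= X)%N -> (g <= X)%N -> (M <= X)%N ->
  ((a + (g.+1 * ((b + (M.+1 * (c + e + 1) + f).+1).+1 + h + 1) + i).+1).+1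
    <= (a + 4 * (b + c + e + f + h + 4) + i + 2) * X)%N.
Proof.
move=> X0 gM gX MX; have := nested_count X0 gM gX MX.
set Y := (g.+1 * M.+1)%N => YX.
have E : (g.+1 * ((b + (M.+1 * (c + e + 1) + f).+1).+1 + h + 1)
  <= Y * (b + c + e + f + h + 4))%N.
  by rewrite /Y -mulnA leq_mul2l; apply/orP; right; nia.
move: E; set Z := (g.+1 * _)%N; set t := (b + c + e + f + h + 4)%N => E.
have E' : (Z <= 4 * t * X)%N.
  by apply: leq_trans E _; rewrite mulnAC leq_mul2r YX orbT.
have aX := leq_pmulr a X0; have iX := leq_pmulr i X0.
by rewrite !mulnDl; lia.
Qed.

Definition quotient_cmd (m : nat) : cmd :=
  Seq (SetReg 2 (NConst 0))
    (While (BNle (nmulc m (NAdd (NReg 2) (NConst 1))) (NReg 1)) (incr 2)).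

Lemma quotient_cmdP (m : nat) : (0 < m)%N -> exists C, forall st X,
  (0 < X)%N -> (reg st 1 <= X)%N ->
  exists2 st', runs (quotient_cmd m) st st' (C * X) & reg st' 2 = (reg st 1 %/ m)%N.
Proof.
move=> m0; eexists => st X X0 dX.
have gX : (reg st 1 %/ m <= X)%N by apply: leq_trans dX; exact: leq_div.
eapply runs_weaken_ex.
  apply: (runs_seq_ex (P := fun st1 => reg st1 2 = 0%N)).
    by apply: runs_straight_ex.
  move=> st1 fr1 h1; have d1 : reg st1 1 = reg st 1 by rewrite (fr1.1 1%N).
  eapply (@runs_while_ex R (reg st 1 %/ m) (fun i s => reg s 2 = i)) => //.
  - move=> i s ile fr ri; rewrite /= nmulcE /= ri (fr.1 1%N) // d1 addn1.
    by rewrite leq_divRL // mulnC.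
  - by move=> i s ilt fr ri; apply: runs_straight_ex => //=; rewrite ri addn1.
by apply: cost_loop gX.
Qed.

Definition power_step : cmd :=
  Seq (Seq (SetReg 5 (NConst 0)) (SetReg 4 (NConst 0)))
  (Seq (While (BNlt (NReg 4) (NReg 1)) (Seq (SetReg 5 (NAdd (NReg 5) (NReg 3))) (incr 4)))
    (SetReg 3 (NReg 5))).

Lemma power_stepP : exists C, forall st X, (0 < X)%N -> (reg st 1 <= X)%N ->
  exists2 st', runs power_step st st' (C * X) & reg st' 3 = (reg st 1 * reg st 3)%N.
Proof.
eexists => st X X0 dX.
eapply runs_weaken_ex.
  apply: (runs_seq_ex (P := fun s => reg s 4 = 0%N /\ reg s 5 = 0%N)).
    by apply: runs_straight_ex.
  move=> st1 fr1 [h4 h5]; have d1 : reg st1 1 = reg st 1 by rewrite (fr1.1 1%N).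
  have s1 : reg st1 3 = reg st 3 by rewrite (fr1.1 3%N).
  apply: (runs_seq_ex (P := fun s => reg s 5 = (reg st 1 * reg st 3)%N)).
    eapply (@runs_while_ex R (reg st 1)
      (fun i s => reg s 4 = i /\ reg s 5 = (i * reg st 3)%N)).
    + by rewrite h4 h5.
    + by move=> i s ile fr [ri _]; rewrite BNltE /= ri (fr.1 1%N) // d1.
    + move=> i s ilt fr [ri r5]; apply: runs_straight_ex => //=.
      by rewrite ri r5 (fr.1 3%N) // s1 addn1 mulSn addnC.
    + by move=> s _ [].
  by move=> st2 fr2 h2; apply: runs_straight_ex => //=.
by apply: cost_loop_seq dX.
Qed.

Definition difference_pass (m src dst : nat) : cmd :=
  Seq (Seq (SetReg 5 (NConst 0)) (SetReg 4 (NConst 0)))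
  (Seq (While (BNlt (NReg 4) (NReg 2))
    (Seq (SetReg 6 (NAdd (nmulc m (NReg 2)) (nmulc 2 (NReg 4))))
    (Seq (While (BNlt (NReg 6) (NReg 3))
       (Seq (SetCell dst (NReg 5)
              (RSub (RCell src (NAdd (NReg 6) (NConst 1))) (RCell src (NReg 6))))
       (Seq (incr 5) (SetReg 6 (NAdd (NReg 6) (NReg 1))))))
     (incr 4))))
  (SetReg 3 (NReg 5))).

Definition difference (d M o : nat) (y : nat -> R) (q : nat) : R :=
  y ((q %% M) * d + (o + 2 * (q %/ M)).+1)%N - y ((q %% M) * d + (o + 2 * (q %/ M)))%N.

Lemma difference_passP (m src dst : nat) : src != dst ->
  exists C, forall st X g d M y,
  (0 < X)%N -> (g * M <= X)%N -> (g <= X)%N -> (M <= X)%N ->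
  reg st 1 = d -> reg st 2 = g -> reg st 3 = (M * d)%N -> (m * g + 2 * g <= d)%N ->
  (forall q, (q < M * d)%N -> cell st src q = y q) ->
  exists2 st', runs (difference_pass m src dst) st st' (C * X) &
    reg st' 3 = (g * M)%N /\
    (forall q, (q < g * M)%N -> cell st' dst q = difference d M (m * g) y q).
Proof.
move=> sd; eexists => st X g d M y X0 gMX gX MX r1 r2 r3 mgd cy.
pose I t h s := reg s 5 = (t * M + h)%N /\
  (forall q, (q < t * M + h)%N -> cell s dst q = difference d M (m * g) y q).
eapply runs_weaken_ex.
  apply: (runs_seq_ex (P := fun s => reg s 4 = 0%N /\ reg s 5 = 0%N)).
    by apply: runs_straight_ex.
  move=> st1 fr1 [h4 h5].
  apply: (runs_seq_ex (P := I g 0%N)); last first.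
    move=> st2 fr2 [I5 Ic]; apply: runs_straight_ex => //=; rewrite I5 addn0; split=> // q.
    by move=> qM; rewrite Ic // addn0.
  eapply (@runs_while_ex R g (fun t s => reg s 4 = t /\ I t 0%N s)); last by move=> s _ [].
  - by rewrite h4 /I h5.
  - by move=> t s _ fr [rt _]; rewrite BNltE /= rt (fr.1 2%N) // (fr1.1 2%N) // r2.
  move=> t s tg fr [rt [I5 Ic]].
  have s1 : reg s 1 = d by rewrite (fr.1 1%N) // (fr1.1 1%N).
  have s2 : reg s 2 = g by rewrite (fr.1 2%N) // (fr1.1 2%N).
  have s3 : reg s 3 = (M * d)%N by rewrite (fr.1 3%N) // (fr1.1 3%N).
  have sy q : (q < M * d)%N -> cell s src q = y q.
    by move=> qM; rewrite (fr.2 src) ?inE //= (fr1.2 src) // cy.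
  apply: (runs_seq_ex (P := fun s' => reg s' 6 = (m * g + 2 * t)%N /\ I t 0%N s')).
    apply: runs_straight_ex => //=; rewrite nmulcE /= s2 rt; split; last by [].
    by lia.
  move=> u fru [u6 Iu].
  apply: (runs_seq_ex (P := I t M)); last first.
    move=> v frv [v5 Iv]; apply: runs_straight_ex => //=; split.
      by rewrite (frv.1 4%N) // (fru.1 4%N) // rt addn1.
    by rewrite /I /= v5 mulSn addn0 [(M + _)%N]addnC.
  eapply (@runs_while_ex R M (fun h s' => reg s' 6 = (h * d + (m * g + 2 * t))%N /\ I t h s'));
    last by move=> s' _ [].
  - by rewrite u6.
  - move=> h s' _ frs [r6 _]; rewrite BNltE /= r6 (frs.1 3%N) // (fru.1 3%N) // s3.
    apply/idP/idP => [lt|hM]; last by nia.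
    by rewrite ltnNge; apply: contraL lt => Mh; rewrite -leqNgt; nia.
  move=> h s' hM frs [r6 [J5 Jc]]; apply: runs_straight_ex => //=.
  rewrite r6 (frs.1 1%N) // (fru.1 1%N) // s1 J5; split; first by lia.
  rewrite /I /=; split; first by lia.
  move=> q; rewrite addnS ltnS leq_eqVlt => /orP[/eqP ->|lt]; last first.
    by rewrite (ltn_eqF lt) andbF Jc.
  rewrite !eqxx /difference modnMDl divnMDl ?(leq_ltn_trans _ hM) //.
  rewrite modn_small // divn_small // addn0.
  have sc x : (x < M * d)%N -> cell s' src x = y x.
    by move=> xM; rewrite (frs.2 src) ?inE // (fru.2 src) // sy.
  by rewrite !sc ?addn1 ?addnS //; nia.
by apply: cost_nest gMX gX MX.
Qed.

End Passes.

Section MainLoop.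
Context {R : realType}.
Implicit Types (st : state R).

Lemma flat_inj (n a b i j : nat) : (i < n)%N -> (j < n)%N ->
  (a * n + i = b * n + j)%N -> a = b /\ i = j.
Proof.
move=> hi hj e; have n0 : (0 < n)%N by apply: leq_ltn_trans hi.
have := congr1 (divn^~ n) e; rewrite !divnMDl // !divn_small // !addn0 => ab.
by split=> //; move: e; rewrite ab => /addnI.
Qed.

Lemma cost_nest3 (g M n Z X a b c e f h i j l : nat) :
  (0 < Z)%N -> (g * M <= Z)%N -> (g <= Z)%N -> (M <= Z)%N -> (0 < n)%N -> (Z * n <= X)%N ->
  ((a + (g.+1 * ((b + (M.+1 * ((c + n.+1 * (e + f + 1)).+1 + h + 1) + i).+1).+1 + j + 1)
      + l).+1).+1
    <= (a + 8 * (b + c + e + f + h + i + j + 6) + l + 2) * X)%N.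
Proof.
move=> Z0 gM gX MX n0 ZX; have gMZ := nested_count Z0 gM gX MX.
have X0 : (0 < X)%N by apply: leq_trans ZX; rewrite muln_gt0 Z0.
have Y8 : (g.+1 * M.+1 * n.+1 <= 8 * X)%N.
  apply: (@leq_trans (4 * Z * (2 * n))); last by lia.
  by apply: leq_mul => //; lia.
set t := (b + c + e + f + h + i + j + 6)%N.
have E1 : ((c + n.+1 * (e + f + 1)).+1 + h + 1 <= n.+1 * (c + e + f + h + 3))%N by nia.
have E2 : ((b + (M.+1 * ((c + n.+1 * (e + f + 1)).+1 + h + 1) + i).+1).+1 + j + 1
   <= M.+1 * n.+1 * t)%N.
  have := leq_mul (leqnn M.+1) E1; rewrite mulnA; set Y := (M.+1 * n.+1)%N => E3.
  have Y0 : (0 < Y)%N by [].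
  have := leq_pmull (b + i + j + 3) Y0.
  have -> : (Y * t = Y * (c + e + f + h + 3) + Y * (b + i + j + 3))%N.
    by rewrite -mulnDr; congr (_ * _)%N; rewrite /t; lia.
  by lia.
have E : (g.+1 * ((b + (M.+1 * ((c + n.+1 * (e + f + 1)).+1 + h + 1) + i).+1).+1 + j + 1)
   <= 8 * t * X)%N.
  apply: leq_trans (leq_mul (leqnn g.+1) E2) _.
  by have := leq_mul Y8 (leqnn t); rewrite !mulnA [(8 * X * t)%N]mulnAC.
have aX := leq_pmulr a X0; have iX := leq_pmulr l X0.
by rewrite !mulnDl; move: E; set V := (g.+1 * _)%N; lia.
Qed.

Lemma cost_nest2 (g M X a b c e f h : nat) :
  (0 < X)%N -> (g * M <= X)%N -> (g <= X)%N -> (M <= X)%N ->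
  ((a + g.+1 * ((b + (M.+1 * (c + e + 1) + f).+1).+1 + h + 1)).+1
    <= (a + 4 * (b + c + e + f + h + 4) + 0 + 2) * X)%N.
Proof.
move=> X0 gM gX MX; apply: leq_trans (cost_nest a b c e f h 0 X0 gM gX MX).
by rewrite addn0 ltnS leq_add2l leqnSn.
Qed.

Definition product_pass (m src dst : nat) : cmd :=
  Seq (Seq (SetReg 5 (NConst 0)) (SetReg 4 (NConst 0)))
  (Seq (While (BNlt (NReg 4) (NReg 2))
    (Seq (SetReg 6 (NConst 0))
    (Seq (While (BNlt (NReg 6) (NReg 7))
      (Seq (Seq (SetReg 9 (NAdd (nmulc m (NReg 2)) (nmulc 2 (NReg 4)))) (SetReg 8 (NConst 0)))
        (While (BNlt (NReg 8) (NReg 0))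
          (Seq (SetCell dst (NReg 5) (RMul (RCell src (NReg 6))
                 (RSub (RCell 0 (NAdd (NReg 9) (NConst 1))) (RCell 0 (NReg 9)))))
          (Seq (Seq (incr 5) (incr 6))
               (Seq (SetReg 9 (NAdd (NReg 9) (NReg 1))) (incr 8)))))))
     (incr 4))))
  (SetReg 7 (NReg 5))).

Definition column_product (d G o : nat) (u : nat -> R) (w : nat -> nat -> R) (q i : nat) : R :=
  w (q %% G)%N i * (u (i * d + (o + 2 * (q %/ G)).+1)%N - u (i * d + (o + 2 * (q %/ G)))%N).

Lemma product_passP (m src dst : nat) : src != dst -> 0%N != dst ->
  exists C, forall st X Z n g d G u w,
  (0 < Z)%N -> (g * G <= Z)%N -> (g <= Z)%N -> (G <= Z)%N -> (0 < n)%N -> (Z * n <= X)%N ->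
  reg st 0 = n -> reg st 1 = d -> reg st 2 = g -> reg st 7 = (G * n)%N ->
  (forall q, cell st 0 q = u q) ->
  (forall q i, (q < G)%N -> (i < n)%N -> cell st src (q * n + i)%N = w q i) ->
  exists2 st', runs (product_pass m src dst) st st' (C * X) &
    reg st' 7 = (g * G * n)%N /\
    (forall q i, (q < g * G)%N -> (i < n)%N ->
      cell st' dst (q * n + i)%N = column_product d G (m * g) u w q i).
Proof.
move=> sd zd; eexists => st X Z n g d G u w Z0 gG gZ GZ n0 ZX r0 r1 r2 r7 cu cw.
pose I t h i s := reg s 5 = ((t * G + h) * n + i)%N /\
  (forall q j, (q * n + j < (t * G + h) * n + i)%N -> (j < n)%N ->
     cell s dst (q * n + j)%N = column_product d G (m * g) u w q j).
eapply runs_weaken_ex.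
  apply: (runs_seq_ex (P := fun s => reg s 4 = 0%N /\ reg s 5 = 0%N)).
    by apply: runs_straight_ex.
  move=> st1 fr1 [h4 h5].
  apply: (runs_seq_ex (P := I g 0%N 0%N)); last first.
    move=> st2 fr2 [I5 Ic]; apply: runs_straight_ex => //=; rewrite I5 !addn0; split=> // q i.
    by move=> qG hi; rewrite Ic // !addn0; nia.
  eapply (@runs_while_ex R g (fun t s => reg s 4 = t /\ I t 0%N 0%N s)); last by move=> s _ [].
  - by rewrite h4 /I h5.
  - by move=> t s _ fr [rt _]; rewrite BNltE /= rt (fr.1 2%N) // (fr1.1 2%N) // r2.
  move=> t s tg fr [rt It].
  have s0 : reg s 0 = n by rewrite (fr.1 0%N) // (fr1.1 0%N).
  have s1 : reg s 1 = d by rewrite (fr.1 1%N) // (fr1.1 1%N).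
  have s2 : reg s 2 = g by rewrite (fr.1 2%N) // (fr1.1 2%N).
  have s7 : reg s 7 = (G * n)%N by rewrite (fr.1 7%N) // (fr1.1 7%N).
  have su q : cell s 0 q = u q by rewrite (fr.2 0%N) ?inE //= (fr1.2 0%N) // cu.
  have sw q i : (q < G)%N -> (i < n)%N -> cell s src (q * n + i)%N = w q i.
    by move=> qG hi; rewrite (fr.2 src) ?inE //= (fr1.2 src) // cw.
  apply: (runs_seq_ex (P := fun s' => reg s' 6 = 0%N /\ I t 0%N 0%N s')).
    by apply: runs_straight_ex.
  move=> s' fr' [r6 Is'].
  apply: (runs_seq_ex (P := I t G 0%N)); last first.
    move=> v frv Iv; apply: runs_straight_ex => //=; split.
      by rewrite (frv.1 4%N) // (fr'.1 4%N) // rt addn1.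
    by move: Iv; rewrite /I /= mulSn !addn0 [(G + _)%N]addnC.
  eapply (@runs_while_ex R G (fun h v => reg v 6 = (h * n)%N /\ I t h 0%N v));
    last by move=> v _ [].
  - by rewrite r6.
  - move=> h v _ frv [v6 _]; rewrite BNltE /= v6 (frv.1 7%N) // (fr'.1 7%N) // s7.
    by rewrite ltn_mul2r n0.
  move=> h v hG frv [v6 Iv].
  apply: (runs_seq_ex (P := fun x => [/\ reg x 8 = 0%N,
      reg x 9 = (m * g + 2 * t)%N & I t h 0%N x])).
    apply: runs_straight_ex => //=; split=> //.
    rewrite nmulcE /= (frv.1 2%N) // (fr'.1 2%N) // s2 (frv.1 4%N) // (fr'.1 4%N) // rt.
    by lia.
  move=> x frx [x8 x9 Ix].
  eapply (@runs_while_ex R n (fun i x' => [/\ reg x' 8 = i, reg x' 6 = (h * n + i)%N,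
     reg x' 9 = (i * d + (m * g + 2 * t))%N & I t h i x'])).
  - by rewrite x8 (frx.1 6%N) // v6 x9 addn0.
  - move=> i x' _ frx' [x'8 _ _ _].
    by rewrite BNltE /= x'8 (frx'.1 0%N) // (frx.1 0%N) // (frv.1 0%N) // (fr'.1 0%N) // s0.
  - move=> i x' ilt frx' [x'8 x'6 x'9 [J5 Jc]]; apply: runs_straight_ex => //=.
    have y1 : reg x' 1 = d by rewrite (frx'.1 1%N) // (frx.1 1%N) // (frv.1 1%N) // (fr'.1 1%N).
    have yu q : cell x' 0 q = u q.
      by rewrite (frx'.2 0%N) ?inE // (frx.2 0%N) // (frv.2 0%N) ?inE // (fr'.2 0%N).
    have yw q j : (q < G)%N -> (j < n)%N -> cell x' src (q * n + j)%N = w q j.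
      move=> qG hj; rewrite (frx'.2 src) ?inE // (frx.2 src) // (frv.2 src) ?inE //.
      by rewrite (fr'.2 src) // sw.
    rewrite x'8 x'6 x'9 y1 J5; split; try lia.
    rewrite /I /=; split; first by lia.
    move=> q j; rewrite addnS ltnS => le hj.
    rewrite eqxx /=; case: eqP => [e|ne].
      have [-> ->] := flat_inj hj ilt e; rewrite !yu yw //.
      rewrite /column_product modnMDl divnMDl ?(leq_ltn_trans _ hG) // modn_small //.
      by rewrite divn_small // addn0 addn1 addnS.
    by rewrite Jc // ltn_neqAle le andbT; apply/eqP.
  - move=> x' _ [_ x'6 _ [I5 Ic]]; split; first by rewrite x'6 mulSn addnC.
    have E : ((t * G + h) * n + n = (t * G + h.+1) * n + 0)%N by lia.
    by split; rewrite -?E //; move=> q j; rewrite -E; exact: Ic.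
by apply: cost_nest3 gG gZ GZ n0 ZX.
Qed.

Definition running_sum_cmd : cmd :=
  Seq (SetReg 8 (NConst 0)) (While (BNlt (NReg 8) (NReg 0))
    (Seq (SetCell 2 (NReg 8) (RAdd (RCell 2 (NReg 8)) (RCell 4 (NReg 8)))) (incr 8))).

Lemma running_sum_cmdP : exists C, forall st X n, (0 < X)%N -> (n <= X)%N -> reg st 0 = n ->
  exists2 st', runs running_sum_cmd st st' (C * X) &
    forall i, (i < n)%N -> cell st' 2 i = cell st 2 i + cell st 4 i.
Proof.
eexists => st X n X0 nX r0.
eapply runs_weaken_ex.
  apply: (runs_seq_ex (P := fun s => reg s 8 = 0%N)).
    by apply: runs_straight_ex.
  move=> st1 fr1 h8.
  eapply (@runs_while_ex R n (fun i s => reg s 8 = i /\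
    forall j, cell s 2 j = if (j < i)%N then cell st 2 j + cell st 4 j else cell st 2 j)).
  - by rewrite h8; split=> // j; rewrite (fr1.2 2%N).
  - by move=> i s _ fr [ri _]; rewrite BNltE /= ri (fr.1 0%N) // (fr1.1 0%N) // r0.
  - move=> i s ilt fr [ri Ic]; apply: runs_straight_ex => //=; rewrite ri addn1.
    split=> // j; rewrite !Ic (fr.2 4%N) // (fr1.2 4%N) // ltnn ltnS.
    by rewrite [(j <= i)%N]leq_eqVlt; case: eqP => [->|_].
  - by move=> s _ [_ Ic] i ilt; rewrite Ic ilt.
by apply: cost_loop nX.
Qed.

Definition signs_cmd (zs ws : nat) (scl : nexp) : cmd :=
  Seq (Seq (SetReg 6 (NConst 0)) (SetReg 4 (NConst 0)))
    (While (BNlt (NReg 4) (NReg 3))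
      (Seq (Seq (SetCell 8 (NConst 0) (RNat (NConst 0))) (SetReg 8 (NConst 0)))
      (Seq (While (BNlt (NReg 8) (NReg 0))
             (Seq (SetCell 8 (NConst 0) (RAdd (RCell 8 (NConst 0))
                     (RMul (RCell ws (NReg 6)) (RCell 4 (NReg 8)))))
                  (Seq (incr 6) (incr 8))))
        (Seq (If (BRle (RMul (RCell zs (NReg 4)) (RNat scl)) (RCell 8 (NConst 0)))
                (SetCell 6 (NReg 4) (RNat (NConst 1)))
                (SetCell 6 (NReg 4) (RSub (RNat (NConst 0)) (RNat (NConst 1)))))
             (incr 4))))).

Definition scale_exp (averaged : bool) : nexp := if averaged then NReg 0 else NConst 1.
Definition scale (averaged : bool) (n : nat) : R := if averaged then n%:R else 1.

Lemma signs_cmdP (zs ws : nat) (averaged : bool) :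
  zs \notin [:: 6; 8]%N -> ws \notin [:: 6; 8]%N ->
  exists C, forall st X N n W z v,
  (0 < X)%N -> (N * n <= X)%N -> (N <= X)%N -> (n <= X)%N ->
  reg st 0 = n -> reg st 3 = N ->
  (forall p i, (p < N)%N -> (i < n)%N -> cell st ws (p * n + i)%N = W p i) ->
  (forall p, (p < N)%N -> cell st zs p = z p) ->
  (forall i, (i < n)%N -> cell st 4 i = v i) ->
  exists2 st', runs (signs_cmd zs ws (scale_exp averaged)) st st' (C * X) &
    forall p, (p < N)%N -> cell st' 6 p
      = residual_sign n W (fun p => z p * scale averaged n) v p.
Proof.
rewrite !inE !negb_or => /andP[z6 z8] /andP[w6 w8].
eexists => st X N n W z v X0 NnX NX nX r0 r3 cw cz cv.
eapply runs_weaken_ex.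
  apply: (runs_seq_ex (P := fun s => reg s 4 = 0%N /\ reg s 6 = 0%N)).
    by apply: runs_straight_ex.
  move=> st1 fr1 [h4 h6].
  eapply (@runs_while_ex R N (fun t s => [/\ reg s 4 = t, reg s 6 = (t * n)%N &
    forall p, (p < t)%N -> cell s 6 p = residual_sign n W (fun p => z p * scale averaged n) v p])).
  - by rewrite h4 h6.
  - by move=> t s _ fr [rt _ _]; rewrite BNltE /= rt (fr.1 3%N) // (fr1.1 3%N) // r3.
  - move=> t s tN fr [rt r6 Is].
    have s0 : reg s 0 = n by rewrite (fr.1 0%N) // (fr1.1 0%N).
    have sw p i : (p < N)%N -> (i < n)%N -> cell s ws (p * n + i)%N = W p i.
      by move=> pN hi; rewrite (fr.2 ws) ?inE ?negb_or ?w8 ?w6 //= (fr1.2 ws) // cw.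
    have sz p : (p < N)%N -> cell s zs p = z p.
      by move=> pN; rewrite (fr.2 zs) ?inE ?negb_or ?z8 ?z6 //= (fr1.2 zs) // cz.
    have sv i : (i < n)%N -> cell s 4 i = v i.
      by move=> hi; rewrite (fr.2 4%N) // (fr1.2 4%N) // cv.
    apply: (runs_seq_ex (P := fun x => reg x 8 = 0%N /\ cell x 8 0%N = 0)).
      by apply: runs_straight_ex.
    move=> x frx [x8 xc].
    apply: (runs_seq_ex (P := fun y => reg y 6 = (t.+1 * n)%N /\
        cell y 8 0%N = apply_mx n W v t)).
      eapply (@runs_while_ex R n (fun i y => [/\ reg y 8 = i, reg y 6 = (t * n + i)%N &
        cell y 8 0%N = \sum_(j < i) W t j * v j])).
      + by rewrite x8 (frx.1 6%N) // r6 addn0 xc big_ord0.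
      + by move=> i y _ fry [yi _ _]; rewrite BNltE /= yi (fry.1 0%N) // (frx.1 0%N) // s0.
      + move=> i y ilt fry [yi y6 yc]; apply: runs_straight_ex => //=.
        rewrite y6 yi yc (fry.2 ws) ?inE // (frx.2 ws) ?inE // sw //.
        rewrite (fry.2 4%N) // (frx.2 4%N) // sv // !addn1 big_ord_recr /=.
        by rewrite addnS.
      + by move=> y _ [_ y6 yc]; rewrite y6 yc mulSn addnC.
    move=> y fry [y6 yc]; apply: runs_straight_ex => //.
    have y4 : reg y 4 = t by rewrite (fry.1 4%N) // (frx.1 4%N).
    have y0 : reg y 0 = n by rewrite (fry.1 0%N) // (frx.1 0%N).
    have yz : cell y zs t = z t by rewrite (fry.2 zs) ?inE // (frx.2 zs) ?inE // sz.
    have yI p : (p < t)%N -> cell y 6 p = residual_sign n W (fun p => z p * scale averaged n) v p.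
      by move=> pt; rewrite (fry.2 6%N) // (frx.2 6%N) // Is.
    have ysc : (neval (reg y) (scale_exp averaged))%:R = scale averaged n :> R.
      by rewrite /scale_exp /scale; case: (averaged); rewrite //= y0.
    rewrite /= y4 yz yc ysc.
    case: ifP => hle /=; rewrite y4 addn1 y6; split=> // p; rewrite ltnS leq_eqVlt => /orP[].
    + by move/eqP=> ->; rewrite eqxx /residual_sign hle.
    + by move=> pt; rewrite ltn_eqF // yI.
    + by move/eqP=> ->; rewrite eqxx /residual_sign hle sub0r.
    + by move=> pt; rewrite ltn_eqF // yI.
  - by move=> s _ [].
by apply: cost_nest2 NnX NX nX.
Qed.

Definition update_cmd (ws : nat) : cmd :=
  Seq (Seq (SetReg 6 (NConst 0)) (SetReg 4 (NConst 0)))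
    (While (BNlt (NReg 4) (NReg 3))
      (Seq (SetReg 8 (NConst 0))
      (Seq (While (BNlt (NReg 8) (NReg 0))
             (Seq (SetCell 4 (NReg 8) (RSub (RCell 4 (NReg 8))
                (RDiv (RMul (RCell 6 (NReg 4)) (RCell ws (NReg 6))) (RNat (NReg 3)))))
                  (Seq (incr 6) (incr 8))))
        (incr 4)))).

Lemma update_cmdP (ws : nat) : ws != 4%N ->
  exists C, forall st X N n W sg v,
  (0 < X)%N -> (N * n <= X)%N -> (N <= X)%N -> (n <= X)%N ->
  reg st 0 = n -> reg st 3 = N ->
  (forall p i, (p < N)%N -> (i < n)%N -> cell st ws (p * n + i)%N = W p i) ->
  (forall p, (p < N)%N -> cell st 6 p = sg p) ->
  (forall i, (i < n)%N -> cell st 4 i = v i) ->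
  exists2 st', runs (update_cmd ws) st st' (C * X) &
    forall i, (i < n)%N -> cell st' 4 i = v i - \sum_(p < N) sg p * W p i / N%:R.
Proof.
move=> w4.
eexists => st X N n W sg v X0 NnX NX nX r0 r3 cw cs cv.
eapply runs_weaken_ex.
  apply: (runs_seq_ex (P := fun s => reg s 4 = 0%N /\ reg s 6 = 0%N)).
    by apply: runs_straight_ex.
  move=> st1 fr1 [h4 h6].
  eapply (@runs_while_ex R N (fun t s => [/\ reg s 4 = t, reg s 6 = (t * n)%N &
    forall i, (i < n)%N -> cell s 4 i = v i - \sum_(p < t) sg p * W p i / N%:R])).
  - by rewrite h4 h6; split=> // i hi; rewrite big_ord0 subr0 (fr1.2 4%N) // cv.
  - by move=> t s _ fr [rt _ _]; rewrite BNltE /= rt (fr.1 3%N) // (fr1.1 3%N) // r3.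
  - move=> t s tN fr [rt r6 Is].
    have s0 : reg s 0 = n by rewrite (fr.1 0%N) // (fr1.1 0%N).
    have s3 : reg s 3 = N by rewrite (fr.1 3%N) // (fr1.1 3%N).
    have sw p i : (p < N)%N -> (i < n)%N -> cell s ws (p * n + i)%N = W p i.
      by move=> pN hi; rewrite (fr.2 ws) ?inE //= (fr1.2 ws) // cw.
    have ss p : (p < N)%N -> cell s 6 p = sg p.
      by move=> pN; rewrite (fr.2 6%N) // (fr1.2 6%N) // cs.
    apply: (runs_seq_ex (P := fun x => reg x 8 = 0%N)); first by apply: runs_straight_ex.
    move=> x frx x8.
    apply: (runs_seq_ex (P := fun y => reg y 6 = (t.+1 * n)%N /\
        forall i, (i < n)%N -> cell y 4 i = v i - \sum_(p < t.+1) sg p * W p i / N%:R)).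
      eapply (@runs_while_ex R n (fun i y => [/\ reg y 8 = i, reg y 6 = (t * n + i)%N &
        forall j, (j < n)%N -> cell y 4 j = if (j < i)%N
          then v j - \sum_(p < t.+1) sg p * W p j / N%:R
          else v j - \sum_(p < t) sg p * W p j / N%:R])).
      + by rewrite x8 (frx.1 6%N) // r6 addn0; split=> // j hj; rewrite (frx.2 4%N) // Is.
      + by move=> i y _ fry [yi _ _]; rewrite BNltE /= yi (fry.1 0%N) // (frx.1 0%N) // s0.
      + move=> i y ilt fry [yi y6 yc]; apply: runs_straight_ex => //=.
        rewrite y6 yi !addn1 addnS; split=> // j hj.
        rewrite ltnS leq_eqVlt; case: eqP => [->|_] /=; last by rewrite yc.
        rewrite yc // ltnn (fry.1 4%N) // (frx.1 4%N) // rt.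
        rewrite (fry.2 6%N) // (frx.2 6%N) // ss // (fry.2 ws) ?inE // (frx.2 ws) ?inE // sw //.
        rewrite (fry.1 3%N) // (frx.1 3%N) // s3 big_ord_recr /=.
        by rewrite opprD addrA.
      + move=> y _ [_ y6 yc]; rewrite y6 mulSn addnC; split=> // i hi.
        by rewrite yc // hi.
    move=> y fry [y6 yc]; apply: runs_straight_ex => //=.
    by rewrite (fry.1 4%N) // (frx.1 4%N) // rt addn1 y6.
  - by move=> s _ [].
by apply: cost_nest2 NnX NX nX.
Qed.

End MainLoop.

Lemma leq_exp2r_homo (a b l : nat) : (a <= b)%N -> (a ^ l <= b ^ l)%N.
Proof. by case: l => // l ab; rewrite leq_exp2r. Qed.

Section Attack.
Context {R : realType}.
Implicit Types (st : state R) (u y : nat -> R).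

Section FlatArrays.
Variables (k d : nat).

Definition half_block : nat := (d %/ (2 * k))%N.
Local Notation g := half_block.

(* The l-th pass treats position k-1-l of the query tuple, which uses the column
   pairs starting at [pair_offset l]; it moves the new index to the front. *)
Definition pair_offset (l : nat) : nat := (2 * (k - l.+1) * g)%N.

Fixpoint alternating_answers y (l : nat) : nat -> R :=
  if l is l'.+1 then
    difference d (g ^ l' * d ^ (k - l'.+1)) (pair_offset l') (alternating_answers y l')
  else y.

Fixpoint query_matrix u (l : nat) : nat -> nat -> R :=
  if l is l'.+1 then column_product d (g ^ l') (pair_offset l') u (query_matrix u l')
  else fun _ _ => 1.

Lemma half_block_le : (0 < k)%N -> (2 * k * g <= d)%N.
Proof. by move=> k0; rewrite mulnC leq_divM. Qed.

End FlatArrays.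

Definition attack_mean (k : nat) (averaged : bool) (n d : nat) u y (i : nat) : R :=
  descent_sum (half_block k d ^ k) n (query_matrix k d u k)
    (fun p => alternating_answers k d y k p * scale averaged n) n i.

Definition attack_bit (k : nat) (averaged : bool) (sig a : R) (n d : nat) u y (i : nat) : bool :=
  0 <= (2 * attack_mean k averaged n d u y i - sig * n%:R) * a.

Definition init_cmd : cmd :=
  Seq (SetReg 8 (NConst 0)) (Seq (While (BNlt (NReg 8) (NReg 0))
    (Seq (SetCell 10 (NReg 8) (RNat (NConst 1))) (incr 8))) (SetReg 7 (NReg 0))).

Lemma init_cmdP : exists C, forall st X n, (0 < X)%N -> (n <= X)%N -> reg st 0 = n ->
  exists2 st', runs init_cmd st st' (C * X) &
    reg st' 7 = n /\ forall i, (i < n)%N -> cell st' 10 i = 1.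
Proof.
eexists => st X n X0 nX r0.
eapply runs_weaken_ex.
  apply: (runs_seq_ex (P := fun s => reg s 8 = 0%N)).
    by apply: runs_straight_ex.
  move=> st1 fr1 h8.
  apply: (runs_seq_ex (P := fun s => forall i, (i < n)%N -> cell s 10 i = 1)).
    eapply (@runs_while_ex R n (fun i s => reg s 8 = i /\
      forall j, (j < i)%N -> cell s 10 j = 1)).
    - by rewrite h8.
    - by move=> i s _ fr [ri _]; rewrite BNltE /= ri (fr.1 0%N) // (fr1.1 0%N) // r0.
    - move=> i s ilt fr [ri Ic]; apply: runs_straight_ex => //=; rewrite ri addn1.
      by split=> // j; rewrite ltnS leq_eqVlt; case: eqP => //= _; exact: Ic.
    - by move=> s _ [_ Ic].
  move=> st2 fr2 h2; apply: runs_straight_ex => //=; split=> //.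
  by rewrite (fr2.1 0%N) // (fr1.1 0%N).
by apply: cost_loop_seq nX.
Qed.

Fixpoint power_cmd (k : nat) : cmd :=
  if k is k'.+1 then Seq (power_cmd k') power_step else SetReg 3 (NConst 1).

Lemma power_cmd_frame k : {subset written_regs (power_cmd k) <= [:: 3; 4; 5]%N}
  /\ written_arrays (power_cmd k) = [::].
Proof.
elim: k => [|k [IH1 IH2]] /=; first by split=> // x; rewrite !inE => ->.
rewrite IH2; split=> // x; rewrite mem_cat => /orP[/IH1 //|].
by rewrite !inE; do !case/orP; move=> /eqP ->.
Qed.

Lemma power_cmdP (k : nat) : exists C, forall st X, (0 < X)%N -> (reg st 1 <= X)%N ->
  exists2 st', runs (power_cmd k) st st' (C * X) & reg st' 3 = (reg st 1 ^ k)%N.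
Proof.
elim: k => [|k [C IH]].
  exists 2%N => st X X0 _; eapply runs_weaken_ex; first by apply: runs_straight_ex.
  by rewrite /= ; lia.
have [C' hC'] := @power_stepP R.
exists (C + C' + 1)%N => st X X0 dX; eapply runs_weaken_ex.
  apply: (runs_seq_ex (IH st X X0 dX)) => st1 fr1 h1.
  have d1 : reg st1 1 = reg st 1.
    by rewrite (fr1.1 1%N) //; apply/negP => /(power_cmd_frame k).1.
  by have [|st2 r2 h2] := hC' st1 X X0; [rewrite d1|exists st2; [exact: r2|rewrite h2 d1 h1 expnS]].
by rewrite !mulnDl; lia.
Qed.

Definition answers_array (l : nat) : nat := (2 * l + 1)%N.
Definition products_array (l : nat) : nat := (2 * l + 10)%N.

Fixpoint passes_cmd (k l : nat) : cmd :=
  if l is l'.+1 then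
    Seq (passes_cmd k l')
    (Seq (difference_pass (2 * (k - l)) (answers_array l') (answers_array l))
         (product_pass (2 * (k - l)) (products_array l') (products_array l)))
  else Skip.

Lemma passes_cmdP (k l : nat) : (0 < k)%N -> (l <= k)%N -> exists C, forall st n d u y,
  let g := half_block k d in
  (0 < n)%N -> (0 < d)%N ->
  reg st 0 = n -> reg st 1 = d -> reg st 2 = g -> reg st 3 = (d ^ k)%N -> reg st 7 = n ->
  (forall q, cell st 0 q = u q) -> (forall q, cell st 1 q = y q) ->
  (forall i, (i < n)%N -> cell st 10 i = 1) ->
  exists2 st', runs (passes_cmd k l) st st' (C * (d ^ k * n)) &
    [/\ reg st' 0 = n, reg st' 1 = d, reg st' 2 = g, reg st' 3 = (g ^ l * d ^ (k - l))%N
      & reg st' 7 = (g ^ l * n)%N] /\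
    [/\ (forall q, cell st' 0 q = u q),
        (forall t, t \in [:: 2; 4]%N -> forall q, cell st' t q = cell st t q),
        (forall q, (q < g ^ l * d ^ (k - l))%N ->
           cell st' (answers_array l) q = alternating_answers k d y l q) &
        (forall q i, (q < g ^ l)%N -> (i < n)%N ->
           cell st' (products_array l) (q * n + i)%N = query_matrix k d u l q i)].
Proof.
move=> k0; elim: l => [|l IH] lk.
  exists 1%N => st n d u y g n0 d0 r0 r1 r2 r3 r7 cu cy c10.
  exists st; first by exists 1%N; [constructor|rewrite mul1n muln_gt0 expn_gt0 d0].
  split; first by split=> //; rewrite ?expn0 ?mul1n ?subn0.
  split=> // q i; rewrite expn0 ltnS leqn0 => /eqP -> hi /=.
  by rewrite mul0n add0n; exact: c10.
have [C hC] := IH (ltnW lk).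
have [|C1 hC1] := @difference_passP R (2 * (k - l.+1)) (answers_array l) (answers_array l.+1).
  by rewrite /answers_array; apply/eqP; lia.
have [||C2 hC2] := @product_passP R (2 * (k - l.+1)) (products_array l) (products_array l.+1).
- by rewrite /products_array; apply/eqP; lia.
- by rewrite /products_array; apply/eqP; lia.
exists (C + C1 + C2 + 2)%N => st n d u y g n0 d0 r0 r1 r2 r3 r7 cu cy c10.
have gd : (g <= d)%N by rewrite leq_div.
have kE : (k - l = (k - l.+1).+1)%N by lia.
pose M := (g ^ l * d ^ (k - l.+1))%N.
have leZ a b : (a + b <= k)%N -> (g ^ a * d ^ b <= d ^ k)%N.
  move=> ab; apply: (@leq_trans (d ^ (a + b))); last by rewrite leq_pexp2l.
  by rewrite expnD leq_mul2r leq_exp2r_homo ?orbT.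
have Z0 : (0 < d ^ k)%N by rewrite expn_gt0 d0.
have gM : (g * M = g ^ l.+1 * d ^ (k - l.+1))%N by rewrite /M expnS mulnA.
have gMZ : (g * M <= d ^ k)%N by rewrite gM leZ //; lia.
have MZ : (M <= d ^ k)%N by rewrite /M leZ //; lia.
have gZ : (g <= d ^ k)%N by have := leZ 1%N 0%N; rewrite expn1 expn0 muln1; apply.
have glZ : (g ^ l <= d ^ k)%N by have := leZ l 0%N; rewrite expn0 muln1; apply; lia.
have gglZ : (g * g ^ l <= d ^ k)%N.
  by have := leZ l.+1 0%N; rewrite expn0 muln1 expnS; apply; lia.
set X := (d ^ k * n)%N.
have ZX : (d ^ k <= X)%N by rewrite leq_pmulr.
have X0 : (0 < X)%N by apply: leq_trans ZX.
eapply runs_weaken_ex.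
  eapply runs_seq_ex; first exact: (hC st n d u y).
  move=> st1 fr1 [[s0 s1 s2 s3 s7] [su s24 sy sw]].
  eapply runs_seq_ex.
    eapply (hC1 st1 X g d M (alternating_answers k d y l)) => //.
    - exact: leq_trans gMZ ZX.
    - exact: leq_trans gZ ZX.
    - exact: leq_trans MZ ZX.
    - by rewrite s3 kE expnSr mulnA.
    - apply: leq_trans (half_block_le d k0); rewrite -mulnDl leq_mul2r; apply/orP; right; lia.
    - by move=> q; rewrite /M -mulnA -expnSr -kE; exact: sy.
  move=> st2 fr2 [t3 tz].
  have t0 : reg st2 0 = n by rewrite (fr2.1 0%N).
  have t1 : reg st2 1 = d by rewrite (fr2.1 1%N).
  have t2 : reg st2 2 = g by rewrite (fr2.1 2%N).
  have t7 : reg st2 7 = (g ^ l * n)%N by rewrite (fr2.1 7%N).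
  have na t : ~~ odd t -> forall q, cell st2 t q = cell st1 t q.
    move=> ot; apply: fr2.2; rewrite /= inE /answers_array; apply: contra ot => /eqP ->.
    by lia.
  have [||||||||||||st3 rr3 [v7 vw]] := hC2 st2 X (d ^ k)%N n g d (g ^ l)%N u (query_matrix k d u l);
    rewrite ?leqnn //.
  - by move=> q; rewrite na.
  - by move=> q i qg hi; rewrite na ?sw // /products_array; lia.
  have fr3 := runs_framed rr3.
  exists st3; first exact: rr3.
  have nb t : t != products_array l.+1 -> forall q, cell st3 t q = cell st2 t q.
    by move=> ot; apply: fr3.2; rewrite /= inE.
  split.
    by split; rewrite ?(fr3.1 0%N) ?(fr3.1 1%N) ?(fr3.1 2%N) ?(fr3.1 3%N) ?t3 ?v7 ?gM ?expnS.
  split.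
  - by move=> q; rewrite nb ?na ?su // /products_array; apply/eqP; lia.
  - move=> t tt q; rewrite nb ?na ?s24 //; move: tt; rewrite !inE => /orP[]/eqP-> //.
      by rewrite /products_array; apply/eqP; lia.
    by rewrite /products_array; apply/eqP; lia.
  - move=> q; rewrite -gM => qM; rewrite nb ?tz // /products_array /answers_array.
    by apply/eqP; lia.
  - by move=> q i; rewrite expnS => qg hi; rewrite vw.
by rewrite !mulnDl -/X; lia.
Qed.

Definition descent_cmd (zs ws : nat) (averaged : bool) : cmd :=
  Seq (SetReg 11 (NConst 0)) (While (BNlt (NReg 11) (NReg 0))
    (Seq running_sum_cmd (Seq (signs_cmd zs ws (scale_exp averaged))
      (Seq (update_cmd ws) (incr 11))))).

Lemma descent_cmdP (zs ws : nat) (averaged : bool) :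
  zs \notin [:: 2; 4; 6; 8]%N -> ws \notin [:: 2; 4; 6; 8]%N ->
  exists C, forall st Z N n W z, (0 < n)%N -> (0 < Z)%N -> (N <= Z)%N ->
  reg st 0 = n -> reg st 3 = N ->
  (forall p i, (p < N)%N -> (i < n)%N -> cell st ws (p * n + i)%N = W p i) ->
  (forall p, (p < N)%N -> cell st zs p = z p) ->
  (forall i, cell st 2 i = 0) -> (forall i, cell st 4 i = 0) ->
  exists2 st', runs (descent_cmd zs ws averaged) st st' (C * (Z * n ^ 2)) &
    forall i, (i < n)%N -> cell st' 2 i
      = descent_sum N n W (fun p => z p * scale averaged n) n i.
Proof.
move=> hz hw.
have [C1 hC1] := @running_sum_cmdP R.
have [||C2 hC2] := @signs_cmdP R zs ws averaged.
- by move: hz; rewrite !inE !negb_or => /and4P[_ _ -> ->].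
- by move: hw; rewrite !inE !negb_or => /and4P[_ _ -> ->].
have [|C3 hC3] := @update_cmdP R ws.
  by move: hw; rewrite !inE !negb_or => /and4P[_ -> _ _].
exists (3 + 2 * (C1 + C2 + C3 + 20))%N => st Z N n W z n0 Z0 NZ r0 r3 cw cz c2 c4.
pose z' p := z p * scale averaged n.
set X := (Z * n)%N.
have nX : (n <= X)%N by rewrite leq_pmull.
have X0 : (0 < X)%N by apply: leq_trans nX.
have NX : (N <= X)%N by apply: leq_trans NZ _; rewrite leq_pmulr.
have NnX : (N * n <= X)%N by rewrite leq_mul2r NZ orbT.
eapply runs_weaken_ex.
  apply: (runs_seq_ex (P := fun s => reg s 11 = 0%N)).
    by apply: runs_straight_ex.
  move=> st1 fr1 h11.
  eapply (@runs_while_ex R n (fun T s => [/\ reg s 11 = T,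
    forall i, (i < n)%N -> cell s 4 i = descent N n W z' T i &
    forall i, (i < n)%N -> cell s 2 i = descent_sum N n W z' T i])).
  - split=> // i hi; first by rewrite (fr1.2 4%N) // c4.
    by rewrite (fr1.2 2%N) // c2 /descent_sum big_ord0.
  - by move=> T s _ fr [rT _ _]; rewrite BNltE /= rT (fr.1 0%N) // (fr1.1 0%N) // r0.
  - move=> T s Tn fr [rT s4 s2].
    have s0 : reg s 0 = n by rewrite (fr.1 0%N) // (fr1.1 0%N).
    have s3 : reg s 3 = N by rewrite (fr.1 3%N) // (fr1.1 3%N).
    have sw p i : (p < N)%N -> (i < n)%N -> cell s ws (p * n + i)%N = W p i.
      move=> pN hi; rewrite (fr.2 ws) ?(fr1.2 ws) ?cw //=.
      by move: hw; rewrite !inE !negb_or => /and4P[-> -> -> ->].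
    have sz p : (p < N)%N -> cell s zs p = z p.
      move=> pN; rewrite (fr.2 zs) ?(fr1.2 zs) ?cz //=.
      by move: hz; rewrite !inE !negb_or => /and4P[-> -> -> ->].
    eapply (runs_seq_ex (hC1 s X n X0 nX s0)) => a fra a2.
    eapply runs_seq_ex.
      eapply (hC2 a X N n W z (descent N n W z' T)) => //.
      + by rewrite (fra.1 0%N).
      + by rewrite (fra.1 3%N).
      + move=> p i pN hi; rewrite (fra.2 ws) ?sw //=.
        by move: hw; rewrite !inE !negb_or => /and4P[-> _ _ _].
      + move=> p pN; rewrite (fra.2 zs) ?sz //=.
        by move: hz; rewrite !inE !negb_or => /and4P[-> _ _ _].
      + by move=> i hi; rewrite (fra.2 4%N) // s4.
    move=> b frb b6.
    eapply runs_seq_ex.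
      eapply (hC3 b X N n W (residual_sign n W z' (descent N n W z' T))
         (descent N n W z' T)) => //.
      + by rewrite (frb.1 0%N) // (fra.1 0%N).
      + by rewrite (frb.1 3%N) // (fra.1 3%N).
      + move=> p i pN hi; rewrite (frb.2 ws) ?(fra.2 ws) ?sw //=.
          by move: hw; rewrite !inE !negb_or => /and4P[-> _ _ _].
        by move: hw; rewrite !inE !negb_or => /and4P[_ _ -> ->].
      + by move=> i hi; rewrite (frb.2 4%N) // (fra.2 4%N) // s4.
    move=> c frc c4'; apply: runs_straight_ex => //=; split.
    + by rewrite (frc.1 11%N) // (frb.1 11%N) // (fra.1 11%N) // rT addn1.
    + by move=> i hi; rewrite c4'.
    + move=> i hi; rewrite (frc.2 2%N) // (frb.2 2%N) // a2 // s2 // s4 //.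
      by rewrite /descent_sum big_ord_recr.
  - by move=> s _ [].
have -> : (Z * n ^ 2 = X * n)%N by rewrite /X expnS expn1 mulnA.
rewrite /=; set t := (C1 + C2 + C3 + 20)%N.
apply: (@leq_trans (3 + n.+1 * (t * X))).
  rewrite -addSn leq_add2l leq_mul2l; apply/orP; right.
  by rewrite /t !mulnDl; lia.
have nX1 : (n.+1 * (t * X) <= 2 * t * (X * n))%N.
  rewrite (_ : 2 * t * (X * n) = (2 * n) * (t * X))%N; last by ring.
  by rewrite leq_mul2r; apply/orP; right; lia.
rewrite mulnDl; apply: leq_add => //.
by rewrite leq_pmulr // muln_gt0 X0.
Qed.

Definition rint (p q : nat) : rexp := RSub (RNat (NConst p)) (RNat (NConst q)).

Definition rounding_cmd (sig a : rexp) : cmd :=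
  Seq (SetReg 8 (NConst 0)) (While (BNlt (NReg 8) (NReg 0))
    (Seq (If (BRle (RNat (NConst 0)) (RMul (RSub (RMul (RNat (NConst 2)) (RCell 2 (NReg 8)))
                                       (RMul sig (RNat (NReg 0)))) a))
           (SetCell 2 (NReg 8) (RNat (NConst 1)))
           (SetCell 2 (NReg 8) (RNat (NConst 0))))
         (incr 8))).

Lemma rounding_cmdP (p1 q1 p2 q2 : nat) :
  exists C, forall st X n, (0 < X)%N -> (n <= X)%N -> reg st 0 = n ->
  exists2 st', runs (rounding_cmd (rint p1 q1) (rint p2 q2)) st st' (C * X) &
    forall i, (i < n)%N -> cell st' 2 i =
      (0 <= (2 * cell st 2 i - (p1%:R - q1%:R) * n%:R) * (p2%:R - q2%:R) :> R)%R%:R.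
Proof.
eexists => st X n X0 nX r0.
pose out i : R := (0 <= (2 * cell st 2 i - (p1%:R - q1%:R) * n%:R) * (p2%:R - q2%:R) :> R)%R%:R.
eapply runs_weaken_ex.
  apply: (runs_seq_ex (P := fun s => reg s 8 = 0%N)).
    by apply: runs_straight_ex.
  move=> st1 fr1 h8.
  eapply (@runs_while_ex R n (fun i s => reg s 8 = i /\
    forall j, cell s 2 j = if (j < i)%N then out j else cell st 2 j)).
  - by rewrite h8; split=> // j; rewrite (fr1.2 2%N).
  - by move=> i s _ fr [ri _]; rewrite BNltE /= ri (fr.1 0%N) // (fr1.1 0%N) // r0.
  - move=> i s ilt fr [ri Ic]; apply: runs_straight_ex => //=.
    rewrite ri (fr.1 0%N) // (fr1.1 0%N) // r0 Ic ltnn.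
    case: ifP => h /=; rewrite ri addn1; split=> // j; rewrite ltnS [(j <= i)%N]leq_eqVlt;
      case: eqP => [->|_] /=; rewrite ?Ic // /out h //.
  - by move=> s _ [_ Ic] i ilt; rewrite Ic ilt.
by apply: cost_loop nX.
Qed.

Definition attack_program (k : nat) (averaged : bool) (p1 q1 p2 q2 : nat) : cmd :=
  Seq (quotient_cmd (2 * k))
  (Seq (power_cmd k)
  (Seq init_cmd
  (Seq (passes_cmd k k)
  (Seq (descent_cmd (answers_array k) (products_array k) averaged)
       (rounding_cmd (rint p1 q1) (rint p2 q2)))))).

Lemma attack_programP (k : nat) (averaged : bool) (p1 q1 p2 q2 : nat) : (0 < k)%N ->
  exists C, forall st n d u y, (0 < n)%N -> (0 < d)%N ->
  reg st 0 = n -> reg st 1 = d ->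
  (forall q, cell st 0 q = u q) -> (forall q, cell st 1 q = y q) ->
  (forall q, cell st 2 q = 0) -> (forall q, cell st 4 q = 0) ->
  exists2 st', runs (attack_program k averaged p1 q1 p2 q2) st st' (C * (d ^ k * n ^ 2)) &
    forall i, (i < n)%N -> cell st' 2 i =
      (attack_bit k averaged (p1%:R - q1%:R) (p2%:R - q2%:R) n d u y i)%:R.
Proof.
move=> k0.
have [|Cq hq] := @quotient_cmdP R (2 * k); first by lia.
have [Cp hp] := power_cmdP k.
have [Ci hi] := init_cmdP.
have [Cs hs] := passes_cmdP k0 (leqnn k).
have [||Cd hd] := @descent_cmdP (answers_array k) (products_array k) averaged.
- by rewrite /answers_array !inE; lia.
- by rewrite /products_array !inE; lia.
have [Cr hr] := rounding_cmdP p1 q1 p2 q2.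
exists (Cq + Cp + Ci + Cs + Cd + Cr + 10)%N => st n d u y n0 d0 r0 r1 cu cy c2 c4.
set X := (d ^ k * n ^ 2)%N.
have Z0 : (0 < d ^ k)%N by rewrite expn_gt0 d0.
have n1 : (n <= n ^ 2)%N by rewrite expnS expn1 leq_pmulr.
have dZ : (d <= d ^ k)%N by rewrite -{1}[d]expn1 leq_pexp2l.
have ZX : (d ^ k <= X)%N by rewrite leq_pmulr // expn_gt0 n0.
have dX : (d <= X)%N by exact: leq_trans dZ ZX.
have nX : (n <= X)%N by apply: leq_trans n1 _; rewrite leq_pmull.
have X0 : (0 < X)%N by exact: leq_trans nX.
have ZnX : (d ^ k * n <= X)%N by rewrite leq_mul2l n1 orbT.
have gd : (half_block k d <= d)%N by rewrite leq_div.
eapply runs_weaken_ex.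
  eapply runs_seq_ex; first by apply: (hq st X X0); rewrite r1.
  move=> s1 f1; rewrite r1 -/(half_block k d) => g1.
  eapply runs_seq_ex; first by apply: (hp s1 X X0); rewrite (f1.1 1%N) // r1.
  move=> s2 f2; rewrite (f1.1 1%N) // r1 => z2.
  have [w1 w2] := power_cmd_frame k.
  have nr x : x \notin [:: 3; 4; 5]%N -> reg s2 x = reg s1 x.
    by move=> hx; apply: f2.1; apply: contra hx; exact: w1.
  have nc t q : cell s2 t q = cell s1 t q by apply: f2.2; rewrite w2.
  eapply runs_seq_ex; first by apply: (hi s2 X n X0 nX); rewrite nr // (f1.1 0%N).
  move=> s3 f3 [r7 c10].
  eapply runs_seq_ex.
    eapply (hs s3 n d u y) => //.
    - by rewrite (f3.1 0%N) // nr // (f1.1 0%N).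
    - by rewrite (f3.1 1%N) // nr // (f1.1 1%N).
    - by rewrite (f3.1 2%N) // nr.
    - by rewrite (f3.1 3%N).
    - by move=> q; rewrite (f3.2 0%N) // nc (f1.2 0%N).
    - by move=> q; rewrite (f3.2 1%N) // nc (f1.2 1%N).
  move=> s4 f4 [[a0 a1 a2 a3 a7] [au a24 ay aw]].
  rewrite subnn expn0 muln1 in a3 ay.
  eapply runs_seq_ex.
    eapply (hd s4 (d ^ k)%N (half_block k d ^ k)%N n (query_matrix k d u k)
       (alternating_answers k d y k)) => //.
    - by rewrite leq_exp2r_homo.
    - by move=> i; rewrite a24 // (f3.2 2%N) // nc (f1.2 2%N).
    - by move=> i; rewrite a24 // (f3.2 4%N) // nc (f1.2 4%N).
  move=> s5 f5 b2.
  have [|s6 rr6 h6] := hr s5 X n X0 nX.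
    by rewrite (f5.1 0%N).
  exists s6; first exact: rr6.
  by move=> i hin; rewrite h6 // b2.
have := leq_mul (leqnn Cs) ZnX.
by rewrite !mulnDl -/X; lia.
Qed.

End Attack.

(** * Finite differences and the top coefficient *)

Section FiniteDifferences.
Context {R : realType}.

Fixpoint fdiff (l : nat) (F : seq bool -> R) (bs : seq bool) : R :=
  if l is l'.+1 then fdiff l' F (rcons bs true) - fdiff l' F (rcons bs false) else F bs.

Lemma fdiff_sum (I : Type) (r : seq I) (c : I -> R) (F : I -> seq bool -> R) l bs :
  fdiff l (fun x => \sum_(i <- r) c i * F i x) bs = \sum_(i <- r) c i * fdiff l (F i) bs.
Proof.
elim: l bs => //= l IH bs; rewrite !IH -sumrB.
by apply: eq_bigr => i _; rewrite mulrBr.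
Qed.

Lemma fdiffB (F G : seq bool -> R) l bs :
  fdiff l (fun x => F x - G x) bs = fdiff l F bs - fdiff l G bs.
Proof. by elim: l bs => //= l IH bs; rewrite !IH; ring. Qed.

Lemma eq_fdiff (F G : seq bool -> R) l bs :
  (forall x, size x = (size bs + l)%N -> F x = G x) -> fdiff l F bs = fdiff l G bs.
Proof.
elim: l bs => [|l IH] bs h /=; first by apply: h; rewrite addn0.
by rewrite !IH // => x; rewrite size_rcons addSnnS => /h.
Qed.

Lemma fdiff_int (F : seq bool -> bool) l bs :
  exists p q : nat, fdiff l (fun x => (F x)%:R) bs = p%:R - q%:R.
Proof.
elim: l bs => [|l IH] bs /=; first by exists (F bs), 0%N; rewrite subr0.
have [p [q ->]] := IH (rcons bs true); have [p' [q' ->]] := IH (rcons bs false).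
by exists (p + q')%N, (q + p')%N; rewrite !natrD; ring.
Qed.

Definition smonomial (u : nat -> nat) (x : seq bool) : R :=
  \prod_(j < size x) (nth false x j)%:R ^+ u j.

Lemma smonomial_rcons u x b :
  smonomial u (rcons x b) = smonomial u x * b%:R ^+ u (size x).
Proof.
rewrite /smonomial size_rcons big_ord_recr /= nth_rcons ltnn eqxx.
congr (_ * _); apply: eq_bigr => j _.
by rewrite nth_rcons ltn_ord.
Qed.

Lemma fdiff_smonomial u l x : fdiff l (smonomial u) x =
  smonomial u x * \prod_(j < l) (0 < u (size x + j))%N%:R.
Proof.
elim: l x => [|l IH] x /=; first by rewrite big_ord0 mulr1.
rewrite !IH !smonomial_rcons !size_rcons expr1n mulr1 big_ord_recl /= addn0.
under [in RHS]eq_bigr do rewrite /bump /= add1n addnS -addSn.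
set P := \prod_(i < l) _; case: (u (size x)) => [|n]; first by rewrite expr0 /=; ring.
by rewrite exprS mul0r /=; ring.
Qed.

End FiniteDifferences.

(* The top coefficient of the multilinear representation is the full
   alternating sum of the values. *)
Section TopCoefficient.
Context {R : realType}.
Variables (m : nat) (f : m.+1.-tuple bool -> bool).

Definition seqfun (x : seq bool) : bool := f [tuple nth false x i | i < m.+1].

Lemma top_difference_neq0 : non_degenerate R f ->
  fdiff m (fun x => (seqfun (rcons x true))%:R) [::]
    - fdiff m (fun x => (seqfun (rcons x false))%:R) [::] != 0 :> R.
Proof.
move=> [p [ml rep sz]].
pose un (u : multinom m.+1) (j : nat) : nat := u (inord j).
have rep' x : size x = m.+1 -> (seqfun x)%:R =
    \sum_(u <- msupp p) mcoeff u p * smonomial (un u) x.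
  move=> sx; rewrite -rep mevalE; apply: eq_bigr => u _; congr (_ * _).
  rewrite /smonomial sx; apply: eq_bigr => i _.
  by rewrite tnth_mktuple /un inord_val.
have -> : fdiff m (fun x => (seqfun (rcons x true))%:R) [::]
    - fdiff m (fun x => (seqfun (rcons x false))%:R) [::]
    = \sum_(u <- msupp p) mcoeff u p * \prod_(j < m.+1) (0 < u j)%N%:R :> R.
  rewrite -fdiffB.
  rewrite (@eq_fdiff _ _ (fun x => \sum_(u <- msupp p)
      (mcoeff u p * (0 < un u m)%N%:R) * smonomial (un u) x)); last first.
    move=> x sx; rewrite !rep' ?size_rcons ?sx // -sumrB; apply: eq_bigr => u _.
    rewrite !smonomial_rcons sx expr1n add0n.
    by case: (un u m) => [|?]; rewrite ?expr0 ?exprS ?mul0r /=; ring.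
  rewrite fdiff_sum; apply: eq_bigr => u _.
  rewrite fdiff_smonomial /smonomial /= big_ord0 mul1r -mulrA; congr (_ * _).
  rewrite big_ord_recr /= mulrC; congr (_ * _).
    apply: eq_bigr => j _; congr (_ < _)%N%:R; rewrite /un add0n; congr (u _).
    by apply: val_inj; rewrite /= inordK // ltnS ltnW.
  by congr (_ < _)%N%:R; rewrite /un; congr (u _); apply: val_inj; rewrite /= inordK.
pose u1 : multinom m.+1 := Multinom [tuple 1%N | i < m.+1].
have u1E i : u1 i = 1%N by rewrite multinomE tnth_mktuple.
have all1 u : u \in msupp p -> (forall j, 0 < u j)%N -> u = u1.
  move=> up pos; apply/mnmP => i; rewrite u1E; apply/eqP.
  by rewrite eqn_leq (ml u up i) pos.
have u1p : u1 \in msupp p.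
  have p0 : p != 0 by apply/eqP => p0; move: sz; rewrite p0 msize0.
  have lp := mlead_supp p0.
  have dl : mdeg (mlead p) = m.+1.
    by apply/eqP; rewrite -eqSS mlead_deg // sz.
  suff -> : u1 = mlead p by [].
  apply/esym/all1 => // j; rewrite lt0n; apply/negP => /eqP j0.
  have : (mdeg (mlead p) < m.+1)%N.
    rewrite mdegE (bigD1 j) //= j0 add0n ltnS.
    apply: (@leq_trans (\sum_(i < m.+1 | i != j) 1)).
      by apply: leq_sum => i _; exact: ml.
    by rewrite sum1_card cardC1 card_ord.
  by rewrite dl ltnn.
rewrite (bigD1_seq u1) ?msupp_uniq //= [X in _ * X]big1 => [|j _]; last by rewrite u1E.
rewrite [X in _ + X]big1_seq ?addr0 ?mulr1 -?mcoeff_msupp //.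
move=> u /andP[nu up]; have [j j0] : exists j, u j = 0%N.
  apply/not_existsP => h; move/eqP: nu; apply; apply: all1 => // j.
  by rewrite lt0n; apply/eqP/h.
by rewrite (bigD1 j) //= j0 mul0r mulr0.
Qed.

End TopCoefficient.

(** * Alternating sums of the answers *)

Section AlternatingAnswers.
Context {R : realType}.
Variables (k d : nat).
Hypothesis k0 : (0 < k)%N.
Local Notation g := (half_block k d).

Lemma pair_column_lt (l t : nat) (b : bool) : (l < k)%N -> (t < g)%N ->
  (pair_offset k d l + 2 * t + b < d)%N.
Proof.
move=> lk tg; apply: leq_trans (half_block_le d k0).
rewrite /pair_offset; have : (2 * (k - l.+1) * g + 2 * g <= 2 * k * g)%N.
  by rewrite -mulnDl leq_mul2r; apply/orP; right; lia.
by case: b; lia.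
Qed.

Lemma alternating_linear (n : nat) (c : R) (y : nat -> R) (phi : nat -> nat -> R) (l p : nat) :
  alternating_answers k d y l p * c =
  \sum_(i < n) alternating_answers k d (phi i) l p
  + alternating_answers k d (fun a => y a * c - \sum_(i < n) phi i a) l p.
Proof.
elim: l p => [|l IH] p /=; first by rewrite addrC subrK.
by rewrite /difference mulrBl !IH sumrB; ring.
Qed.

Fixpoint digit_bits (r : nat -> bool) (j a : nat) : seq bool :=
  if j is j'.+1 then rcons (digit_bits r j' (a %/ d)) (r (a %% d)%N) else [::].

Lemma alternating_digit_bits (u : nat -> R) (r : nat -> bool) (i : nat) (F : seq bool -> R)
    (l tau h : nat) : (forall c, (c < d)%N -> u (i * d + c)%N = (r c)%:R) ->
  (l <= k)%N -> (tau < g ^ l)%N -> (h < d ^ (k - l))%N ->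
  alternating_answers k d (fun a => F (digit_bits r k a)) l (tau * d ^ (k - l) + h)
    = fdiff l F (digit_bits r (k - l) h) * query_matrix k d u l tau i.
Proof.
move=> ur; elim: l tau h => [|l IH] tau h lk.
  by rewrite expn0 ltnS leqn0 => /eqP-> _; rewrite subn0 mul0n add0n /= mulr1.
move=> tg hd.
have kE : (k - l = (k - l.+1).+1)%N by lia.
have gl0 : (0 < g ^ l)%N.
  by case: (posnP (g ^ l)) tg => // e; rewrite expnS e muln0.
have d0 : (0 < d ^ (k - l.+1))%N by apply: leq_ltn_trans hd.
set t := (tau %/ g ^ l)%N; set s := (tau %% g ^ l)%N.
have tauE : tau = (t * g ^ l + s)%N by exact: divn_eq.
have sl : (s < g ^ l)%N by rewrite ltn_mod.
have tlt : (t < g)%N by rewrite ltn_divLR // -expnS.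
set M := (g ^ l * d ^ (k - l.+1))%N.
have M0 : (0 < M)%N by rewrite muln_gt0 gl0.
have sM : (s * d ^ (k - l.+1) + h < M)%N.
  apply: (@leq_trans (s.+1 * d ^ (k - l.+1))); first by rewrite mulSn addnC ltn_add2r.
  by rewrite leq_mul2r sl orbT.
have qE : (tau * d ^ (k - l.+1) + h = t * M + (s * d ^ (k - l.+1) + h))%N.
  by rewrite {1}tauE /M mulnDl mulnA addnA.
rewrite /= /difference qE modnMDl divnMDl // modn_small // divn_small // addn0.
have col (b : bool) : (pair_offset k d l + 2 * t + b < d)%N by exact: pair_column_lt.
have main (b : bool) : alternating_answers k d (fun a => F (digit_bits r k a)) l
     ((s * d ^ (k - l.+1) + h) * d + (pair_offset k d l + 2 * t + b))
   = fdiff l F (rcons (digit_bits r (k - l.+1) h) (r (pair_offset k d l + 2 * t + b)%N))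
     * query_matrix k d u l s i.
  have -> : ((s * d ^ (k - l.+1) + h) * d + (pair_offset k d l + 2 * t + b)
      = s * d ^ (k - l) + (h * d + (pair_offset k d l + 2 * t + b)))%N.
    by rewrite mulnDl -mulnA -expnSr -kE -addnA.
  have c0 := col b; set c := (pair_offset k d l + 2 * t + b)%N in c0 *.
  have dd : (0 < d)%N by apply: leq_ltn_trans c0.
  rewrite IH ?(ltnW lk) //.
    by rewrite kE /= divnMDl // divn_small // modnMDl modn_small // addn0.
  rewrite kE expnSr; apply: (@leq_trans (h.+1 * d)).
    by rewrite mulSn addnC ltn_add2r.
  by rewrite leq_mul2r hd orbT.
have := main true; have := main false; rewrite addn0 addn1 => -> ->.
rewrite /column_product -/s -/t.
have := col true; have := col false; rewrite addn0 addn1 => c0 c1.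
rewrite !ur //; case: (r _); case: (r _); rewrite /=; ring.
Qed.

Lemma alternating_digit_bits_full (u : nat -> R) (r : nat -> bool) (i : nat)
    (F : seq bool -> R) (p : nat) :
  (forall c, (c < d)%N -> u (i * d + c)%N = (r c)%:R) -> (p < g ^ k)%N ->
  alternating_answers k d (fun a => F (digit_bits r k a)) k p
    = fdiff k F [::] * query_matrix k d u k p i.
Proof.
move=> ur pg; have := @alternating_digit_bits u r i F k p 0 ur (leqnn k) pg.
by rewrite subnn expn0 muln1 addn0; apply.
Qed.

Lemma difference_few_bad (G M o N1 N2 : nat) (e : nat -> R) (eps : R) :
  N1 = (G * M)%N -> N2 = (M * d)%N -> (o + 2 * G <= d)%N ->
  (#|[pred q : 'I_N1 | (2 * eps < `|difference d M o e q|)%R]|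
    <= #|[pred a : 'I_N2 | (eps < `|e a|)%R]|)%N.
Proof.
move=> -> -> oG.
pose src (b : bool) (q : nat) : nat := ((q %% M) * d + (o + 2 * (q %/ M) + b))%N.
have colq (q : 'I_(G * M)) (b : bool) : (o + 2 * (q %/ M) + b < d)%N.
  have M0 : (0 < M)%N by case: (M) q => //; rewrite muln0 => -[].
  have : (q %/ M < G)%N by rewrite ltn_divLR.
  by case: b; lia.
have srcP (q : 'I_(G * M)) (b : bool) : (src b q < M * d)%N.
  have M0 : (0 < M)%N by case: (M) q => //; rewrite muln0 => -[].
  have qM : (q %% M < M)%N by rewrite ltn_mod.
  apply: (@leq_trans ((q %% M).+1 * d)); last by rewrite leq_mul2r qM orbT.
  by rewrite /src mulSn addnC ltn_add2r colq.
pose pick1 (q : 'I_(G * M)) : bool := eps < `|e (src true q)|.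
pose h (q : 'I_(G * M)) : 'I_(M * d) := Ordinal (srcP q (pick1 q)).
have hinj : injective h.
  move=> q q' /(congr1 val) /= e1.
  have [e2 e3] := flat_inj (colq q _) (colq q' _) e1.
  have e4 : (q %/ M = q' %/ M)%N by case: (pick1 q) (pick1 q') e3 => -[] /=; lia.
  by apply: val_inj; rewrite /= (divn_eq q M) (divn_eq q' M) e2 e4.
rewrite -(card_imset _ hinj); apply: subset_leq_card; apply/fintype.subsetP => a /imsetP[q hq ->].
rewrite inE /= /h /=; case: (boolP (pick1 q)) => // npick.
move: hq; rewrite inE /difference => hq; rewrite ltNge; apply/negP => le0.
move: npick; rewrite /pick1 -leNgt /src addn1 => le1.
rewrite /src addn0 in le0.
move: hq; apply/negP; rewrite -leNgt; apply: le_trans (ler_normB _ _) _.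
by lra.
Qed.

Lemma alternating_few_bad (e : nat -> R) (eps : R) (l : nat) : (l <= k)%N ->
  (#|[pred q : 'I_(g ^ l * d ^ (k - l)) | (2 ^+ l * eps < `|alternating_answers k d e l q|)%R]|
    <= #|[pred a : 'I_(d ^ k) | (eps < `|e a|)%R]|)%N.
Proof.
elim: l => [|l IH] lk.
  by rewrite expn0 mul1n subn0 expr0 mul1r.
apply: leq_trans (IH (ltnW lk)).
rewrite exprS -mulrA; apply: difference_few_bad.
- by rewrite expnS mulnA.
- by rewrite -mulnA -expnSr; congr (_ * _ ^ _)%N; lia.
apply: leq_trans (half_block_le d k0); rewrite /pair_offset -mulnDl leq_mul2r.
by apply/orP; right; lia.
Qed.

End AlternatingAnswers.

Section StructuredAttributes.
Context {R : realType}.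
Variables (k d m : nat) (E : nat -> nat -> bool).
Hypothesis k0 : (0 < k)%N.
Local Notation g := (half_block k d).

(* Person i carries k digits in base m; the column pair t of position k-1-l
   encodes the sign E t (l-th digit of i) as (1, 0) or (0, 1). *)
Definition structured_bit (i c : nat) : bool :=
  E (c./2 %% g)%N ((i %/ m ^ (k.-1 - c./2 %/ g)) %% m)%N == odd c.

Lemma structured_pair (i l t : nat) : (l < k)%N -> (t < g)%N ->
  (structured_bit i (pair_offset k d l + 2 * t).+1)%:R
    - (structured_bit i (pair_offset k d l + 2 * t))%:R
  = bsign (E t ((i %/ m ^ l) %% m)%N) :> R.
Proof.
move=> lk tg; rewrite /structured_bit.
have g0 : (0 < g)%N by apply: leq_ltn_trans tg.
have cE : (pair_offset k d l + 2 * t = ((k - l.+1) * g + t).*2)%N.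
  by rewrite /pair_offset -mul2n; lia.
rewrite cE /= uphalf_double doubleK odd_double /= modnMDl modn_small //.
rewrite divnMDl // (divn_small tg) addn0.
have -> : (k.-1 - (k - l.+1) = l)%N by lia.
by case: (E _ _); rewrite /bsign /= ?subr0 ?sub0r.
Qed.

Lemma query_matrix_kron (u : nat -> R) (l p i : nat) :
  (forall c, (c < d)%N -> u (i * d + c)%N = (structured_bit i c)%:R) ->
  (l <= k)%N -> (p < g ^ l)%N ->
  query_matrix k d u l p i = kron g m (fun t c => bsign (E t c)) l p (i %% m ^ l)%N.
Proof.
move=> hu; elim: l p => //= l IH p lk pg.
have gl0 : (0 < g ^ l)%N by case: (posnP (g ^ l)) pg => // e; rewrite expnS e muln0.
have tlt : (p %/ g ^ l < g)%N by rewrite ltn_divLR // -expnS.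
have h0 := pair_column_lt k0 false lk tlt; have h1 := pair_column_lt k0 true lk tlt.
rewrite /= addn0 in h0; rewrite /= addn1 in h1.
rewrite /column_product IH ?ltn_mod ?(ltnW lk) // !hu // structured_pair //.
by rewrite expnS modn_dvdm ?dvdn_mull // -modn_divl.
Qed.

End StructuredAttributes.

(** * Correctness of the attack *)

Section FlatInput.
Context {R : realType}.

Definition reconstruction (k : nat) (averaged : bool) (sig a : R) : attack R k :=
  fun n d U y => \col_i attack_bit k averaged sig a n d
    (cell (input_state U y) 0) (cell (input_state U y) 1) i.

Lemma input_attributes (k n d : nat) (U : 'M[bool]_(n, d)) (y : answers R d k) (i : 'I_n) (c : 'I_d) :
  cell (input_state U y) 0 (i * d + c)%N = (U i c)%:R.
Proof.
rewrite /=; case: pickP => [[i' c'] /= /eqP h|/(_ (i, c))]; last by rewrite /= eqxx.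
have [e1 e2] := flat_inj (ltn_ord c') (ltn_ord c) h.
by congr (U _ _)%:R; apply: val_inj.
Qed.

Definition seq_code (d : nat) (J : seq 'I_d) : nat :=
  foldl (fun a (j : 'I_d) => (a * d + j)%N) 0%N J.

Lemma seq_code_rcons (d : nat) (J : seq 'I_d) j : seq_code (rcons J j) = (seq_code J * d + j)%N.
Proof. by rewrite /seq_code foldl_rcons. Qed.

Lemma seq_code_lt (d : nat) (J : seq 'I_d) : (seq_code J < d ^ size J)%N.
Proof.
elim/last_ind: J => [|J j IH]; first by rewrite expn0.
rewrite seq_code_rcons size_rcons expnSr; apply: (@leq_trans ((seq_code J).+1 * d)).
  by rewrite mulSn addnC ltn_add2r.
by rewrite leq_mul2r IH orbT.
Qed.

Lemma seq_code_inj (d : nat) (J J' : seq 'I_d) :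
  size J = size J' -> seq_code J = seq_code J' -> J = J'.
Proof.
elim/last_ind: J J' => [|J j IH] J'; first by case: J'.
elim/last_ind: J' => [|J' j' _]; first by rewrite size_rcons.
rewrite !size_rcons !seq_code_rcons => -[sJ] h.
have [e1 e2] := flat_inj (ltn_ord j) (ltn_ord j') h.
by rewrite (IH J') // (val_inj e2).
Qed.

Lemma digit_bits_code (d : nat) (r : nat -> bool) (J : seq 'I_d) :
  digit_bits d r (size J) (seq_code J) = [seq r (val j) | j <- J].
Proof.
elim/last_ind: J => [|J j IH] //=; rewrite size_rcons /= seq_code_rcons map_rcons.
have d0 : (0 < d)%N by apply: leq_ltn_trans (ltn_ord j).
by rewrite divnMDl // divn_small // addn0 modnMDl modn_small // IH.
Qed.

Lemma input_answers (k n d : nat) (U : 'M[bool]_(n, d)) (y : answers R d k) (J : k.-tuple 'I_d) :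
  cell (input_state U y) 1 (tuple_code J) = y J.
Proof.
rewrite /=; case: pickP => [J' /eqP h|/(_ J)]; last by rewrite eqxx.
by congr (y _); apply: val_inj; apply: seq_code_inj => //; rewrite !size_tuple.
Qed.

Lemma seqfunE (m : nat) (f : m.+1.-tuple bool -> bool) (t : m.+1.-tuple bool) :
  seqfun f t = f t.
Proof.
by congr f; apply: eq_from_tnth => i; rewrite tnth_mktuple (tnth_nth false).
Qed.

Lemma Sigma_flat (k n d : nat) (f : k.+1.-tuple bool -> bool) (U : 'M[bool]_(n, d))
    (s : 'cV[bool]_n) (J : k.-tuple 'I_d) (r : nat -> nat -> bool) :
  (forall (i : 'I_n) (c : 'I_d), r i c = U i c) ->
  Sigma R f (row_mx U s) J =
  \sum_(i < n) (seqfun f (rcons (digit_bits d (r i) k (tuple_code J)) (s i ord0)))%:R.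
Proof.
move=> rU; apply: eq_bigr => i _; rewrite row_mxKl row_mxKr -seqfunE /=.
have -> : digit_bits d (r i) k (tuple_code J) = [seq r i (val j) | j <- J].
  by rewrite -digit_bits_code size_tuple.
by congr (seqfun f (rcons _ _))%:R; apply: eq_map => j; rewrite rU.
Qed.

End FlatInput.

Section Correctness.
Context {R : realType}.
Variables (k d m : nat) (w : {ffun 'I_(half_block k d) -> {ffun 'I_m -> bool}}).
Hypotheses (k0 : (0 < k)%N) (m0 : (0 < m)%N) (g0 : (0 < half_block k d)%N).
Local Notation g := (half_block k d).
Local Notation n := (m ^ k)%N.
Variables (lam0 kap0 : R).
Hypotheses (lam00 : 0 < lam0) (kap00 : 0 < kap0).
Hypothesis section_w : forall x : 'I_m -> R,
  lam0 * g%:R * Num.sqrt (sqnorm x) <= \sum_j `|rademacher x (w j)| /\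
  sqnorm (fun j => rademacher x (w j)) <= kap0 ^+ 2 * g%:R * sqnorm x.

Definition flat_signs (t c : nat) : bool :=
  if insub t is Some t' then if insub c is Some c' then w t' c' else true else true.

Lemma flat_signsE (t : 'I_g) (c : 'I_m) : flat_signs t c = w t c.
Proof. by rewrite /flat_signs !valK. Qed.

Definition structured_attributes : 'M[bool]_(n, d) :=
  \matrix_(i, c) structured_bit k d m flat_signs i c.

Variables (f : k.+1.-tuple bool -> bool) (averaged : bool).

Definition level (b : bool) : R := fdiff k (fun x => (seqfun f (rcons x b))%:R) [::].

Hypothesis level_gap : 1 <= `|level true - level false|.

Variables (s : 'cV[bool]_n) (y : answers R d k) (eps gam : R).
Hypotheses (eps0 : 0 <= eps) (gam0 : 0 <= gam).
Hypothesis gam_small : gam * (4 * k%:R) ^+ k <= (lam0 ^+ k / (4 * kap0 ^+ k)) ^+ 2.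
Hypothesis mostly_accurate : (1 - gam) * (d ^ k)%:R <=
  #|[pred J | `|y J * scale averaged n - Sigma R f (row_mx structured_attributes s) J| <= eps]|%:R.

Lemma attack_hamming :
  (hamming s (reconstruction averaged (level true + level false)
     (level true - level false) structured_attributes y))%:R
  <= 4 * ((4 * (2 ^+ k * eps) + (level true ^+ 2 + level false ^+ 2) + (kap0 ^+ k) ^+ 2)
          / lam0 ^+ k) ^+ 2.
Proof.
set U := structured_attributes.
pose u := cell (input_state U y) 0; pose yf := cell (input_state U y) 1.
have n0 : (0 < n)%N by rewrite expn_gt0 m0.
pose N := (g ^ k)%N; have N0 : (0 < N)%N by rewrite expn_gt0 g0.
pose r i c := structured_bit k d m flat_signs i c.
have rU (i : 'I_n) (c : 'I_d) : r i c = U i c by rewrite mxE.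
have ur i c : (i < n)%N -> (c < d)%N -> u (i * d + c)%N = (r i c)%:R.
  by move=> hi hc; rewrite /u (input_attributes U y (Ordinal hi) (Ordinal hc)) -rU.
pose W := query_matrix k d u k.
pose z p := alternating_answers k d yf k p * scale averaged n.
pose Er t c : R := bsign (flat_signs t c).
have WE (p i : nat) : (p < N)%N -> (i < n)%N -> W p i = kron g m Er k p i.
  move=> pN hi; rewrite /W (query_matrix_kron (m := m) (E := flat_signs) k0 _ (leqnn k) pN).
    by rewrite modn_small.
  by move=> c hc; exact: ur.
have applyE (x : nat -> R) (p : 'I_N) : apply_mx n W x p = \sum_(c < n) kron g m Er k p c * x c.
  by apply: eq_bigr => i _; rewrite WE.
have ErE (x : nat -> R) (t : 'I_g) :
    \sum_(c < m) Er t c * x c = rademacher (fun c : 'I_m => x c) (w t).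
  by apply: eq_bigr => c _; rewrite /Er flat_signsE.
have lower (x : nat -> R) : lam0 ^+ k * N%:R * Num.sqrt (\sum_(i < n) x i ^+ 2)
    <= \sum_(p < N) `|apply_mx n W x p|.
  rewrite natrX -exprMn; under [X in _ <= X]eq_bigr do rewrite applyE.
  apply: kron_lower (ltW lam00) _ => v; under [X in _ <= X]eq_bigr do rewrite ErE.
  exact: (section_w (fun c => v c)).1.
have upper (x : nat -> R) : \sum_(p < N) apply_mx n W x p ^+ 2
    <= (kap0 ^+ k) ^+ 2 * N%:R * \sum_(i < n) x i ^+ 2.
  rewrite -exprM mulnC exprM natrX -exprMn; under eq_bigr do rewrite applyE.
  apply: kron_upper (sqr_ge0 _) _ => v; under eq_bigr do rewrite ErE.
  exact: (section_w (fun c => v c)).2.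
pose sb i : bool := if insub i is Some i' then s i' ord0 else false.
have sbE (i : 'I_n) : sb i = s i ord0 by rewrite /sb valK.
pose v i : R := level (sb i).
pose phi i a : R := (seqfun f (rcons (digit_bits d (r i) k a) (sb i)))%:R.
pose e a : R := yf a * scale averaged n - \sum_(i < n) phi i a.
have zE p : (p < N)%N -> z p = apply_mx n W v p + alternating_answers k d e k p.
  move=> pN; rewrite /z (alternating_linear k d n _ _ phi); congr (_ + _).
  apply: eq_bigr => i _; rewrite mulrC.
  exact: (@alternating_digit_bits_full R k d k0 u (r i) i
    (fun x => (seqfun f (rcons x (sb i)))%:R) p (fun c => ur i c (ltn_ord i)) pN).
have bad_e : #|[pred a : 'I_(d ^ k) | eps < `|e a|]|%:R <= gam * (d ^ k)%:R :> R.
  pose good := [pred a : 'I_(d ^ k) | `|e a| <= eps].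
  have codeP (J : k.-tuple 'I_d) : (tuple_code J < d ^ k)%N.
    by have := seq_code_lt J; rewrite size_tuple.
  pose code J := Ordinal (codeP J).
  have code_inj : injective code.
    move=> J J' /(congr1 val) /= h; apply: val_inj; apply: seq_code_inj => //.
    by rewrite !size_tuple.
  have eJ J : e (code J) = y J * scale averaged n - Sigma R f (row_mx U s) J.
    rewrite /e /yf input_answers (Sigma_flat f s J rU); congr (_ - _).
    by apply: eq_bigr => i _; rewrite /phi sbE.
  have : (1 - gam) * (d ^ k)%:R <= #|good|%:R.
    apply: le_trans mostly_accurate _; rewrite ler_nat -(card_imset _ code_inj).
    apply: subset_leq_card; apply/fintype.subsetP => a /imsetP[J hJ ->].
    by rewrite inE eJ.
  have -> : #|[pred a : 'I_(d ^ k) | eps < `|e a|]| = (d ^ k - #|good|)%N.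
    have := cardC good; rewrite [RHS]card_ord => cc.
    rewrite -[X in (X - _)%N]cc addKn; apply: eq_card => a.
    by rewrite !inE -ltNge.
  rewrite natrB; last by rewrite -[X in (_ <= X)%N]card_ord max_card.
  by lra.
have few_bad : #|[pred p : 'I_N | 2 ^+ k * eps < `|apply_mx n W v p - z p|]|%:R
    <= (lam0 ^+ k / (4 * kap0 ^+ k)) ^+ 2 * N%:R.
  apply: (@le_trans _ _ (gam * (d ^ k)%:R)).
    apply: le_trans bad_e; rewrite ler_nat.
    have := @alternating_few_bad R k d k0 e eps k (leqnn k).
    rewrite subnn expn0 muln1; apply: leq_trans; apply: subset_leq_card.
    apply/fintype.subsetP => p; rewrite !inE zE //.
    by rewrite opprD addrA subrr add0r normrN.
  have d4 : (d <= 4 * k * g)%N.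
    have : (d < g.+1 * (2 * k))%N by rewrite -ltn_divLR ?muln_gt0.
    by move=> dlt; apply: (leq_trans (ltnW dlt)); nia.
  apply: (@le_trans _ _ (gam * (4 * k%:R) ^+ k * N%:R)); last by rewrite ler_wpM2r.
  rewrite -mulrA ler_wpM2l // -(natrM _ 4) -natrX -natrM ler_nat -expnMn.
  exact: leq_exp2r_homo.
have lamk : 0 < lam0 ^+ k by rewrite exprn_gt0.
have kapk : 0 < kap0 ^+ k by rewrite exprn_gt0.
have e2 : 0 <= 2 ^+ k * eps by rewrite mulr_ge0 // exprn_ge0.
have := @descent_mean_close R N n W z N0 n0 _ (sqr_ge0 _) upper _ _ _ v lamk kapk e2 erefl lower few_bad.
set B := \sum_(i < n) (_ - _) ^+ 2 => close.
have vb : (\sum_(i < n) v i ^+ 2) / n%:R <= level true ^+ 2 + level false ^+ 2.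
  rewrite ler_pdivrMr ?ltr0n // mulr_natr -[X in _ *+ X]card_ord -sumr_const.
  apply: ler_sum => i _; rewrite /v.
  by have := sqr_ge0 (level true); have := sqr_ge0 (level false); case: (sb i); lra.
apply: (@le_trans _ _ (4 * B)).
  rewrite /hamming -sum1_card natr_sum mulr_sumr big_mkcond /=; apply: ler_sum => i _.
  case: ifP => [|_]; last by rewrite mulr_ge0 // sqr_ge0.
  rewrite inE mxE => hi.
  have -> : v i = if s i ord0 then level true else level false.
    by rewrite /v sbE; case: (s i ord0).
  apply: rounding_correct => //; rewrite [level false + _]addrC.
  have nR : 0 < n%:R :> R by rewrite ltr0n.
  have bitE (A L a : R) : (0 <= (2 * A - L * n%:R) * a) = (0 <= (2 * (A / n%:R) - L) * a).
    rewrite (_ : (2 * A - L * n%:R) * a = (2 * (A / n%:R) - L) * a * n%:R).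
      by rewrite pmulr_lge0.
    by field; rewrite gt_eqF.
  by move: hi; rewrite /attack_bit bitE.
rewrite ler_wpM2l //; apply: le_trans close _.
have v0 : 0 <= (\sum_(i < n) v i ^+ 2) / n%:R.
  by rewrite divr_ge0 // sumr_ge0 // => i _; exact: sqr_ge0.
have k2 := sqr_ge0 (kap0 ^+ k).
rewrite lerXn2r ?nnegrE ?divr_ge0 ?(ltW lamk) //; try lra.
by rewrite ler_wpM2r ?invr_ge0 ?(ltW lamk) //; lra.
Qed.

End Correctness.

Section Measurability.
Context {R : realType} (disp : measure_display) (T : measurableType disp).

Lemma measurable_alternating_answers (k d : nat) (y : T -> nat -> R) (l p : nat) :
  (forall a, measurable_fun setT (fun w => y w a)) ->
  measurable_fun setT (fun w => alternating_answers k d (y w) l p).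
Proof.
move=> my; elim: l p => [|l IH] p /=; first exact: my.
by apply: measurable_funB; exact: IH.
Qed.

Lemma measurable_descent (N n : nat) (W : nat -> nat -> R) (z : T -> nat -> R) (t i : nat) :
  (forall p, measurable_fun setT (fun w => z w p)) ->
  measurable_fun setT (fun w => descent N n W (z w) t i).
Proof.
move=> mz; elim: t i => [|t IH] i /=; first exact: measurable_cst.
apply: measurable_funB; first exact: IH.
apply: measurable_sum => p; apply: measurable_funM; last exact: measurable_cst.
apply: measurable_funM; last exact: measurable_cst.
apply: measurable_fun_ifT; try exact: measurable_cst.
apply: measurable_fun_ler; first exact: mz.
by apply: measurable_sum => j; apply: measurable_funM; [exact: measurable_cst|exact: IH].
Qed.

Lemma measurable_attack_bit (k : nat) (averaged : bool) (sig a : R) (n d : nat)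
    (u : nat -> R) (y : T -> nat -> R) (i : nat) :
  (forall p, measurable_fun setT (fun w => y w p)) ->
  measurable_fun setT (fun w => attack_bit k averaged sig a n d u (y w) i).
Proof.
move=> my; apply: measurable_fun_ler; first exact: measurable_cst.
apply: measurable_funM; last exact: measurable_cst.
apply: measurable_funB; last exact: measurable_cst.
apply: measurable_funM; first exact: measurable_cst.
apply: measurable_sum => t; apply: measurable_descent => p.
apply: measurable_funM; last exact: measurable_cst.
exact: measurable_alternating_answers.
Qed.

End Measurability.

Lemma measurable_success {R : realType} (k n d : nat) (averaged : bool) (sig a alpha : R)
    (M : mechanism R n d k) (U : 'M[bool]_(n, d)) (s : 'cV[bool]_n) :
  measurable [set w | (hamming s (@reconstruction R k averaged sig a n d U
    (M (row_mx U s) w)))%:R <= alpha].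
Proof.
rewrite -[X in measurable X]setTI.
pose y w := cell (input_state U (M (row_mx U s) w)) 1.
have my p : measurable_fun setT (fun w => y w p).
  rewrite /y /=; case: pickP => [J _|_]; last exact: measurable_cst.
  exact: release_measurable.
pose u := cell (input_state U (fun _ : k.-tuple 'I_d => 0 : R)) 0.
have ham w : (hamming s (@reconstruction R k averaged sig a n d U (M (row_mx U s) w)))%:R
    = \sum_(i < n) (if attack_bit k averaged sig a n d u (y w) i
                    then (~~ s i ord0)%:R else (s i ord0)%:R) :> R.
  rewrite /hamming -sum1_card natr_sum big_mkcond /=; apply: eq_bigr => i _.
  rewrite inE mxE -/(y w) -/u.
  by case: attack_bit; case: (s i ord0).
have : measurable_fun setT (fun w =>
    (hamming s (@reconstruction R k averaged sig a n d U (M (row_mx U s) w)))%:R <= alpha).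
  apply: measurable_fun_ler; last exact: measurable_cst.
  rewrite (_ : (fun w => _) = (fun w => \sum_(i < n)
      (if attack_bit k averaged sig a n d u (y w) i
       then (~~ s i ord0)%:R else (s i ord0)%:R))); last by apply/funext => w; exact: ham.
  apply: measurable_sum => i; apply: measurable_fun_ifT; try exact: measurable_cst.
  exact: measurable_attack_bit.
by move=> /(_ measurableT [set true] I).
Qed.

Lemma ae_success {R : realType} (d : measure_display) (T : measurableType d)
    (P : probability T R) (A B : set T) :
  measurable A -> {ae P, forall w, B w} -> B `<=` A -> P A = 1%E.
Proof.
move=> mA aeB BA.
have mC : measurable (~` A) by exact: measurableC.
have PC : P (~` A) = 0%E.
  apply/(negligibleP P mC); apply: negligibleS aeB.
  by move=> w /= nA nB; apply: nA; exact: BA.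
by rewrite -[A]setCK probability_setC // PC sube0.
Qed.

Lemma nat_dist_ge1 {R : realType} (a b : nat) : a%:R - b%:R != 0 :> R ->
  1 <= `|a%:R - b%:R| :> R.
Proof.
rewrite subr_eq0 eqr_nat neq_ltn => /orP[ab|ab]; first rewrite distrC.
  by rewrite -natrB ?(ltnW ab) // normr_nat ler1n subn_gt0.
by rewrite -natrB ?(ltnW ab) // normr_nat ler1n subn_gt0.
Qed.

Lemma iterlog_ge1 {R : realType} (q : nat) (t : R) : (0 < q)%N -> 1 <= iterlog q t.
Proof. by case: q => // q _ /=; rewrite le_max lexx orbT. Qed.

Lemma admissible_le {R : realType} (k q C m d : nat) : (0 < k)%N -> (0 < q)%N -> (0 < C)%N ->
  admissible k q ((C%:R ^+ k)^-1 : R) (m ^ k) d -> (C * m <= d)%N.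
Proof.
move=> k0 q0 C0; rewrite /admissible => h.
have L1 := @iterlog_ge1 R q d%:R q0.
have CR : 0 < C%:R ^+ k :> R by rewrite exprn_gt0 // ltr0n.
have {h} : (m ^ k)%:R <= (C%:R ^+ k)^-1 * d%:R ^+ k :> R.
  apply: le_trans h _; apply: ler_piMr.
    by rewrite mulr_ge0 ?invr_ge0 ?exprn_ge0 // ltW.
  by rewrite invf_le1 // (lt_le_trans _ L1).
rewrite mulrC ler_pdivlMr // -!natrX -natrM ler_nat -expnMn leq_exp2r //.
by rewrite mulnC.
Qed.

Lemma admissible_gt0 {R : realType} (k q : nat) (c : R) (n d : nat) : (0 < k)%N -> (0 < n)%N ->
  admissible k q c n d -> (0 < d)%N.
Proof.
move=> k0 n0; case: d => // h; exfalso; move: h.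
by rewrite /admissible expr0n gtn_eqF // mulr0 mul0r lern0 gtn_eqF.
Qed.

Lemma square_littleo {R : realType} (A B : R) (eps : nat -> R) (nu : nat -> nat) :
  (forall n, 0 <= eps n) -> 0 <= A -> 0 <= B ->
  (forall del : R, 0 < del -> \forall n \near \oo, eps n <= del * Num.sqrt n%:R) ->
  (forall i, (i < nu i)%N) ->
  (fun i => (A * eps (nu i) + B) ^+ 2) =o_\oo (fun i => (nu i)%:R : R).
Proof.
move=> e0 A0 B0 heps hnu; apply/eqoP => del del0.
pose del' := Num.sqrt (del / (4 * (A ^+ 2 + 1))).
have A1 : 0 < 4 * (A ^+ 2 + 1) by have := sqr_ge0 A; lra.
have d'2 : del' ^+ 2 = del / (4 * (A ^+ 2 + 1)) by rewrite sqr_sqrtr // divr_ge0 // ltW.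
have del'0 : 0 < del' by rewrite sqrtr_gt0 divr_gt0.
have [N1 _ hN1] := heps del' del'0.
pose N2 := (Num.trunc (4 * B ^+ 2 / del)).+1.
exists (N1 + N2)%N => // i /= Ni.
have ni := hnu i.
have {}hN1 : eps (nu i) <= del' * Num.sqrt (nu i)%:R.
  by apply: hN1 => /=; lia.
have hN2 : 4 * B ^+ 2 / del <= (nu i)%:R.
  apply: le_trans (ltW (truncnS_gt _)) _; rewrite ler_nat -/N2; lia.
rewrite ger0_norm ?sqr_ge0 // ger0_norm ?ler0n //.
have e2 : eps (nu i) ^+ 2 <= del / (4 * (A ^+ 2 + 1)) * (nu i)%:R.
  rewrite -d'2 -[(nu i)%:R]sqr_sqrtr ?ler0n // -exprMn lerXn2r // nnegrE //.
  by rewrite mulr_ge0 ?sqrtr_ge0.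
have e3 : 4 * A ^+ 2 * eps (nu i) ^+ 2 <= del * (nu i)%:R.
  apply: (@le_trans _ _ (4 * (A ^+ 2 + 1) * eps (nu i) ^+ 2)).
    by rewrite ler_wpM2r ?sqr_ge0 //; lra.
  by move: e2; rewrite mulrAC ler_pdivlMr // mulrC.
have e4 : 4 * B ^+ 2 <= (nu i)%:R * del by move: hN2; rewrite ler_pdivrMr.
have := sqr_ge0 (A * eps (nu i) - B).
have -> : (A * eps (nu i) - B) ^+ 2 = A ^+ 2 * eps (nu i) ^+ 2 - 2 * (A * eps (nu i) * B) + B ^+ 2 by ring.
have -> : (A * eps (nu i) + B) ^+ 2 = A ^+ 2 * eps (nu i) ^+ 2 + 2 * (A * eps (nu i) * B) + B ^+ 2 by ring.
by lra.
Qed.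

Lemma scaled_error_littleo {R : realType} (averaged : bool) (err : nat -> R) :
  err =o_\oo (noise_rate R averaged) -> forall del : R, 0 < del ->
  \forall n \near \oo, scale averaged n * `|err n| <= del * Num.sqrt n%:R.
Proof.
move=> /eqoP h del del0; have [N _ hN] := h del del0.
exists N.+1 => // n /= Nn; have := hN n (ltnW Nn).
have nR : 0 < n%:R :> R by rewrite ltr0n; apply: leq_trans Nn.
rewrite /noise_rate /scale; case: averaged {h hN}; last first.
  by rewrite mul1r [X in _ <= _ * X -> _]ger0_norm ?sqrtr_ge0.
rewrite [X in _ <= _ * X -> _]ger0_norm ?invr_ge0 ?sqrtr_ge0 // => h.
have s0 : 0 < Num.sqrt n%:R :> R by rewrite sqrtr_gt0.
apply: (@le_trans _ _ (n%:R * (del / Num.sqrt n%:R))); first by rewrite ler_wpM2l // ltW.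
by rewrite -{1}[n%:R]sqr_sqrtr ?ler0n // le_eqVlt; apply/orP; left; apply/eqP; field; rewrite gt_eqF.
Qed.

Lemma program_computes {R : realType} (k q : nat) (averaged : bool) (p1 q1 p2 q2 : nat) :
  (0 < k)%N -> exists C : R, forall (c : R) (n d : nat), (0 < n)%N -> admissible k q c n d ->
  computes_within (attack_program k averaged p1 q1 p2 q2)
    (@reconstruction R k averaged (p1%:R - q1%:R) (p2%:R - q2%:R)) n d
    (C * (d%:R ^+ (2 * k) * n%:R ^+ 3 + d%:R `^ (5 / 2 * k%:R) * n%:R ^+ 2)).
Proof.
move=> k0; have [C hC] := @attack_programP R k averaged p1 q1 p2 q2 k0.
exists C%:R => c n d n0 adm U y; have d0 := admissible_gt0 k0 n0 adm.
have [//|//|//|//|st [T e TC] h] := hC (input_state U y) n d (cell (input_state U y) 0)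
  (cell (input_state U y) 1) n0 d0 erefl erefl _ _ _ _.
exists st, T; split=> //.
  apply/matrixP => i j; rewrite !mxE h //.
  by case: attack_bit; rewrite ?oner_eq0 ?eqxx.
apply: (@le_trans _ _ (C%:R * (d ^ k * n ^ 2)%:R)); first by rewrite -natrM ler_nat.
rewrite ler_wpM2l // ler_wpDr ?mulr_ge0 ?powR_ge0 ?exprn_ge0 //.
rewrite -!natrX -natrM ler_nat leq_mul // leq_pexp2l //; lia.
Qed.

Unset Implicit Arguments.

Theorem theorem3p6 (R : realType) (k q : nat) (hk : (1 <= k)%N)
    (hq : (1 <= q)%N) :
  exists c gamma : R, [/\ 0 < c, 0 < gamma &
  forall f : k.+1.-tuple bool -> bool, non_degenerate R f ->
  forall averaged : bool,
  exists (A : attack R k) (P : cmd) (C : R),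
    (forall n d : nat, (0 < n)%N -> admissible k q c n d ->
       computes_within P A n d
         (C * (d%:R ^+ (2 * k) * n%:R ^+ 3
               + d%:R `^ (5 / 2 * k%:R) * n%:R ^+ 2)))
    /\
    (forall d : nat -> nat, (forall n : nat, admissible k q c n (d n)) ->
     forall M : (forall n : nat, mechanism R n (d n) k),
       accurate averaged f gamma M ->
       attribute_nonprivate_by A M)].
Proof.
have [C0 [lam [kap [lam0 kap0 hsec]]]] := @sign_euclidean_section R.
pose C1 := (C0.+1 * (2 * k))%N.
have C10 : (0 < C1)%N by rewrite !muln_gt0.
have lamk : 0 < lam ^+ k by rewrite exprn_gt0.
have kapk : 0 < kap ^+ k by rewrite exprn_gt0.
have k4 : 0 < (4 * k%:R) ^+ k :> R by rewrite exprn_gt0 // mulr_gt0 // ltr0n.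
pose gam : R := (lam ^+ k / (4 * kap ^+ k)) ^+ 2 / (4 * k%:R) ^+ k.
have gam0 : 0 < gam by rewrite divr_gt0 // exprn_gt0 // divr_gt0 // mulr_gt0.
exists ((C1%:R ^+ k)^-1), gam; split=> //.
  by rewrite invr_gt0 exprn_gt0 // ltr0n.
move=> f ndf averaged.
have [p1 [q1 e1]] := @fdiff_int R (fun x => seqfun f (rcons x true)) k [::].
have [p0 [q0 e0]] := @fdiff_int R (fun x => seqfun f (rcons x false)) k [::].
have e1' : level f true = p1%:R - q1%:R :> R := e1.
have e0' : level f false = p0%:R - q0%:R :> R := e0.
have sigE : level f true + level f false = (p1 + p0)%:R - (q1 + q0)%:R :> R.
  by rewrite e1' e0' !natrD; ring.
have gapE : level f true - level f false = (p1 + q0)%:R - (q1 + p0)%:R :> R.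
  by rewrite e1' e0' !natrD; ring.
have gap1 : 1 <= `|level f true - level f false| :> R.
  by rewrite gapE; apply: nat_dist_ge1; rewrite -gapE; exact: top_difference_neq0.
have [C hC] := @program_computes R k q averaged (p1 + p0) (q1 + q0) (p1 + q0) (q1 + p0) hk.
rewrite -sigE -gapE in hC.
exists (reconstruction averaged (level f true + level f false) (level f true - level f false)).
exists (attack_program k averaged (p1 + p0) (q1 + q0) (p1 + q0) (q1 + p0)), C.
split=> [n d n0 adm|d adm M [err erro acc]]; first exact: hC n0 adm.
pose nu i := (i.+1 ^ k)%N.
pose eps n := scale averaged n * `|err n|.
have scale0 n : 0 <= scale averaged n :> R by rewrite /scale; case: (averaged).
have eps0 n : 0 <= eps n by rewrite mulr_ge0.
pose B0 : R := (level f true ^+ 2 + level f false ^+ 2) + (kap ^+ k) ^+ 2.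
have B00 : 0 <= B0 by rewrite !addr_ge0 // sqr_ge0.
pose A1 : R := 8 * 2 ^+ k / lam ^+ k; pose B1 : R := 2 * B0 / lam ^+ k.
exists nu, (fun i => (A1 * eps (nu i) + B1) ^+ 2), (fun=> 0); split.
- by move=> i j ij; rewrite ltn_exp2r.
- apply: square_littleo => //.
  + by rewrite divr_ge0 ?mulr_ge0 ?exprn_ge0 // ltW.
  + by rewrite divr_ge0 ?mulr_ge0 // ltW.
  + exact: scaled_error_littleo.
  + by move=> i; rewrite -[X in (X < _)%N]/i.+1.-1 /nu -{1}[i.+1]expn1 leq_pexp2l.
- by apply/eqoP => del del0; near=> i; rewrite normr0 mulr_ge0 // ltW.
move=> i; set n := nu i; set m := i.+1.
have n0 : (0 < n)%N by rewrite expn_gt0.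
have Cm : (C1 * m <= d n)%N by exact: (admissible_le hk hq C10 (adm n)).
have gm : (C0.+1 * m <= half_block k (d n))%N.
  by rewrite leq_divRL ?muln_gt0 // mulnAC.
have g0 : (0 < half_block k (d n))%N by apply: leq_trans gm; rewrite muln_gt0.
have [|w hw] := hsec (half_block k (d n)) m isT.
  by apply: leq_trans gm; rewrite leq_mul2r leqnSn orbT.
exists (structured_attributes w) => s /=.
set ok := [set w | _].
have mok : measurable ok by exact: measurable_success.
split=> //.
rewrite (ae_success mok (acc n n0 (row_mx (structured_attributes w) s))) ?subr0 //.
move=> x /= hx; rewrite /ok /=.
have hx' : (1 - gam) * (d n ^ k)%:R <=
    #|[pred J | `|M n (row_mx (structured_attributes w) s) x J * scale averaged n
       - Sigma R f (row_mx (structured_attributes w) s) J| <= eps n]|%:R.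
  apply: le_trans hx _; rewrite ler_nat; apply: subset_leq_card.
  apply/fintype.subsetP => J; rewrite !inE /target /eps /scale => hJ.
  have {}hJ := le_trans hJ (ler_norm _).
  move: hJ; case: (averaged) => hJ; last by rewrite mulr1 mul1r.
  have nR : 0 < n%:R :> R by rewrite ltr0n.
  rewrite -[Sigma R f _ J](divfK (lt0r_neq0 nR)) -mulrBl normrM [`|n%:R|]gtr0_norm // mulrC.
  by rewrite ler_wpM2l // ltW.
have gam_small : gam * (4 * k%:R) ^+ k <= (lam ^+ k / (4 * kap ^+ k)) ^+ 2.
  by rewrite divfK // gt_eqF.
have := attack_hamming hk (ltn0Sn i) g0 lam0 kap0 hw gap1 (eps0 n) (ltW gam0) gam_small hx'.
move=> /le_trans; apply.
rewrite le_eqVlt; apply/orP; left; apply/eqP.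
by rewrite /A1 /B1 /B0; field; rewrite gt_eqF.
Unshelve. all: by end_near.
Qed.
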